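(* Let $G$ be a finite planar loopless multigraph with $G\neq K_1$ and $w(G)\ge 0$, and suppose that $G/\mathcal{P}\notin\mathcal{N}$ for every partition $\mathcal{P}$ of $V(G)$. Then at least one of the following holds. (1) $G$ contains a proper subgraph that is $\mathcal{N}$-good. (2) One can perform some liftings in $G$ such that the resulting graph $G'$ contains an $\mathcal{N}$-good subgraph $H$ for which $G'/H$ is $\mathcal{S}$-good. (3) One can perform some liftings at a single vertex $v$ of $G$ such that the resulting graph $G''$ satisfies: $G''-v$ is $\mathcal{S}$-good, and $G''/\mathcal{P}\notin\mathcal{N}$ for every partition $\mathcal{P}$ of $V(G'')$. (4) $v(G)\le 4$.
   Context: Graphs may have parallel edges but no loops. A partition of $V(G)$ always means a partition into at least two parts; it is trivial if every part is a singleton, and nontrivial otherwise. For a partition $\mathcal{P}=\{P_1,\dots,P_t\}$ of $V(G)$, $G/\mathcal{P}$ is the graph obtained by identifying, for each $i$, all vertices of $P_i$ into one vertex and deleting the resulting loops. For a connected subgraph $H$, $G/H$ is obtained by contracting all edges of $H$ (identifying $V(H)$ into one vertex) and deleting loops. The weight of a partition is $w_G(\mathcal{P})=\sum_{i=1}^t d(P_i)-23t+42$, where $d(P_i)$ is the number of edges with exactly one endpoint in $P_i$, and $w(G)=\min_{\mathcal{P}} w_G(\mathcal{P})$ over all partitions. $\alpha K_2$ denotes two vertices joined by $\alpha\ge1$ parallel edges; $T_{a,b,c}$ ($\min\{a,b,c\}\ge1$) denotes the multigraph on three vertices whose three pairs are joined by $a$, $b$, $c$ parallel edges respectively. Let $\mathcal{N}=\{\alpha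 K_2:\alpha\le 7\}\cup\{T_{a,b,c}:a+b+c\le 15\}$ and $\mathcal{W}^*=\{8K_2\}\cup\{T_{a,b,c}: a+b+c=16,\ \delta(T_{a,b,c})\ge 9\}$ (membership up to isomorphism). A connected graph $G$ with $v(G)\ge2$ is $\mathcal{N}$-good if $w(G)\ge0$, $G\notin\mathcal{N}$, and $G/\mathcal{Q}\notin\mathcal{N}\cup\mathcal{W}^*$ for every nontrivial partition $\mathcal{Q}$; it is $\mathcal{S}$-good if $w(G)\ge0$ and $G/\mathcal{P}\notin\mathcal{N}\cup\mathcal{W}^*$ for every partition $\mathcal{P}$. Lifting a pair of edges $xv,vy$ (with $x,v,y$ distinct) at $v$ means deleting $xv$ and $vy$ and adding a new edge $xy$. *)

(* Defs.v *)
From mathcomp Require Import all_boot all_order all_algebra all_fingroup.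
Set Implicit Arguments. Unset Strict Implicit. Unset Printing Implicit Defensive.
Import GRing.Theory Num.Theory.

(* A multigraph on an ambient finite type V: vertex set [vset] and, for each
   pair of vertices, the number [mult x y] of parallel edges between them. *)
Record mgraph (V : finType) := MG { vset : {set V}; mult : V -> V -> nat }.
Arguments MG {V}.

Section Graphs.
Variable V : finType.
Implicit Types (G H : mgraph V) (X A : {set V}) (P : {set {set V}}).

Definition wf G :=
  [/\ forall x y, mult G x y = mult G y x,
      forall x, mult G x x = 0 &
      forall x y, 0 < mult G x y -> x \in vset G /\ y \in vset G].

Definition connected G :=
  vset G != set0 /\
  forall X, X \proper vset G -> X != set0 ->
    exists x y, [/\ x \in X, y \in vset G :\: X & 0 < mult G x y].

Definition is_part G P := partition P (vset G) && (1 < #|P|).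
Definition nontrivial P := exists2 A, A \in P & 1 < #|A|.

Definition dout G A : nat := \sum_(x in A) \sum_(y in vset G :\: A) mult G x y.

Definition wG G P : int :=
  (\sum_(A in P) (dout G A)%:Z - 23 * (#|P|)%:Z + 42)%R.

(* w(G) >= 0, i.e. the minimum of w_G(P) over all partitions P is >= 0 *)
Definition w_ge0 G := forall P, is_part G P -> (0 <= wG G P)%R.

Definition quot G P : mgraph {set V} :=
  MG P (fun A B => if [&& A \in P, B \in P & A != B]
                   then \sum_(x in A) \sum_(y in B) mult G x y else 0).

Definition contract G X : mgraph {set V} :=
  quot G (X |: [set [set x] | x in vset G :\: X]).

Definition delv G v : mgraph V :=
  MG (vset G :\ v) (fun a b => if (a != v) && (b != v) then mult G a b else 0).

Definition subgraph H G :=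
  [/\ wf H, vset H \subset vset G & forall x y, mult H x y <= mult G x y].
Definition proper_subgraph H G :=
  subgraph H G /\ (vset H != vset G \/ exists x y, mult H x y < mult G x y).

Definition degree G x := \sum_(y in vset G) mult G x y.

Definition epair (a b x y : V) : nat := ((a == x) && (b == y)) || ((a == y) && (b == x)).
Definition lift1 (v : V) G G' :=
  exists x y, [/\ [&& x != v, y != v & x != y], 0 < mult G x v, 0 < mult G v y,
     vset G' = vset G &
     forall a b, mult G' a b = mult G a b - epair a b x v - epair a b v y + epair a b x y].

Inductive liftseq (Q : V -> Prop) : mgraph V -> mgraph V -> Prop :=
| liftseq0 G : liftseq Q G G
| liftseqS G G1 G2 v : Q v -> lift1 v G G1 -> liftseq Q G1 G2 -> liftseq Q G G2.

Definition lifts G G' := liftseq (fun _ => True) G G'.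
Definition lifts_at v G G' := liftseq (fun u => u = v) G G'.

(* Planarity via combinatorial embeddings (rotation systems): darts D, a
   fixed-point-free involution [inv] pairing the two darts of an edge, and a
   rotation [rot] cyclically ordering the darts at each vertex; the embedding
   is planar iff every component has Euler characteristic 2:
   n' - |D|/2 + #faces = 2 * #components (n' = vertices incident to darts;
   isolated vertices are trivially planar). *)
Definition planar G :=
  exists (D : finType) (tail : D -> V) (inv rot : {perm D}),
  [/\ forall d, inv (inv d) = d /\ inv d != d,
      forall x y, #|[set d | (tail d == x) && (tail (inv d) == y)]| = mult G x y,
      forall d, porbit rot d = [set e | tail e == tail d] &
      let r := fun d e : D => (e == inv d) || (e == rot d) in
      let ncomp := #|[set [set e | connect r d e] | d : D]| in
      let nvert := #|[set tail d | d : D]| in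
      let nface := #|porbits (inv * rot)%g| in
      2 * nvert + 2 * nface = #|D| + 4 * ncomp].

End Graphs.

Definition iso (V W : finType) (G : mgraph V) (H : mgraph W) :=
  exists f : V -> W, [/\ {in vset G &, injective f}, f @: vset G = vset H &
     {in vset G &, forall x y, mult H (f x) (f y) = mult G x y}].

Definition K2 (alpha : nat) : mgraph 'I_2 :=
  MG setT (fun i j : 'I_2 => if i != j then alpha else 0).

(* T_{a,b,c} on vertices 0,1,2 : a edges 01, b edges 12, c edges 02 *)
Definition T3 (a b c : nat) : mgraph 'I_3 :=
  MG setT (fun i j : 'I_3 =>
    if i == j then 0
    else if (i : nat) + j == 1 then a
    else if (i : nat) + j == 3 then b
    else c).

Definition inN (V : finType) (G : mgraph V) :=
  (exists alpha, [/\ 1 <= alpha, alpha <= 7 & iso G (K2 alpha)]) \/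
  (exists a b c, [/\ [&& 1 <= a, 1 <= b & 1 <= c], a + b + c <= 15 & iso G (T3 a b c)]).

Definition inWstar (V : finType) (G : mgraph V) :=
  iso G (K2 8) \/
  (exists a b c, [/\ [&& 1 <= a, 1 <= b & 1 <= c], a + b + c = 16,
      (forall i : 'I_3, 9 <= degree (T3 a b c) i) & iso G (T3 a b c)]).

Definition Ngood (V : finType) (G : mgraph V) :=
  [/\ connected G, 2 <= #|vset G|, w_ge0 G, ~ inN G &
      forall Q, is_part G Q -> nontrivial Q -> ~ inN (quot G Q) /\ ~ inWstar (quot G Q)].

Definition Sgood (V : finType) (G : mgraph V) :=
  [/\ connected G, 2 <= #|vset G|, w_ge0 G &
      forall P, is_part G P -> ~ inN (quot G P) /\ ~ inWstar (quot G P)].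

(* Main.v *)
(* For a vertex set A let def(A) = 23 (|A| - 1) - 2 e(A).  The weight of a
   partition P exceeds that of the partition into singletons by the sum of def
   over the parts of P.  If G has no proper N-good subgraph, then def(A) is at
   least 9, 16 or 20 for a proper subset A of size 2, 3 or at least 4, because a
   smallest violator induces an N-good subgraph.  So nontrivial partitions have
   large weight, and a few liftings cannot spoil them.  This gives outcome (3)
   when G has five vertices or a vertex of degree at most 14, and outcome (2)
   whenever a few liftings along short paths create 8K_2, T_{6,6,4} or a 4-cycle
   with multiplicities 7, 6, 6, 6.

   If none of this applies, give a non-digon face of length l, bounded by bundles
   of m_1, ..., m_l parallel edges, the charge 46 - 23 l + 2 (m_1 + ... + m_l).
   By Euler's formula and w(G) >= 0 the charges sum to at least 8.  Short paths
   being unavailable for liftings, the only faces of positive charge are the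
   triangles with bundles (6,6,1), (6,5,1), (5,5,2), (4,4,4) and the 4-faces with
   bundles (6,6,6,6); for the same reason each of them obtains its excess from
   the faces across its bundles of size at least 4, which can afford it. *)
Require Import Defs.
From mathcomp Require Import all_boot all_order all_algebra all_fingroup.
From mathcomp Require Import zify.
From Stdlib Require Import Classical_Prop.
Set Implicit Arguments. Unset Strict Implicit. Unset Printing Implicit Defensive.

(** * Edge sums and partitions *)

(* Elaboration wraps the canonical structures of iterated set types in
   [reverse_coercion], which hides equal cardinals from [lia]. *)
Ltac slia :=
  cbv beta iota delta
    [reverse_coercion finset_set_of__canonical__fintype_Finite Finite.sort] in *; lia.

(** The values of [bd] come from the definition of N-goodness. On k >= 4 vertices a violation means
    2e >= 23k - 42, which says exactly that the partition into singletons has nonnegative weight;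
    this is the origin of 20. On two and three vertices that condition is weaker than avoiding N, so
    9 and 16 encode having at least 8 and 16 edges. Isomorphism types are never analysed. A quotient
    in N or W* has two parts and at most 8 crossing edges or three parts and at most 16, so every
    goodness claim becomes a lower bound on crossing edges. The obstacle in the discharging is that
    two vertices may be joined by several bundles, and that the faces on both sides of a bundle may
    share further vertices, so that paths read off from faces need not be disjoint. Two facts
    resolve this: distinct bundles between the same vertices add up within one multiplicity, and too
    few bundles around a vertex cannot reach degree 15. *)

Section EdgeSums.
Variable V : finType.
Implicit Types (f g : V -> V -> nat) (a b x y : V) (A B S : {set V}) (P Q : {set {set V}}).

(** Ordered pairs are summed, so for a multiplicity function this is twice the number of edges
    inside [A]. Likewise [cr] counts every crossing edge from both ends, as the sum of the d(P_i) in
    the weight does. *)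
Definition e2 f A := \sum_(x in A) \sum_(y in A) f x y.

Definition cr f S P := \sum_(A in P) \sum_(x in A) \sum_(y in S :\: A) f x y.

Lemma crE f S P : partition P S -> cr f S P + \sum_(A in P) e2 f A = e2 f S.
Proof.
move=> pP; rewrite /cr /e2 -big_split /= (set_partition_big _ pP) /=.
apply: eq_bigr => A AP; rewrite -big_split /=; apply: eq_bigr => x _.
rewrite [RHS](big_setID A) /= addnC; congr (_ + _).
by apply: eq_bigl => y; rewrite in_setI andb_idl // => yA; apply: (subsetP (partitionS pP AP)).
Qed.

Lemma e2D f g A : e2 (fun a b => f a b + g a b) A = e2 f A + e2 g A.
Proof. by rewrite /e2 -big_split; apply: eq_bigr => x _; rewrite -big_split. Qed.

Lemma e2M c f A : e2 (fun a b => c * f a b) A = c * e2 f A.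
Proof. by rewrite /e2 big_distrr; apply: eq_bigr => x _; rewrite big_distrr. Qed.

Lemma eq_e2 f g A : {in A &, f =2 g} -> e2 f A = e2 g A.
Proof. by move=> fg; apply: eq_bigr => x xA; apply: eq_bigr => y yA; apply: fg. Qed.

Lemma eq_cr f g S P : partition P S -> {in S &, f =2 g} -> cr f S P = cr g S P.
Proof.
move=> pP fg; apply: eq_bigr => A AP; apply: eq_bigr => x xA.
have /subsetP AS := partitionS pP AP.
by apply: eq_bigr => y; rewrite inE => /andP[_ yS]; apply: fg => //; apply: AS.
Qed.

Lemma crD f g S P : cr (fun a b => f a b + g a b) S P = cr f S P + cr g S P.
Proof.
rewrite /cr -big_split; apply: eq_bigr => A _; rewrite -big_split.
by apply: eq_bigr => x _; rewrite -big_split.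
Qed.

Lemma cr0 S P : cr (fun _ _ => 0) S P = 0.
Proof. by rewrite /cr big1 // => A _; rewrite big1 // => x _; rewrite big1. Qed.

Lemma e2_set0 f : e2 f set0 = 0.
Proof. by rewrite /e2 big_set0. Qed.

Section Sym.
Variable f : V -> V -> nat.
Hypotheses (fC : forall x y, f x y = f y x) (f0 : forall x, f x x = 0).

Lemma e2_setU1 x A : x \notin A -> e2 f (x |: A) = e2 f A + 2 * \sum_(y in A) f x y.
Proof.
move=> xA; rewrite /e2 big_setU1 //= big_setU1 //= f0 add0n.
under [X in _ + X]eq_bigr => z _ do rewrite big_setU1 //= fC.
by rewrite big_split /=; lia.
Qed.

Lemma e2_set1 x : e2 f [set x] = 0.
Proof. by rewrite /e2 !big_set1 f0. Qed.

Lemma e2_set2 x y : x != y -> e2 f [set x; y] = 2 * f x y.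
Proof. by move=> xy; rewrite e2_setU1 ?inE // e2_set1 big_set1. Qed.

Lemma e2_D1 x A : x \in A -> e2 f A = e2 f (A :\ x) + 2 * \sum_(y in A) f x y.
Proof.
move=> xA; rewrite -{1}(setD1K xA) e2_setU1 ?setD11 //.
by rewrite [in RHS](big_setD1 x) //= f0.
Qed.

Lemma e2_even A : ~~ odd (e2 f A).
Proof.
have [n] := ubnP #|A|; elim: n A => // n IH A An.
have [->|[x xA]] := set_0Vmem A; first by rewrite e2_set0.
have {}IH := IH (A :\ x); rewrite -(setD1K xA) e2_setU1 ?setD11 // oddD oddM /= addbF.
by apply: IH; have := cardsD1 x A; rewrite xA; lia.
Qed.

(** Parity supplies the last unit where the weight only yields an odd bound, such as 17, 33 or
    47. *)
Lemma cr_even S P : partition P S -> ~~ odd (cr f S P).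
Proof.
move=> pP; have := e2_even S; rewrite -(crE f pP) oddD => H.
suff H2: ~~ odd (\sum_(A in P) e2 f A) by case: (odd (cr _ _ _)) H H2; case: (odd _).
elim/big_ind: _ => // [m n om on|A _]; last exact: e2_even.
by rewrite oddD (negPf om) (negPf on).
Qed.
End Sym.

Lemma e2_sub f A B : A \subset B -> e2 f A <= e2 f B.
Proof.
move=> AB; rewrite /e2 [X in _ <= X](big_setID A) /= (setIidPr AB).
apply: leq_trans (leq_addr _ _); apply: leq_sum => x _.
by rewrite [X in _ <= X](big_setID A) /= (setIidPr AB) leq_addr.
Qed.

Lemma epairC a b x y : epair a b x y = epair b a x y.
Proof. by rewrite /epair orbC ![(b == _) && _]andbC. Qed.

Lemma epair_le1 a b x y : epair a b x y <= 1.
Proof. by rewrite /epair; case: (_ || _). Qed.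

Lemma sum_eq (A : {set V}) (x : V) : \sum_(a in A) (a == x : nat) = (x \in A).
Proof.
case: (boolP (x \in A)) => xA; last by rewrite big1 // => a aA; case: eqP aA xA => // -> ->.
by rewrite (big_setD1 x) //= eqxx big1 ?addn0 // => a; rewrite !inE => /andP[/negPf->].
Qed.

Lemma epair_split a b x y : x != y ->
  epair a b x y = (a == x) * (b == y) + (a == y) * (b == x).
Proof.
move=> xy; rewrite /epair; case: (eqVneq a x) => [->|_]; first by rewrite (negPf xy) orbF; case: (_ == _).
by case: (a == y); case: (b == x).
Qed.

Lemma sum_epair A a x y : x != y ->
  \sum_(b in A) epair a b x y = (a == x) * (y \in A) + (a == y) * (x \in A).
Proof.
move=> xy; under eq_bigr => b _ do rewrite epair_split //.
by rewrite big_split /= -!big_distrr /= !sum_eq.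
Qed.

Lemma e2_epair A x y : x != y ->
  e2 (fun a b => epair a b x y) A = 2 * ((x \in A) && (y \in A)).
Proof.
move=> xy; rewrite /e2; under eq_bigr => a _ do rewrite sum_epair //.
by rewrite big_split /= -!big_distrl /= !sum_eq; case: (x \in A); case: (y \in A).
Qed.

Lemma cr_epair_le S P x y : partition P S -> x \in S -> y \in S -> x != y ->
  cr (fun a b => epair a b x y) S P <= 2.
Proof.
move=> pP xS yS xy; have := crE (fun a b => epair a b x y) pP.
by rewrite e2_epair // xS yS; lia.
Qed.

Lemma cr_epair0 S P A x y : partition P S -> A \in P -> x \in A -> y \in A -> x != y ->
  cr (fun a b => epair a b x y) S P = 0.
Proof.
move=> pP AP xA yA xy; have := crE (fun a b => epair a b x y) pP.
have /subsetP AS := partitionS pP AP.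
rewrite e2_epair // (AS x) // (AS y) //= (big_setD1 A) //= e2_epair // xA yA; lia.
Qed.
End EdgeSums.

(* The least values of 23 (k - 1) - 2 e over the proper k-vertex subgraphs of G,
   when none of them is N-good. *)
Definition bd (k : nat) := if k <= 1 then 0 else if k == 2 then 9 else if k == 3 then 16 else 20.

Lemma bdP k : [\/ k <= 1 /\ bd k = 0, k = 2 /\ bd k = 9, k = 3 /\ bd k = 16 | 4 <= k /\ bd k = 20].
Proof.
case: k => [|[|[|[|k]]]]; rewrite /bd /=;
  by [constructor 1|constructor 2|constructor 3|constructor 4].
Qed.

(** * Partitions into two or three parts *)

Section Partitions.
Variable V : finType.
Implicit Types (A B S : {set V}) (P Q : {set {set V}}).

Lemma partition_pos P S A : partition P S -> A \in P -> 0 < #|A|.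
Proof. by move=> pP AP; rewrite card_gt0 (partition_neq0 pP). Qed.

Lemma partition_proper P S A : partition P S -> 1 < #|P| -> A \in P -> A \proper S.
Proof.
move=> pP P2 AP; rewrite properEcard (partitionS pP AP) (card_partition pP) (big_setD1 A) //=.
have: 0 < #|P :\ A| by have cD : #|P| = (#|P :\ A|).+1 by [rewrite (cardsD1 A) AP]; lia.
case/card_gt0P => B BP; rewrite (big_setD1 B) //=; move: BP; rewrite inE => /andP[_ BP].
by have := partition_pos pP BP; lia.
Qed.

Lemma card_partition_le P S : partition P S -> #|P| <= #|S|.
Proof.
move=> pP; rewrite (card_partition pP) -sum1_card; apply: leq_sum => A AP.
exact: partition_pos pP AP.
Qed.

Lemma parts2 P S A : partition P S -> A \in P -> #|P| = 2 ->
  exists B, [/\ B != A, P = [set A; B], B = S :\: A & #|A| + #|B| = #|S|].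
Proof.
move=> pP AP P2; have: #|P :\ A| == 1 by have cD : #|P| = (#|P :\ A|).+1 by [rewrite (cardsD1 A) AP]; lia.
case/cards1P => B PB; have EP: P = [set A; B] by rewrite -(setD1K AP) PB.
have: B \in P :\ A by rewrite PB set11.
rewrite in_setD1 => /andP[BA BP].
have ES: #|A| + #|B| = #|S|.
  by rewrite (card_partition pP) EP big_setU1 ?inE 1?eq_sym //= big_set1.
exists B; split=> //; apply/eqP; rewrite eqEcard; apply/andP; split; last first.
  by rewrite cardsD (setIidPr (partitionS pP AP)); lia.

rewrite subsetD (partitionS pP BP) /=.
case/and3P: pP => _ /trivIsetP tP _. exact: tP BP AP BA.
Qed.

Lemma parts3 P S A : partition P S -> A \in P -> #|P| = 3 ->
  exists B C, [/\ P = A |: [set B; C], A \notin [set B; C], B != C & #|A| + #|B| + #|C| = #|S|].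
Proof.
move=> pP AP P3; have: #|P :\ A| == 2 by have cD : #|P| = (#|P :\ A|).+1 by [rewrite (cardsD1 A) AP]; lia.
case/cards2P => B [C [BC PB]]; have EP: P = A |: [set B; C] by rewrite -(setD1K AP) PB.
have ABC : A \notin [set B; C] by rewrite -PB setD11.
exists B, C; split=> //.
by rewrite (card_partition pP) EP big_setU1 //= big_setU1 ?inE //= big_set1 addnA.
Qed.

Lemma sum_parts2 (F : {set V} -> nat) P S A : partition P S -> A \in P -> #|P| = 2 ->
  exists B, [/\ B \in P, B != A, #|A| + #|B| = #|S| & \sum_(X in P) F X = F A + F B].
Proof.
move=> pP AP P2; have [B [BA EP _ ES]] := parts2 pP AP P2; exists B; split=> //.
  by rewrite EP !inE eqxx orbT.
by rewrite EP big_setU1 ?inE 1?eq_sym //= big_set1.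
Qed.

Lemma sum_parts3 (F : {set V} -> nat) P S A : partition P S -> A \in P -> #|P| = 3 ->
  exists B C, [/\ [/\ B \in P, C \in P, A != B, A != C & B != C], #|A| + #|B| + #|C| = #|S| &
     \sum_(X in P) F X = F A + F B + F C].
Proof.
move=> pP AP P3; have [B [C [EP ABC BC ES]]] := parts3 pP AP P3; exists B, C.
move: (ABC); rewrite !inE negb_or => /andP[AB AC].
split=> //; first by split=> //; rewrite EP !inE eqxx ?orbT.
by rewrite EP big_setU1 //= big_setU1 ?inE //= big_set1 addnA.
Qed.
End Partitions.

(** * Numerical criteria for N-goodness and S-goodness *)

Lemma iso_e2 (V W : finType) (G : mgraph V) (H : mgraph W) : iso G H ->
  #|vset G| = #|vset H| /\ e2 (mult G) (vset G) = e2 (mult H) (vset H).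
Proof.
case=> f [finj fS fm]; split; first by rewrite -fS card_in_imset.
rewrite /e2 -fS big_imset //=; apply: eq_bigr => x xG.
by rewrite big_imset //=; apply: eq_bigr => y yG; rewrite fm.
Qed.

Lemma K2_e2 alpha : #|vset (K2 alpha)| = 2 /\ e2 (mult (K2 alpha)) (vset (K2 alpha)) = 2 * alpha.
Proof.
split; first by rewrite /= cardsT card_ord.
rewrite /e2 /=; under eq_bigl => i do rewrite inE.
under eq_bigr => i _ do under eq_bigl => j do rewrite inE.
by rewrite !big_ord_recl !big_ord0 /=; lia.
Qed.

Lemma T3_e2 a b c :
  #|vset (T3 a b c)| = 3 /\ e2 (mult (T3 a b c)) (vset (T3 a b c)) = 2 * (a + b + c).
Proof.
split; first by rewrite /= cardsT card_ord.
rewrite /e2 /=; under eq_bigl => i do rewrite inE.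
under eq_bigr => i _ do under eq_bigl => j do rewrite inE.
by rewrite !big_ord_recl !big_ord0 /=; lia.
Qed.

(** Membership only ever has to be refuted, so the order and the doubled edge count stand in for
    isomorphisms. *)
Lemma inN_e2 (V : finType) (K : mgraph V) : inN K ->
  #|vset K| = 2 /\ e2 (mult K) (vset K) <= 14 \/ #|vset K| = 3 /\ e2 (mult K) (vset K) <= 30.
Proof.
case=> [[alpha [_ a7 /iso_e2]]|[a [b [c [_ abc /iso_e2]]]]].
  by have [-> ->] := K2_e2 alpha; case=> -> ->; left; split=> //; lia.
by have [-> ->] := T3_e2 a b c; case=> -> ->; right; split=> //; lia.
Qed.

Lemma inWstar_e2 (V : finType) (K : mgraph V) : inWstar K ->
  #|vset K| = 2 /\ e2 (mult K) (vset K) <= 16 \/ #|vset K| = 3 /\ e2 (mult K) (vset K) <= 32.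
Proof.
case=> [/iso_e2|[a [b [c [_ abc _ /iso_e2]]]]].
  by have [-> ->] := K2_e2 8; case=> -> ->; left.
by have [-> ->] := T3_e2 a b c; case=> -> ->; right; split=> //; lia.
Qed.

Lemma quot_e2 (V : finType) (G : mgraph V) P : partition P (vset G) ->
  e2 (mult (quot G P)) P = cr (mult G) (vset G) P.
Proof.
move=> pP; rewrite /e2 /cr; apply: eq_bigr => A AP /=; rewrite AP /=.
have -> : vset G :\: A = cover (P :\ A).
  by rewrite coverD1 ?(partition_trivIset pP) // (cover_partition pP).
rewrite [RHS]exchange_big /= big_trivIset /=; last first.
  exact: trivIsetS (subD1set P A) (partition_trivIset pP).
rewrite (big_setD1 A) //= AP eqxx /= add0n.
apply: eq_bigr => B; rewrite !inE => /andP[BA BP].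
by rewrite BP eq_sym BA /= exchange_big.
Qed.

Section Good.
Variables (V : finType) (G : mgraph V).
Local Notation S := (vset G).

Lemma wG_ge0 P : is_part G P -> ((0 <= wG G P)%R = (23 * #|P| <= cr (mult G) S P + 42)).
Proof.
move=> _; rewrite /wG.
have -> : (\sum_(A in P) Posz (dout G A))%R = Posz (cr (mult G) S P).
  by rewrite /cr /dout [RHS](big_morph Posz PoszD (erefl _)).
by apply/idP/idP; lia.
Qed.

(** A set [X] without outgoing edges would give the partition into [X] and its complement the weight
    42 - 46 < 0. *)
Lemma connected_cr : (forall x y, mult G x y = mult G y x) -> 1 < #|S| ->
  (forall P, is_part G P -> 23 * #|P| <= cr (mult G) S P + 42) -> connected G.
Proof.
move=> mC S2 H; split; first by rewrite -card_gt0; lia.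
move=> X XS X0; have [XsS Sx] := properP XS.
have D0 : S :\: X != set0 by case: Sx => x xS xX; apply/set0Pn; exists x; rewrite inE xX.
have XD: X != S :\: X.
  by case/set0Pn: X0 => x xX; apply/eqP => E; move: (xX); rewrite E inE xX.
have pP : partition [set X; S :\: X] S.
  apply/and3P; split.
  - by rewrite /cover big_setU1 ?inE //= big_set1 -{1}(setIidPr XsS) setID.
  - apply/trivIsetP => A B; rewrite !inE => /orP[]/eqP-> /orP[]/eqP->; rewrite ?eqxx //= => _.
      by apply/pred0P => z /=; rewrite !inE; case: (z \in X).
    by apply/pred0P => z /=; rewrite !inE; case: (z \in X); rewrite ?andbF.
  - by rewrite !inE negb_or eq_sym X0 eq_sym D0.
have := H _ (introT andP (conj pP _)); rewrite cards2 XD => /(_ isT) cr4.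
have [/exists_inP[x xX /exists_inP[y yD m]]|] :=
  boolP [exists x in X, exists y in S :\: X, 0 < mult G x y]; first by exists x, y.
rewrite negb_exists_in => /forall_inP nE; exfalso.
  suff E0: cr (mult G) S [set X; S :\: X] = 0 by rewrite E0 in cr4.
  have m0 x y : x \in X -> y \in S :\: X -> mult G x y = 0.
    move=> xX yD; apply/eqP; rewrite -leqn0 leqNgt; apply: contraNN (nE _ xX) => m.
    by apply/exists_inP; exists y.
  rewrite /cr big_setU1 ?inE //= big_set1 setDDr setDv set0U (setIidPr XsS).
  rewrite !big1 // => x xX; rewrite big1 // => y yX; first by rewrite mC m0.
  by rewrite m0.
Qed.

(** The largest members of N and W* on two and three vertices have 8 and 16 edges, counted by [cr]
    as 16 and 32; 18 and 34 are the next even values. *)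
Lemma Sgood_cr : (forall x y, mult G x y = mult G y x) -> 1 < #|S| ->
  (forall P, is_part G P -> [/\ 23 * #|P| <= cr (mult G) S P + 42,
     #|P| = 2 -> 18 <= cr (mult G) S P & #|P| = 3 -> 34 <= cr (mult G) S P]) ->
  Sgood G.
Proof.
move=> mC S2 H; split=> // [|P iP|P iP].
- by apply: connected_cr => // P /H[].
- by rewrite wG_ge0 //; case: (H P iP).
- have [_ H2 H3] := H P iP; have /andP[pP _] := iP.
  split; [move/inN_e2|move/inWstar_e2]; rewrite /= quot_e2 // => -[][E C];
  by [have := leq_trans (H2 E) C|have := leq_trans (H3 E) C].
Qed.

(** The hypotheses make the vertex set a smallest violator of [bd]. Adding the bounds for the parts
    of P limits the edges inside parts, while the whole graph has many edges, so many must cross. As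
    [bd] is at most 20, the violation itself gives nonnegative weight. *)
Lemma Ngood_bd : wf G -> 1 < #|S| ->
  (forall A : {set V}, A \proper S -> A != set0 -> e2 (mult G) A + bd #|A| <= 23 * (#|A| - 1)) ->
  23 * (#|S| - 1) < e2 (mult G) S + bd #|S| -> Ngood G.
Proof.
case=> mC m0 _ S2 prop big.
have crP P : is_part G P ->
    23 * #|P| + \sum_(A in P) bd #|A| + e2 (mult G) S <= cr (mult G) S P + 23 + 23 * (#|S| - 1).
  case/andP=> pP P2; have := crE (mult G) pP.
  have : \sum_(A in P) (e2 (mult G) A + bd #|A| + 23) <= \sum_(A in P) 23 * #|A|.
    apply: leq_sum => A AP; have := partition_pos pP AP.
    by have := prop A (partition_proper pP P2 AP) (partition_neq0 pP AP); lia.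
  have -> : \sum_(A in P) 23 * #|A| = 23 * #|S| by rewrite (card_partition pP) big_distrr.
  have c0 : 0 < #|P| by lia.
  have := card_partition_le pP.
  rewrite !big_split /= sum_nat_const. slia.
have bdS := bdP #|S|.
have wP P : is_part G P -> 23 * #|P| <= cr (mult G) S P + 42.
  by move/crP; case: bdS => -[]; slia.
split=> //; first exact: connected_cr.
- by move=> P iP; rewrite wG_ge0 // wP.
- have := e2_even mC m0 S; move=> ev /inN_e2 -[] [ES C];
  move: ev big; rewrite ES /bd /=; slia.
- move=> Q iQ [A AQ A2]; have /andP[pQ Q2] := iQ; have := crP Q iQ.
  have ev := cr_even mC m0 pQ.
  have evS := e2_even mC m0 S.
  suff [H2 H3] : (#|Q| = 2 -> 18 <= cr (mult G) S Q) /\ (#|Q| = 3 -> 34 <= cr (mult G) S Q).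
    by move=> _; split; [move/inN_e2|move/inWstar_e2]; rewrite /= quot_e2 // => -[][E C];
    by [have := leq_trans (H2 E) C|have := leq_trans (H3 E) C].
  split=> EQ; move: (crP Q iQ); rewrite EQ.
    have [B [_ _ ES ->]] := sum_parts2 (fun X => bd #|X|) pQ AQ EQ.
    have := partition_pos pQ; move: ES big.
    case: bdS => -[]; case: (bdP #|A|) => -[]; case: (bdP #|B|) => -[]; slia.
  have [B [C [_ ES ->]]] := sum_parts3 (fun X => bd #|X|) pQ AQ EQ.
  move: ES big; case: bdS => -[]; case: (bdP #|A|) => -[]; slia.
Qed.
End Good.

(** * Contractions and induced subgraphs *)

Section Contract.
Variables (V : finType) (G : mgraph V).
Local Notation S := (vset G).
Hypothesis mC : forall x y, mult G x y = mult G y x.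

Lemma quot_sym P A B : mult (quot G P) A B = mult (quot G P) B A.
Proof.
rewrite /= andbCA [B == A]eq_sym; case: ifP => // _.
by rewrite exchange_big; apply: eq_bigr => x _; apply: eq_bigr => y _; rewrite mC.
Qed.

(** Replacing each part of [Q] by the union of its members gives a partition of G with the same
    crossing edges. So S-goodness of a contraction only concerns partitions of G that keep the
    contracted set inside one part. *)
Lemma quot_cr R Q : partition R S -> partition Q R ->
  cr (mult (quot G R)) R Q = cr (mult G) S (cover @: Q).
Proof.
move=> pR pQ; have [pC injC] := partition_partition pR pQ.
rewrite /cr big_imset //=; apply: eq_bigr => B BQ.
have BR := partitionS pQ BQ.
have tR := partition_trivIset pR.
rewrite [RHS]big_trivIset ?(trivIsetS BR) //=; apply: eq_bigr => A AB.
have AR := subsetP BR A AB.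
have -> : S :\: cover B = cover (R :\: B).
  have tB := trivIsetS BR tR.
  rewrite -(cover_partition pR); apply/setP => x; rewrite inE.
  apply/andP/bigcupP => [[xB /bigcupP[C CR xC]]|[C]].
    exists C => //; rewrite inE CR andbT; apply: contra xB => CB.
    by apply/bigcupP; exists C.
  rewrite inE => /andP[CB CR] xC; split; last by apply/bigcupP; exists C.
  apply: contra CB => /bigcupP[C' C'B xC'].
  suff -> : C = C' by [].
  by rewrite -(def_pblock tR CR xC) (def_pblock tR (subsetP BR _ C'B) xC').
rewrite [RHS]exchange_big big_trivIset ?(trivIsetS (subsetDl R B)) //=.
apply: eq_bigr => C; rewrite inE => /andP[CB CR].
rewrite AR CR /= exchange_big /=; case: eqP => // AC.
by rewrite -AC AB in CB.
Qed.

Definition cparts (X : {set V}) := X |: [set [set x] | x in S :\: X].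

Lemma cparts_partition (X : {set V}) : X \subset S -> X != set0 -> partition (cparts X) S.
Proof.
move=> XS X0; apply/and3P; split.
- apply/eqP/setP => x; apply/bigcupP/idP => [[A]|xS].
    rewrite !inE => /orP[/eqP->|/imsetP[y]]; first exact: (subsetP XS).
    by rewrite inE => /andP[_ yS] -> /set1P->.
  case: (boolP (x \in X)) => xX; first by exists X; rewrite ?setU11.
  exists [set x]; rewrite ?set11 // inE; apply/orP; right.
  by apply/imsetP; exists x; rewrite // inE xX.
- apply/trivIsetP => A B; rewrite !inE.
  move=> /orP[/eqP->|/imsetP[x xD ->]] /orP[/eqP->|/imsetP[y yD ->]]; rewrite ?eqxx // => AB.
  + by rewrite disjoint_sym disjoints1; move: yD; rewrite inE => /andP[].
  + by rewrite disjoints1; move: xD; rewrite inE => /andP[].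
  + by rewrite disjoints1 inE; apply: contra AB => /eqP->.
- rewrite in_setU1 negb_or eq_sym X0 /=; apply/imsetP => -[x _ E].
  by have := set11 x; rewrite -E inE.
Qed.

Lemma Sgood_contract (X : {set V}) : X \proper S -> X != set0 ->
  (forall P (A : {set V}), is_part G P -> A \in P -> X \subset A ->
     [/\ 23 * #|P| <= cr (mult G) S P + 42,
     #|P| = 2 -> 18 <= cr (mult G) S P & #|P| = 3 -> 34 <= cr (mult G) S P]) ->
  Sgood (contract G X).
Proof.
move=> XS X0 H; have pR := cparts_partition (proper_sub XS) X0.
have vE : vset (contract G X) = cparts X by [].
apply: Sgood_cr; rewrite ?vE.
- exact: quot_sym.
- case/properP: XS => _ [x xS xX]; apply/card_gt1P; exists X, [set x]; split.
  + exact: setU11.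
  + by rewrite in_setU1; apply/orP; right; apply/imsetP; exists x; rewrite // inE xX.
  + by apply: contraNneq xX => ->; rewrite set11.
- move=> Q; rewrite /is_part vE => /andP[pQ Q2].
  have [pC injC] := partition_partition pR pQ.
  have XR : X \in cparts X by rewrite setU11.
  have [B BQ XB] : exists2 B, B \in Q & X \in B.
    by apply/bigcupP; rewrite -/(cover Q) (cover_partition pQ).
  rewrite -[contract G X]/(quot G (cparts X)) quot_cr // -(card_in_imset injC); apply: (H _ (cover B)).
  + by rewrite /is_part pC card_in_imset.
  + exact: imset_f.
  + exact: (bigcup_sup X).
Qed.
End Contract.

Section Induced.
Variables (V : finType) (G : mgraph V).
Implicit Types A B : {set V}.
Hypothesis wfG : wf G.

Definition induced (A : {set V}) : mgraph V :=
  MG A (fun x y => if (x \in A) && (y \in A) then mult G x y else 0).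

Lemma induced_wf A : wf (induced A).
Proof.
have [mC m0 _] := wfG; split=> /= [x y|x|x y].
- by rewrite andbC mC.
- by rewrite m0 if_same.
- by case: ifP => // /andP[-> ->].
Qed.

Lemma induced_sub A : A \subset vset G -> subgraph (induced A) G.
Proof. by move=> AS; split=> //=; [exact: induced_wf|move=> x y; case: ifP]. Qed.

Lemma induced_e2 A B : B \subset A -> e2 (mult (induced A)) B = e2 (mult G) B.
Proof. by move=> /subsetP BA; apply: eq_e2 => x y xB yB /=; rewrite !BA. Qed.

Lemma bd_proper : ~ (exists H, proper_subgraph H G /\ Ngood H) ->
  forall A : {set V}, A \proper vset G -> A != set0 -> e2 (mult G) A + bd #|A| <= 23 * (#|A| - 1).
Proof.
move=> nH A; have [n] := ubnP #|A|; elim: n A => // n IH A An AS A0.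
case: (ltngtP 1 #|A|) => A1; last 2 first.
- by move: A0; rewrite -card_gt0; lia.
- have /cards1P[x ->] : #|A| == 1 by rewrite -A1.
  by rewrite cards1 e2_set1 //; case: wfG.
rewrite leqNgt; apply/negP => big; apply: nH; exists (induced A); split.
  by split; [apply: induced_sub (proper_sub AS)|left; rewrite (proper_neq AS)].
apply: Ngood_bd => //=; [exact: induced_wf| |by rewrite induced_e2].
move=> B BA B0; rewrite induced_e2 ?(proper_sub BA) //.
apply: IH => //; last exact: proper_trans BA AS.
by have := proper_card BA; lia.
Qed.
End Induced.

(** * Liftings along paths *)

Section Lifts.
Variable V : finType.
Implicit Types (G : mgraph V) (a b u v x y z : V) (s : seq V).

Lemma epairE x y : epair x y x y = 1.
Proof. by rewrite /epair !eqxx. Qed.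

Lemma epair_eq0 a b x y : (a != x) || (b != y) -> (a != y) || (b != x) -> epair a b x y = 0.
Proof. by rewrite /epair; do 4![case: eqP => //=]. Qed.

Lemma epair_gt0 a b x y : 0 < epair a b x y -> (a = x /\ b = y) \/ (a = y /\ b = x).
Proof. by rewrite lt0b => /orP[]/andP[/eqP-> /eqP->]; [left|right]. Qed.

Lemma epair0_notin a b x y : a != x -> a != y -> epair a b x y = 0.
Proof. by rewrite /epair => /negPf-> /negPf->. Qed.

(** The number of steps between [a] and [b] on the walk from [x] along [s]: what lifting the whole
    path takes away from the multiplicity of [a], [b]. *)
Fixpoint pedges a b x s :=
  if s is y :: s' then epair a b x y + pedges a b y s' else 0.

Lemma pedgesC a b x s : pedges a b x s = pedges b a x s.
Proof. by elim: s x => //= y s IH x; rewrite epairC IH. Qed.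

Lemma pedges_notin a b x s : a \notin x :: s -> pedges a b x s = 0.
Proof.
elim: s x => //= y s IH x; rewrite !inE !negb_or => /and3P[ax ay aS].
by rewrite epair0_notin // IH // inE negb_or ay.
Qed.

Lemma pedges_le1 a b x s : uniq (x :: s) -> pedges a b x s <= 1.
Proof.
elim: s x => //= y s IH x; rewrite inE negb_or => /andP[/andP[xy xs] us].
have xys : x \notin y :: s by rewrite inE negb_or xy.
have [/epair_gt0[][-> ->]|] := ltnP 0 (epair a b x y).
- by rewrite pedges_notin ?addn0 ?epair_le1.
- by rewrite pedgesC pedges_notin ?addn0 ?epair_le1.
- by rewrite leqn0 => /eqP->; apply: IH.
Qed.

Lemma pedges_gt0 (f : V -> V -> nat) a b x s : (forall u v, f u v = f v u) ->
  path (fun u v => 0 < f u v) x s -> 0 < pedges a b x s -> 0 < f a b.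
Proof.
move=> fC; elim: s x => //= y s IH x /andP[xy ps].
rewrite addn_gt0 => /orP[/epair_gt0[][-> ->]|]; [by []|by rewrite fC|exact: IH].
Qed.

Lemma pedges_le (f : V -> V -> nat) a b x s : (forall u v, f u v = f v u) ->
  path (fun u v => 0 < f u v) x s -> uniq (x :: s) -> pedges a b x s <= f a b.
Proof.
move=> fC ps us; have := pedges_le1 a b us; have := pedges_gt0 (a := a) (b := b) fC ps.
by lia.
Qed.

Lemma cr_pedges (S : {set V}) P x s : partition P S -> {subset x :: s <= S} -> uniq (x :: s) ->
  cr (fun a b => pedges a b x s) S P <= 2 * size s.
Proof.
move=> pP; elim: s x => [|y s IH] x sS us; first by rewrite cr0.
have /= := us; rewrite inE negb_or => /andP[/andP[xy _] us'].
have /= -> := crD (fun a b => epair a b x y) (fun a b => pedges a b y s).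
rewrite mulnS leq_add ?cr_epair_le ?IH ?sS ?inE ?eqxx ?orbT // => z zs.
by apply: sS; rewrite inE zs orbT.
Qed.

Lemma liftseq_trans (Q : V -> Prop) G1 G2 G3 :
  liftseq Q G1 G2 -> liftseq Q G2 G3 -> liftseq Q G1 G3.
Proof. by elim=> // G G' G'' v Qv l _ IH /IH; apply: liftseqS Qv l. Qed.

(** The additive form avoids the truncated subtractions of [lift1]; they do not truncate, because x,
    v, y is a simple path whose edges are present. *)
Lemma lift_step G v x y : wf G -> x != v -> y != v -> x != y ->
  0 < mult G x v -> 0 < mult G v y ->
  exists G1, [/\ lift1 v G G1, wf G1, vset G1 = vset G & forall a b,
    mult G1 a b + (epair a b x v + epair a b v y) = mult G a b + epair a b x y].
Proof.
move=> [mC m0 mS] xv yv xy mxv mvy.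
have le a b : epair a b x v + epair a b v y <= mult G a b.
  have us : uniq [:: x; v; y] by rewrite /= !inE negb_or xv xy eq_sym yv.
  have /= := pedges_le a b mC (_ : path _ x [:: v; y]) us.
  by rewrite addn0; apply; rewrite mxv mvy.
pose G1 := MG (vset G) (fun a b =>
  mult G a b - epair a b x v - epair a b v y + epair a b x y).
exists G1; split=> //=.
- by exists x, y; split; rewrite ?xv ?yv ?xy.
- split=> [a b|a|a b] /=.
  + by rewrite mC !(epairC a b).
  + have d z t : z != t -> epair a a z t = 0.
      by move=> zt; rewrite /epair; case: eqP => [->|//]; case: eqP => // E; rewrite -E eqxx in zt.
    by rewrite m0 !d // eq_sym.
  + have [/mS//|] := ltnP 0 (mult G a b); rewrite leqn0 => /eqP->.
    rewrite !sub0n => /epair_gt0.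
    have [xS _] := mS _ _ mxv; have [_ yS] := mS _ _ mvy.
    by case=> -[-> ->].
- by move=> a b; have := le a b; lia.
Qed.

(** Lifting at the second vertex replaces the first two edges by a new first edge of a shorter path.
    The bound by [pedges] is assumed instead of [path] because it passes to the lifted graph by
    itself. *)
Lemma lift_path G x s : wf G -> uniq (x :: s) -> 0 < size s ->
  (forall a b, pedges a b x s <= mult G a b) ->
  exists G', [/\ lifts G G', wf G', vset G' = vset G &
    forall a b, mult G' a b + pedges a b x s = mult G a b + epair a b x (last x s)].
Proof.
have [n] := ubnP (size s); elim: n G s => // n IH G [|y [|z s]] //= sn wfG us _ le.
  by exists G; split=> //; [exact: liftseq0|move=> a b; rewrite addn0].
move: us; rewrite !inE !negb_or => /and4P[/and3P[xy xz xs] /andP[yz ys] zs us].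
have [G1 [l1 wf1 S1 m1]] : exists G1, [/\ lift1 y G G1, wf G1, vset G1 = vset G & forall a b,
    mult G1 a b + (epair a b x y + epair a b y z) = mult G a b + epair a b x z].
  apply: lift_step => //; rewrite 1?eq_sym //.
    by have := le x y; rewrite epairE; lia.
  by have := le y z; rewrite epairE; lia.
have := IH G1 (z :: s); case=> //=.
- by rewrite inE negb_or xz xs zs.
- by move=> a b; have := m1 a b; have := le a b; lia.
move=> G' [l' wf' S' m']; exists G'; split=> //.
- by apply: liftseqS l1 l'.
- by rewrite S'.
- by move=> a b; have := m1 a b; have /= := m' a b; lia.
Qed.

Lemma degree_epair (S : {set V}) u x y : x != y -> x \in S -> y \in S ->
  \sum_(b in S) epair u b x y = (u == x) + (u == y).
Proof. by move=> xy xS yS; rewrite sum_epair // xS yS !muln1. Qed.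
End Lifts.

(** * Bounds on G and the basic reduction *)

Section WeightedGraph.
Variable V : finType.
Implicit Types (s : seq V) (es : seq (nat * (V * V))).

(** An entry (m, (x, y)) stands for m parallel edges. With such lists the subset condition of
    [Ngood_bd] becomes a finite check on which listed vertices belong to the subset. *)
Definition wmult es (a b : V) := \sum_(e <- es) e.1 * epair a b e.2.1 e.2.2.
Definition wgraph s es := MG [set z in s] (wmult es).

Lemma card_sub_seq s (B : {set V}) : uniq s -> B \subset [set z in s] ->
  #|B| = count (mem B) s.
Proof.
move=> us /subsetP Bs; rewrite -size_filter -(card_uniqP (filter_uniq _ us)).
by apply: eq_card => z; rewrite mem_filter andb_idr // => /Bs; rewrite inE.
Qed.

Definition wedges s es :=
  all (fun e => [&& e.2.1 \in s, e.2.2 \in s & e.2.1 != e.2.2]) es.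

Lemma wgraph_e2 s es B : wedges s es ->
  e2 (wmult es) B = \sum_(e <- es) 2 * (e.1 * ((e.2.1 \in B) && (e.2.2 \in B))).
Proof.
rewrite /wmult; elim: es => [_|e es IH /andP[/and3P[_ _ ee] es_ok]].
  by rewrite /e2 big_nil big1 // => x _; rewrite big1 // => y _; rewrite big_nil.
rewrite big_cons -IH // mulnCA -e2_epair // -e2M -e2D.
by apply: eq_e2 => x y _ _; rewrite big_cons.
Qed.

Lemma wgraph_wf s es : wedges s es -> wf (wgraph s es).
Proof.
move=> es_ok; split=> /= [x y|x|x y].
- by apply: eq_bigr => e _; rewrite epairC.
- rewrite /wmult big_seq big1 // => e /(allP es_ok)/and3P[_ _ /negPf ee].
  rewrite /epair; case: (eqVneq x e.2.1) => [->|]; rewrite ?ee ?andbF ?muln0 //=.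
- rewrite /wmult lt0n sum_nat_seq_neq0 => /hasP[e /(allP es_ok)/and3P[p q _]].
  by rewrite /= muln_eq0 negb_or -!lt0n !inE => /andP[_ /epair_gt0[][-> ->]].
Qed.

Lemma wgraph_sub s es G : wf G -> wedges s es -> {subset s <= vset G} ->
  pairwise (fun e e' => epair e.2.1 e.2.2 e'.2.1 e'.2.2 == 0) es ->
  all (fun e => e.1 <= mult G e.2.1 e.2.2) es -> subgraph (wgraph s es) G.
Proof.
move=> [mC _ _] es_ok sS pes ale; split=> /=; first exact: wgraph_wf.
  by apply/subsetP => x; rewrite inE => /sS.
move=> x y; rewrite /wmult; elim: es {es_ok} pes ale => [|e es IH] /=; first by rewrite big_nil.
case/andP=> e0 pes /andP[le ale]; rewrite big_cons.
have [E|] := ltnP 0 (epair x y e.2.1 e.2.2); last first.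
  by rewrite leqn0 => /eqP->; rewrite muln0; apply: IH.
rewrite big_seq big1 => [|e' /(allP e0) /eqP E0].
  have : e.1 <= mult G x y by case/epair_gt0: E => -[-> ->] //; rewrite mC.
  by rewrite addn0; apply: leq_trans; rewrite -[X in _ <= X]muln1 leq_mul2l epair_le1 orbT.
by case/epair_gt0: E => -[-> ->]; [|rewrite epairC]; rewrite E0 muln0.
Qed.

Lemma wgraph_Ngood s es : uniq s -> wedges s es -> 1 < size s ->
  (forall B : {set V}, B \subset [set z in s] -> 0 < count (mem B) s < size s ->
     \sum_(e <- es) 2 * (e.1 * ((e.2.1 \in B) && (e.2.2 \in B))) + bd (count (mem B) s)
       <= 23 * (count (mem B) s - 1)) ->
  23 * (size s - 1) < \sum_(e <- es) 2 * e.1 + bd (size s) -> Ngood (wgraph s es).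
Proof.
move=> us es_ok s1 H big.
have sE : #|[set z in s]| = size s by rewrite -(card_uniqP us); apply: eq_card => z; rewrite inE.
apply: Ngood_bd => /=; rewrite ?sE //; first exact: wgraph_wf.
- move=> A AX A0; have AS := proper_sub AX.
  rewrite (wgraph_e2 _ es_ok) (card_sub_seq us AS) H // -(card_sub_seq us AS).
  by rewrite card_gt0 A0 -sE proper_card.
- rewrite (wgraph_e2 _ es_ok); apply: leq_trans big _; rewrite leq_add2r.
  rewrite big_seq [X in _ <= X]big_seq; apply: leq_sum => e /(allP es_ok)/and3P[p q _].
  by rewrite !inE p q muln1.
Qed.

(** 8, 16 and 25 edges are the fewest that violate [bd] on two, three and four vertices. This graph
    and the next two are the targets of all liftings for outcome (2). *)
Lemma pair_Ngood x y : x != y -> Ngood (wgraph [:: x; y] [:: (8, (x, y))]).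
Proof.
move=> xy; apply: wgraph_Ngood => //=; rewrite ?inE ?xy ?eqxx ?orbT //.
  by move=> B _; rewrite big_seq1 /=; case: (x \in B); case: (y \in B).
by rewrite big_seq1.
Qed.

Lemma triangle_Ngood x y z : uniq [:: x; y; z] ->
  Ngood (wgraph [:: x; y; z] [:: (6, (x, y)); (6, (y, z)); (4, (x, z))]).
Proof.
move=> us; have := us; rewrite /= !inE !negb_or => /and3P[/andP[xy xz] yz _].
apply: wgraph_Ngood => //=; rewrite ?inE ?xy ?yz ?xz ?eqxx ?orbT //.
  by move=> B _; rewrite !big_cons big_nil /=; case: (x \in B); case: (y \in B); case: (z \in B).
by rewrite !big_cons big_nil.
Qed.

Lemma quad_Ngood x y v w : uniq [:: x; y; v; w] ->
  Ngood (wgraph [:: x; y; v; w] [:: (7, (x, y)); (6, (y, v)); (6, (v, w)); (6, (w, x))]).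
Proof.
move=> us; have := us; rewrite /= !inE !negb_or.
move=> /and4P[/and3P[xy xv xw] /andP[yv yw] vw _].
apply: wgraph_Ngood => //=; rewrite ?inE ?xy ?yv ?vw ?[w == x]eq_sym ?xw ?eqxx ?orbT //.
  by move=> B _; rewrite !big_cons big_nil /=;
    case: (x \in B); case: (y \in B); case: (v \in B); case: (w \in B).
by rewrite !big_cons big_nil.
Qed.
End WeightedGraph.

Section Bounds.
Variables (V : finType) (G : mgraph V).
Local Notation S := (vset G).
Local Notation mu := (mult G).
Hypothesis wfG : wf G.
Hypothesis wS : 23 * #|S| <= e2 mu S + 42.
Hypothesis bdG : forall A : {set V}, A \proper S -> A != set0 ->
  e2 mu A + bd #|A| <= 23 * (#|A| - 1).

Let mC : forall x y, mu x y = mu y x. Proof. by case: wfG. Qed.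
Let m0 : forall x, mu x x = 0. Proof. by case: wfG. Qed.

Lemma sum_e2_parts (F : {set V} -> nat) P (T : {set V}) : partition P T ->
  (forall A, A \in P -> e2 mu A + F A <= 23 * (#|A| - 1)) ->
  \sum_(A in P) e2 mu A + \sum_(A in P) F A + 23 * #|P| <= 23 * #|T|.
Proof.
move=> pP H; have -> : 23 * #|T| = \sum_(A in P) 23 * #|A|.
  by rewrite (card_partition pP) big_distrr.
have -> : 23 * #|P| = \sum_(A in P) 23 by rewrite sum_nat_const mulnC.
rewrite -!big_split; apply: leq_sum => A AP /=; have := H A AP.
by have := partition_pos pP AP; clear; lia.
Qed.

Lemma bd_parts P A : is_part G P -> A \in P -> e2 mu A + bd #|A| <= 23 * (#|A| - 1).
Proof.
by case/andP=> pP P2 AP; apply: bdG (partition_proper pP P2 AP) (partition_neq0 pP AP).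
Qed.

Lemma cr_ge_bd P : is_part G P -> 23 * #|P| + \sum_(A in P) bd #|A| <= cr mu S P + 42.
Proof.
move=> iP; have /andP[pP _] := iP; have := crE mu pP.
have := sum_e2_parts pP (fun A AP => bd_parts iP AP); move: wS; clear; slia.
Qed.

(** Only the slack of one part is kept, but it may exceed [bd #|A|]; a pair {x, y} with few edges
    between them needs this. *)
Lemma cr_ge_part P A c : is_part G P -> A \in P -> e2 mu A + c <= 23 * (#|A| - 1) ->
  23 * #|P| + c <= cr mu S P + 42.
Proof.
move=> iP AP Ac; have /andP[pP _] := iP; have := crE mu pP.
have := sum_e2_parts (F := fun B => if B == A then c else 0) pP.
rewrite [\sum_(B in P) (if _ then _ else _)](big_setD1 A) //= eqxx => H.
have {}H := H _; move: wS H => wS' H.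
have : \sum_(B in P) e2 mu B + c + 23 * #|P| <= 23 * #|S|.
  apply: leq_trans (H _); first by rewrite leq_add2r leq_add2l leq_addr.
  move=> B BP; case: eqP => [->//|_]; have := bd_parts iP BP; lia.
clear -wS; slia.
Qed.

Lemma mu_le7 x y : 2 < #|S| -> x \in S -> y \in S -> x != y -> mu x y <= 7.
Proof.
move=> n3 xS yS xy; have := bdG (A := [set x; y]); rewrite e2_set2 // cards2 xy /=.
have XS : [set x; y] \proper S.
  by rewrite properEcard subUset !sub1set xS yS cards2 xy.
have X0 : [set x; y] != set0 by apply/set0Pn; exists x; rewrite !inE eqxx.
by move=> /(_ XS X0); rewrite /bd /=; lia.
Qed.

Lemma set4_le x y v w : 4 < #|S| -> {subset [:: x; y; v; w] <= S} -> uniq [:: x; y; v; w] ->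
  mu x y + mu x v + mu x w + mu y v + mu y w + mu v w <= 24.
Proof.
move=> n5 sS us; pose A := x |: (y |: [set v; w]).
have := us; rewrite /= !inE !negb_or => /and4P[/and3P[xy xv xw] /andP[yv yw] vw _].
have A1 : y \notin [set v; w] by rewrite !inE negb_or yv.
have A2 : x \notin y |: [set v; w] by rewrite !inE !negb_or xy xv.
have cA : #|A| = 4 by rewrite cardsU1 A2 cardsU1 A1 cards2 vw.
have AS : A \proper S.
  rewrite properEcard cA n5 andbT !subUset !sub1set.
  by rewrite !sS ?inE ?eqxx ?orbT.
have A0 : A != set0 by rewrite -card_gt0 cA.
have vw' : v \notin [set w] by rewrite inE.
have := bdG AS A0; rewrite cA e2_setU1 // e2_setU1 // e2_set2 // !big_setU1 //= !big_set1.
by rewrite {1}/bd /=; clear; lia.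
Qed.

Section SixVertices.
Hypothesis n6 : 5 < #|S|.
Hypothesis deg15 : forall v, v \in S -> 15 <= \sum_(y in S) mu v y.

Lemma cr_part1 P v : is_part G P -> [set v] \in P -> #|P| = 2 ->
  cr mu S P = 2 * \sum_(y in S) mu v y.
Proof.
case/andP=> pP _ vP P2; have vS : v \in S by rewrite -sub1set (partitionS pP).
have [B [BA EP EB _]] := parts2 pP vP P2; have := crE mu pP.
by rewrite EP big_setU1 ?inE 1?eq_sym //= big_set1 e2_set1 // EB (e2_D1 _ _ vS) //; clear; lia.
Qed.

(** A singleton part gives twice the minimum degree 15. Two larger parts have [bd] sum at least 9 +
    20, hence at least 46 + 29 - 42 = 33. *)
Lemma cr_part2 P : is_part G P -> #|P| = 2 -> 30 <= cr mu S P.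
Proof.
move=> iP P2; have /andP[pP _] := iP.
have [A AP] : exists A, A \in P by apply/card_gt0P; rewrite P2.
have [B [BP _ ES EB]] := sum_parts2 (fun X => bd #|X|) pP AP P2.
have one X : X \in P -> #|X| = 1 -> 30 <= cr mu S P.
  move=> XP /eqP/cards1P[v Xv]; rewrite Xv in XP; rewrite (cr_part1 iP XP P2).
  have vS : v \in S by rewrite -sub1set (partitionS pP).
  by have := deg15 vS; lia.
have [A1|A1] := eqVneq #|A| 1; first exact: one AP A1.
have [B1|B1] := eqVneq #|B| 1; first exact: one BP B1.
have := cr_ge_bd iP; rewrite EB P2.
have := partition_pos pP AP; have := partition_pos pP BP.
by case: (bdP #|A|) => -[? ->]; case: (bdP #|B|) => -[? ->]; lia.
Qed.

(** On six or more vertices the worst part sizes have [bd] sum 20, giving 69 + 20 - 42 = 47, and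
    parity gives 48. *)
Lemma cr_part3 P : is_part G P -> #|P| = 3 -> 48 <= cr mu S P.
Proof.
move=> iP P3; have /andP[pP _] := iP.
have [A AP] : exists A, A \in P by apply/card_gt0P; rewrite P3.
have [B [C [[BP CP _ _ _] ES EB]]] := sum_parts3 (fun X => bd #|X|) pP AP P3.
have : 20 <= bd #|A| + bd #|B| + bd #|C|.
  move: (partition_pos pP AP) (partition_pos pP BP) (partition_pos pP CP).
  by case: (bdP #|A|) => -[? ->]; case: (bdP #|B|) => -[? ->]; case: (bdP #|C|) => -[? ->];
    clear wS bdG; lia.
have := cr_even mC m0 pP; have := cr_ge_bd iP; rewrite EB P3.
by move: (cr _ _ _) => c; clear; lia.
Qed.

Definition lift_reducible := exists G' H,
  [/\ lifts G G', subgraph H G', Ngood H & Sgood (contract G' (vset H))].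

(** [L] bounds the number of lost crossing edges. The limit 6 comes from two parts, where 30 - 12 =
    18; for three parts 48 - 12 still exceeds 34. The last hypothesis pays for the loss in the
    weight condition, through the part that contains H. *)
Lemma lift_reducible_intro G' H L : lifts G G' -> wf G' -> vset G' = S ->
  (forall P, is_part G P -> cr mu S P <= cr (mult G') S P + 2 * L) -> L <= 6 ->
  subgraph H G' -> Ngood H -> vset H \proper S ->
  (forall A : {set V}, vset H \subset A -> A \proper S -> e2 mu A + 2 * L <= 23 * (#|A| - 1)) ->
  lift_reducible.
Proof.
move=> lG wf' S' loss L6 HG HN HS HA; exists G', H; split=> //.
have H0 : vset H != set0 by have [_ H2 _ _ _] := HN; rewrite -card_gt0; lia.
apply: Sgood_contract; rewrite ?S' //; first by case: wf'.
move=> P A; rewrite {1}/is_part S' => iP AP XA; have /andP[pP P2] := iP.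
have := loss P iP.
have := cr_ge_part iP AP (HA A XA (partition_proper pP P2 AP)).
by split=> [|/(cr_part2 iP)|/(cr_part3 iP)]; slia.
Qed.
End SixVertices.
End Bounds.

(** * Reducible edges and 4-cycles *)

Ltac epsimp :=
  rewrite /epair ?eqxx;
  repeat match goal with
  | H : is_true (~~ (@eq_op _ ?x ?y)) |- context [@eq_op _ ?x ?y] => rewrite (negPf H)
  | H : is_true (~~ (@eq_op _ ?x ?y)) |- context [@eq_op _ ?y ?x] => rewrite (eq_sym y x) (negPf H)
  end;
  rewrite ?andbF ?andbT ?orbF ?orbT /= ?addn0 ?muln0 ?muln1.

Section LiftVia.
Variable V : finType.
Implicit Types (G : mgraph V) (x y z : V) (zs : seq V).

(** The edges used by lifting x z y once for each entry z of [zs]; repeating a vertex in [zs] means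
    lifting there several times. *)
Definition via x y zs (a b : V) := \sum_(z <- zs) (epair a b x z + epair a b z y).

Lemma lift_via G x y zs : wf G -> x != y ->
  (forall z, z \in zs -> [/\ z != x, z != y, count_mem z zs <= mult G x z &
                             count_mem z zs <= mult G z y]) ->
  exists G', [/\ lifts G G', wf G', vset G' = vset G & forall a b,
    mult G' a b + via x y zs a b = mult G a b + size zs * epair a b x y].
Proof.
move=> wfG xy; elim: zs G wfG => [|z zs IH] G wfG H.
  by exists G; split=> //; [exact: liftseq0|move=> a b; rewrite /via big_nil].
have := H z; rewrite inE eqxx /= eqxx => /(_ isT)[zx zy mxz mzy].
have [G1 [l1 wf1 S1 m1]] : exists G1, [/\ lift1 z G G1, wf G1, vset G1 = vset G & forall a b,
    mult G1 a b + (epair a b x z + epair a b z y) = mult G a b + epair a b x y].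
  by apply: lift_step => //; rewrite 1?eq_sym //; lia.
have [z' z'zs|G' [l' wf' S' m']] := IH G1 wf1.
  have := H z'; rewrite inE z'zs orbT /= => /(_ isT)[z'x z'y mx my].
  split=> //.
    by have := m1 x z'; epsimp; rewrite [z' == z]eq_sym; move: mx; clear; lia.
  by have := m1 z' y; epsimp; rewrite [z' == z]eq_sym; move: my; clear; lia.
exists G'; split=> //.
- exact: liftseqS l1 l'.
- by rewrite S'.
- move=> a b; have := m1 a b; have := m' a b; rewrite /via big_cons mulSn; lia.
Qed.

Lemma cr_via (S : {set V}) P x y zs : partition P S -> x \in S -> y \in S ->
  (forall z, z \in zs -> [/\ z \in S, z != x & z != y]) -> cr (via x y zs) S P <= 2 * (2 * size zs).
Proof.
move=> pP xS yS; elim: zs => [|z zs IH] H.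
  by rewrite (eq_cr (g := fun _ _ => 0)) ?cr0 // => a b _ _; rewrite /via big_nil.
have [zS zx zy] := H z (mem_head _ _).
rewrite (eq_cr (g := fun a b => epair a b x z + epair a b z y + via x y zs a b)) //; last first.
  by move=> a b _ _; rewrite /via big_cons.
have /= -> := crD (fun a b => epair a b x z + epair a b z y) (via x y zs).
have /= -> := crD (fun a b => epair a b x z) (fun a b => epair a b z y).
have := @cr_epair_le _ S P x z pP xS zS; rewrite eq_sym => /(_ zx).
have := @cr_epair_le _ S P z y pP zS yS zy.
have : cr (via x y zs) S P <= 2 * (2 * size zs).
  by apply: IH => t tzs; apply: H; rewrite inE tzs orbT.
rewrite /=; lia.
Qed.

(** The new edges [sig] can only help, so the loss is at most the crossing part of the removed edges
    [rho]. *)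
Lemma cr_loss G G' (rho sig : V -> V -> nat) P : partition P (vset G) ->
  (forall a b, mult G' a b + rho a b = mult G a b + sig a b) ->
  cr (mult G) (vset G) P <= cr (mult G') (vset G) P + cr rho (vset G) P.
Proof.
move=> pP E; have /= <- := crD (mult G') rho (vset G) P.
have -> := eq_cr (g := fun a b => mult G a b + sig a b) pP (fun a b _ _ => E a b).
by have /= -> := crD (mult G) sig (vset G) P; apply: leq_addr.
Qed.
End LiftVia.

Section Reductions.
Variables (V : finType) (G : mgraph V).
Local Notation S := (vset G).
Local Notation mu := (mult G).
Hypothesis wfG : wf G.
Hypothesis wS : 23 * #|S| <= e2 mu S + 42.
Hypothesis bdG : forall A : {set V}, A \proper S -> A != set0 ->
  e2 mu A + bd #|A| <= 23 * (#|A| - 1).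
Hypothesis n6 : 5 < #|S|.
Hypothesis deg15 : forall v, v \in S -> 15 <= \sum_(y in S) mu v y.
Hypothesis irred : ~ lift_reducible G.

Let mC : forall x y, mu x y = mu y x. Proof. by case: wfG. Qed.
Let m0 : forall x, mu x x = 0. Proof. by case: wfG. Qed.
Let muS x y : 0 < mu x y -> x \in S /\ y \in S. Proof. by case: wfG => _ _; apply. Qed.

Lemma mu_neq x y : 0 < mu x y -> x != y.
Proof. by case: eqP => // ->; rewrite m0. Qed.

Lemma mu7 x y : mu x y <= 7.
Proof.
have [m|] := ltnP 0 (mu x y); last by rewrite leqn0 => /eqP->.
have [xS yS] := muS m; apply: (mu_le7 wfG) => //; [lia|exact: mu_neq].
Qed.

(** An eighth edge would complete 8K_2. The last numerical hypothesis is the slack required of the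
    part {x, y} itself; larger parts have [bd] at least 16, more than 2 * 6. *)
Lemma pair_irred x y G' L : x != y -> x \in S -> y \in S -> lifts G G' -> wf G' -> vset G' = S ->
  (forall P, is_part G P -> cr mu S P <= cr (mult G') S P + 2 * L) -> L <= 6 ->
  2 * mu x y + 2 * L <= 23 -> mult G' x y <= 7.
Proof.
move=> xy xS yS lG wf' S' loss L6 room; rewrite leqNgt; apply/negP => m8; apply: irred.
have ES : wedges [:: x; y] [:: (8, (x, y))] by rewrite /= !inE !eqxx xy orbT.
apply: (lift_reducible_intro wfG wS bdG n6 deg15 lG wf' S' loss L6 _ (pair_Ngood xy)).
- apply: wgraph_sub ES _ _ _ => //=; last by rewrite m8.
  by move=> z; rewrite S' !inE => /orP[]/eqP->.
- have -> : vset (wgraph [:: x; y] [:: (8, (x, y))]) = [set x; y].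
    by apply/setP => z; rewrite !inE.
  by rewrite properEcard subUset !sub1set xS yS cards2 xy; lia.
- move=> A /subsetP XA AS.
  have xA : x \in A by apply: XA; rewrite !inE eqxx.
  have yA : y \in A by apply: XA; rewrite !inE eqxx orbT.
  have [A2|A2] := eqVneq #|A| 2.
    have -> : A = [set x; y].
      by apply/esym/eqP; rewrite eqEcard subUset !sub1set xA yA cards2 xy A2.
    by rewrite e2_set2 // cards2 xy.
  have : 2 <= #|A| by apply/card_gt1P; exists x, y.
  have A0 : A != set0 by apply/set0Pn; exists x.
  have := bdG AS A0; move: A2 L6; clear.
  by case: (bdP #|A|) => -[? ->]; lia.
Qed.

Lemma path_subset x s : x \in S -> path (fun u v => 0 < mu u v) x s -> {subset x :: s <= S}.
Proof.
elim: s x => [|z s IH] x xS /=; first by move=> _ t; rewrite inE => /eqP->.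
by case/andP=> /muS[_ zS] ps t; rewrite inE => /orP[/eqP->//|]; apply: IH.
Qed.

(** Lifting the path would add an eighth edge to seven. Its length is limited by the slack of the
    pair: 2 * 7 + 2 * 4 <= 23. *)
Lemma path_mult_le6 x s : uniq (x :: s) -> path (fun u v => 0 < mu u v) x s ->
  2 <= size s <= 4 -> mu x (last x s) <= 6.
Proof.
move=> us ps /andP[s2 s4]; rewrite leqNgt; apply/negP => m7; set y := last x s in m7.
have [xS yS] : x \in S /\ y \in S by apply: muS; apply: leq_trans m7.
have xy : x != y by apply: mu_neq; apply: leq_trans m7.
have sS := path_subset xS ps.
have [|G' [lG wf' S' m']] := lift_path wfG us _ (fun a b => pedges_le a b mC ps us); first exact: leq_trans s2.
have p0 : pedges x y x s = 0.
  case: s s2 us @y xy {s4 ps m7 yS sS m'} => [//|z [//|t s]] _ /=.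
  rewrite inE negb_or => /and3P[/andP[xz xs] zs _] xy.
  have yz : last t s != z by apply: contraNneq zs => <-; exact: mem_last.
  rewrite epair_eq0 ?yz ?xz ?orbT //.
  by have := @pedges_notin V x (last t s) z (t :: s); rewrite /= inE negb_or xz; apply.
have := pair_irred (L := size s) xy xS yS lG wf' S'.
have := m' x y; rewrite p0 -/y epairE => E.
move/(_ _ _ _)=> H; suff : mult G' x y <= 7 by lia.
apply: H; [|lia|have := mu7 x y; lia].
move=> P /andP[pP _]; apply: leq_trans (cr_loss pP m') _.
by rewrite leq_add2l cr_pedges.
Qed.

(** Each lifting uses two edges, so the loss is 2k. The instances are six edges with k = 2 and five
    edges with k = 3, where 2 mu + 4k is 20 and 22. *)
Lemma via_irred x y zs k : x != y -> size zs = k -> k <= 3 -> 8 <= mu x y + k ->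
  (forall z, z \in zs -> [/\ z != x, z != y, count_mem z zs <= mu x z &
                             count_mem z zs <= mu z y]) ->
  2 * mu x y + 4 * k <= 23 -> x \in S -> y \in S -> False.
Proof.
move=> xy sk s3 s8 H room xS yS.
have [G' [lG wf' S' m']] := lift_via wfG xy H.
have v0 : via x y zs x y = 0.
  rewrite /via big_seq big1 // => z /H[zx zy _ _].
  by epsimp.
have := m' x y; rewrite v0 epairE sk => E.
have := pair_irred (L := 2 * k) xy xS yS lG wf' S'.
move=> H'; suff : mult G' x y <= 7 by lia.
apply: H'; [|lia|lia].
move=> P /andP[pP _]; apply: leq_trans (cr_loss pP m') _.
rewrite leq_add2l -sk; apply: cr_via => // z zzs; have [zx zy mx _] := H z zzs.
have : 0 < mu x z by apply: leq_trans mx; rewrite -has_count has_pred1.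
by move=> /muS[].
Qed.

(** Six edges become eight by lifting a path of two edges and one of three, at the cost of 5 edges:
    12 + 10 <= 23. The terms [(w == z)] and [(v == z)] ask for a second parallel edge where both
    paths use the same pair. *)
Lemma mu6_irred x y z w v : mu x y = 6 -> uniq [:: x; y; z] -> uniq [:: x; w; v; y] ->
  1 + (w == z) <= mu x z -> 1 + (v == z) <= mu z y ->
  0 < mu x w -> 0 < mu w v -> 0 < mu v y -> False.
Proof.
move=> m6; rewrite /= !inE !negb_or => /and3P[/andP[xy xz] yz _].
move=> /and4P[/and3P[xw xv _] /andP[wv wy] vy _] mxz mzy mxw mwv mvy.
have [xS yS] : x \in S /\ y \in S by apply: muS; rewrite m6.
have [G1 [l1 wf1 S1 m1]] : exists G1, [/\ lift1 z G G1, wf G1, vset G1 = S & forall a b,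
    mult G1 a b + (epair a b x z + epair a b z y) = mu a b + epair a b x y].
  by apply: lift_step => //; rewrite 1?eq_sym //;
    [apply: leq_trans mxz|apply: leq_trans mzy]; rewrite leq_addr.
have pos a b : epair a b x z + epair a b z y < mu a b -> 0 < mult G1 a b.
  by have := m1 a b; clear; lia.
have us : uniq [:: x; w; v; y] by rewrite /= !inE !negb_or xw xv xy wv wy vy.
have ps : path (fun a b => 0 < mult G1 a b) x [:: w; v; y].
  rewrite /= !pos //; epsimp => //.
  - by case: eqP mzy => [<-|].
  - by case: eqP mxz => [<-|].
have [mC1 _ _] := wf1.
have [|G' [l' wf' S' m']] := lift_path wf1 us _ (fun a b => pedges_le a b mC1 ps us); first by [].
have lG : lifts G G' by apply: liftseqS l1 l'.
have sS : {subset [:: x; w; v; y] <= S}.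
  move=> t; rewrite !inE => /or4P[]/eqP-> //; first by case: (muS mxw).
  by case: (muS mvy).
have H := pair_irred (L := 5) xy xS yS lG wf' (etrans S' S1).
have : mult G' x y <= 7.
  apply: H => //; last by rewrite m6.
  move=> P /andP[pP _]; have pP1 : partition P (vset G1) by rewrite S1.
  have := cr_loss pP1 m'; rewrite S1 => le1.
  have := cr_loss (rho := fun a b => epair a b x z + epair a b z y) pP m1 => le2.
  have sS1 : {subset [:: x; z; y] <= S}.
    have mxz0 : 0 < mu x z by apply: leq_trans mxz; rewrite leq_addr.
    by move=> t; rewrite !inE => /or3P[]/eqP-> //; case: (muS mxz0).
  have us1 : uniq [:: x; z; y] by rewrite /= !inE negb_or xz xy eq_sym yz.
  have le3 : cr (fun a b => pedges a b x [:: w; v; y]) S P <= 6 := cr_pedges pP sS us.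
  have := cr_pedges pP sS1 us1; rewrite /=.
  have -> : cr (fun a b => epair a b x z + (epair a b z y + 0)) S P =
            cr (fun a b => epair a b x z + epair a b z y) S P.
    by apply: eq_cr => // a b _ _; rewrite addn0.
  by move: le1 le2 le3; clear; lia.
have := m' x y; have := m1 x y; rewrite m6 /=; epsimp.
by clear; lia.
Qed.

Lemma pedges_new (a b x w v y : V) : uniq [:: x; w; v; y] -> a \notin [:: w; v] -> b \notin [:: w; v] ->
  pedges a b x [:: w; v; y] = 0.
Proof.
rewrite /= !inE !negb_or => /and4P[/and3P[xw xv _] /andP[wv wy] vy _].
by move=> /andP[aw av] /andP[bw bv]; epsimp.
Qed.

Definition quad_edges (x y v w : V) := [:: (7, (x, y)); (6, (y, v)); (6, (v, w)); (6, (w, x))].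

Lemma quad_irred x y v w G' L : uniq [:: x; y; v; w] -> {subset [:: x; y; v; w] <= S} ->
  lifts G G' -> wf G' -> vset G' = S ->
  (forall P, is_part G P -> cr mu S P <= cr (mult G') S P + 2 * L) -> L <= 6 ->
  7 <= mult G' x y -> 6 <= mult G' y v -> 6 <= mult G' v w -> 6 <= mult G' w x -> False.
Proof.
move=> us sS lG wf' S' loss L6 m1 m2 m3 m4; apply: irred.
have := us; rewrite /= !inE !negb_or => /and4P[/and3P[xy xv xw] /andP[yv yw] vw _].
have ES : wedges [:: x; y; v; w] (quad_edges x y v w).
  by rewrite /wedges /= !inE; epsimp.
have sE : #|[set z in [:: x; y; v; w]]| = 4.
  by rewrite -[RHS]/(size [:: x; y; v; w]) -(card_uniqP us); apply: eq_card => z; rewrite inE.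
have XS : [set z in [:: x; y; v; w]] \proper S.
  rewrite properEcard sE (leq_trans _ n6) // andbT.
  by apply/subsetP => z; rewrite inE; apply: sS.
apply: (lift_reducible_intro wfG wS bdG n6 deg15 lG wf' S' loss L6 _ (quad_Ngood us)) => //.
- apply: wgraph_sub ES _ _ _ => //=; rewrite ?S' ?m1 ?m2 ?m3 ?m4 //.
  by epsimp.
- move=> A XA AS; have A4 : 4 <= #|A| by rewrite -sE subset_leq_card.
  have A0 : A != set0 by rewrite -card_gt0; apply: leq_trans A4.
  by have := bdG AS A0; move: A4 L6; clear; case: (bdP #|A|) => -[? ->]; lia.
Qed.

(** The lifted detour from x to y avoids v and w, so the other three sides of the 4-cycle keep their
    six edges while xy gains a seventh. *)
Lemma quad_path_irred x y v w w' v' : uniq [:: x; y; v; w] ->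
  6 <= mu x y -> 6 <= mu y v -> 6 <= mu v w -> 6 <= mu w x ->
  uniq [:: x; y; v; w; w'; v'] -> 0 < mu x w' -> 0 < mu w' v' -> 0 < mu v' y -> False.
Proof.
move=> us m1 m2 m3 m4 us6 p1 p2 p3.
have := us6; rewrite /= !inE !negb_or.
case/and5P=> /and5P[xy xv xw xw' xv'] /and4P[yv yw yw' yv'] /and3P[vw vw' vv'] /andP[ww' wv'] /andP[w'v' _].
have us' : uniq [:: x; w'; v'; y] by rewrite /= !inE; epsimp.
have ps : path (fun a b => 0 < mu a b) x [:: w'; v'; y] by rewrite /= p1 p2 p3.
have [|G' [lG wf' S' m']] := lift_path wfG us' _ (fun a b => pedges_le a b mC ps us'); first by [].
have ge a b : a \notin [:: w'; v'] -> b \notin [:: w'; v'] -> mu a b <= mult G' a b.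
  by move=> aw bw; have := m' a b; rewrite pedges_new //; clear; lia.
apply: (quad_irred (L := 3) us _ lG wf' S') => //.
- have xS : x \in S by case: (muS p1).
  have yS : y \in S by case: (muS p3).
  have m2' : 0 < mu y v by apply: leq_trans m2.
  have m4' : 0 < mu w x by apply: leq_trans m4.
  by move=> t; rewrite !inE => /or4P[]/eqP-> //; [case: (muS m2')|case: (muS m4')].
- have xS : x \in S by case: (muS p1).
  move=> P /andP[pP _]; apply: leq_trans (cr_loss pP m') _.
  by rewrite leq_add2l (leq_trans (cr_pedges pP (path_subset xS ps) us')).
- have := m' x y; rewrite pedges_new ?inE ?negb_or //=; epsimp => //.
  by move: m1; clear; lia.
- by apply: leq_trans m2 (ge _ _ _ _); rewrite !inE; epsimp.
- by apply: leq_trans m3 (ge _ _ _ _); rewrite !inE; epsimp.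
- by apply: leq_trans m4 (ge _ _ _ _); rewrite !inE; epsimp.
Qed.

Lemma quad_via_irred x y v w z : uniq [:: x; y; v; w; z] ->
  5 <= mu x y -> 6 <= mu y v -> 6 <= mu v w -> 6 <= mu w x ->
  2 <= mu x z -> 2 <= mu z y -> False.
Proof.
move=> us m1 m2 m3 m4 p1 p2.
have := us; rewrite /= !inE !negb_or.
case/and5P=> /and4P[xy xv xw xz] /and3P[yv yw yz] /andP[vw vz] wz _.
have usq : uniq [:: x; y; v; w] by rewrite /= !inE; epsimp.
have [t|G' [lG wf' S' m']] := @lift_via _ G x y [:: z; z] wfG xy.
  rewrite !inE orbb => /eqP ->; rewrite /= eqxx /= addn0.
  by split; rewrite // eq_sym.
have ge a b : a != z -> b != z -> mu a b <= mult G' a b.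
  move=> az bz; have := m' a b; rewrite /via !big_cons big_nil.
  have -> : epair a b x z = 0 by epsimp.
  by have -> : epair a b z y = 0 by [epsimp]; clear; lia.
have mxz : 0 < mu x z by apply: leq_trans p1.
have mzy : 0 < mu z y by apply: leq_trans p2.
apply: (quad_irred (L := 4) usq _ lG wf' S') => //.
- have [xS _] := muS mxz; have [_ yS] := muS mzy.
  have m2' : 0 < mu y v by apply: leq_trans m2.
  have m4' : 0 < mu w x by apply: leq_trans m4.
  by move=> t; rewrite !inE => /or4P[]/eqP-> //; [case: (muS m2')|case: (muS m4')].
- move=> P /andP[pP _]; apply: leq_trans (cr_loss pP m') _.
  rewrite leq_add2l; have [xS zS] := muS mxz; have [_ yS] := muS mzy.
  apply: (@cr_via _ _ _ x y [:: z; z]) => // t; rewrite !inE orbb => /eqP->.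
  by split; rewrite // eq_sym.
- have := m' x y; rewrite /via !big_cons big_nil; epsimp.
  by move: m1; clear; lia.
- by apply: leq_trans m2 (ge _ _ _ _); rewrite // eq_sym.
- by apply: leq_trans m3 (ge _ _ _ _); rewrite // eq_sym.
- by apply: leq_trans m4 (ge _ _ _ _); rewrite // eq_sym.
Qed.
End Reductions.

(** * Reducible triangles *)

Section TriangleReduction.
Variables (V : finType) (G : mgraph V).
Local Notation S := (vset G).
Local Notation mu := (mult G).
Hypothesis wfG : wf G.
Hypothesis wS : 23 * #|S| <= e2 mu S + 42.
Hypothesis bdG : forall A : {set V}, A \proper S -> A != set0 ->
  e2 mu A + bd #|A| <= 23 * (#|A| - 1).
Hypothesis n6 : 5 < #|S|.
Hypothesis deg15 : forall v, v \in S -> 15 <= \sum_(y in S) mu v y.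
Hypothesis irred : ~ lift_reducible G.

Let mC : forall x y, mu x y = mu y x. Proof. by case: wfG. Qed.
Let m0 : forall x, mu x x = 0. Proof. by case: wfG. Qed.
Let muS x y : 0 < mu x y -> x \in S /\ y \in S. Proof. by case: wfG => _ _; apply. Qed.

(** Lifting twice at y would turn six edges into eight. In [triangle_irred] this bounds the edges
    between the two outer vertices. *)
Lemma mu_le5 u u' y : u != u' -> y != u -> y != u' -> 2 <= mu u y -> 2 <= mu y u' -> mu u u' <= 5.
Proof.
move=> uu yu yu' m1 m2; rewrite leqNgt; apply/negP => m6.
have [uS _] : u \in S /\ y \in S by apply: muS; apply: leq_trans m1.
have [_ u'S] : y \in S /\ u' \in S by apply: muS; apply: leq_trans m2.
have le6 : mu u u' <= 6.
  have us : uniq [:: u; y; u'] by rewrite /= !inE; epsimp.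
  have ps : path (fun a b => 0 < mu a b) u [:: y; u'].
    by rewrite /= (leq_trans _ m1) // (leq_trans _ m2).
  exact: (path_mult_le6 wfG wS bdG n6 deg15 irred us ps).
have E6 : mu u u' = 6 by apply/eqP; rewrite eqn_leq le6.
apply: (via_irred wfG wS bdG n6 deg15 irred (zs := [:: y; y]) (k := 2) uu) => //;
  rewrite ?E6 // => z; rewrite !inE orbb => /eqP-> /=.
by rewrite eqxx /= addn0; split.
Qed.

Lemma cr_two_out P A u u' : is_part G P -> A \in P -> #|P| = 3 -> u != u' -> u \notin A -> u' \notin A ->
  u \in S -> u' \in S -> #|A| + 2 = #|S| ->
  cr mu S P = 2 * (\sum_(y in S) mu u y + \sum_(y in S) mu u' y - mu u u').
Proof.
move=> iP AP P3 uu uA u'A uS u'S cA; have /andP[pP _] := iP.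
have EA : A = S :\ u :\ u'.
  apply/eqP; rewrite eqEcard; apply/andP; split.
    apply/subsetP => z zA; rewrite !inE (subsetP (partitionS pP AP)) //.
    by rewrite !(contraTneq _ zA) // => ->.
  have := cardsD1 u S; have := cardsD1 u' (S :\ u); rewrite !inE uS u'S eq_sym uu /=.
  by move: cA; clear; lia.
have [B [C [[BP CP AB AC BC] ES EB]]] := sum_parts3 (e2 mu) pP AP P3.
have one X : X \in P -> #|X| = 1 -> e2 mu X = 0.
  by move=> _ /eqP/cards1P[t ->]; rewrite e2_set1.
have B1 : #|B| = 1.
  by have := partition_pos pP BP; have := partition_pos pP CP; move: ES cA; clear; lia.
have C1 : #|C| = 1.
  by have := partition_pos pP BP; have := partition_pos pP CP; move: ES cA; clear; lia.
have := crE mu pP; rewrite EB (one B) // (one C) // !addn0.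
rewrite (e2_D1 mC m0 uS) (e2_D1 mC m0 (A := S :\ u) (x := u')) -?EA; last by rewrite !inE eq_sym uu.
have EU : \sum_(y in S) mu u' y = mu u' u + \sum_(y in S :\ u) mu u' y by rewrite (big_setD1 u uS).
rewrite EU [mu u' u]mC; move: (cr _ _ _) (e2 _ _) (\sum_(y in S) _) (\sum_(y in _) _) (mu _ _).
by clear; lia.
Qed.

(** Lifting twice through u and twice through u' turns multiplicities 4, 4, 4 into 6, 6, 4. This may
    cost 8 edges, beyond the limit of [lift_reducible_intro], so S-goodness is checked by the
    position of u and u' relative to the part A containing the triangle. *)
Lemma triangle_irred x y z u u' : uniq [:: x; y; z; u; u'] ->
  4 <= mu x y -> 4 <= mu y z -> 4 <= mu x z ->
  2 <= mu x u -> 2 <= mu u y -> 2 <= mu y u' -> 2 <= mu u' z -> False.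
Proof.
move=> us mxy myz mxz mxu muy myu muz.
have := us; rewrite /= !inE !negb_or.
case/and5P=> /and4P[xy xz xu xu'] /and3P[yz yu yu'] /andP[zu zu'] uu _.
have [G1 [l1 wf1 S1 m1]] : exists G1, [/\ lifts G G1, wf G1, vset G1 = S & forall a b,
    mult G1 a b + via x y [:: u; u] a b = mu a b + 2 * epair a b x y].
  apply: (@lift_via _ G x y [:: u; u]) => // t; rewrite !inE orbb => /eqP-> /=.
  by rewrite eqxx; split; rewrite // eq_sym.
have [G2 [l2 wf2 S2 m2]] : exists G2, [/\ lifts G1 G2, wf G2, vset G2 = vset G1 & forall a b,
    mult G2 a b + via y z [:: u'; u'] a b = mult G1 a b + 2 * epair a b y z].
  apply: (@lift_via _ G1 y z [:: u'; u']) => // t; rewrite !inE orbb => /eqP-> /=.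
  rewrite eqxx /= addn0; split; rewrite 1?eq_sym //.
    have := m1 y u'; rewrite /via !big_cons !big_nil; epsimp.
    by move=> ->.
  have := m1 u' z; rewrite /via !big_cons !big_nil; epsimp.
  by move=> ->.
have [xS uS] : x \in S /\ u \in S by apply: muS; apply: leq_trans mxu.
have [yS u'S] : y \in S /\ u' \in S by apply: muS; apply: leq_trans myu.
have [_ zS] : x \in S /\ z \in S by apply: muS; apply: leq_trans mxz.
have g1 : 6 <= mult G2 x y.
  have := m1 x y; have := m2 x y; rewrite /via !big_cons !big_nil; epsimp.
  by move: mxy; clear; lia.
have g2 : 6 <= mult G2 y z.
  have := m1 y z; have := m2 y z; rewrite /via !big_cons !big_nil; epsimp.
  by move: myz; clear; lia.
have g3 : 4 <= mult G2 x z.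
  have := m1 x z; have := m2 x z; rewrite /via !big_cons !big_nil; epsimp.
  by move: mxz; clear; lia.
have us3 : uniq [:: x; y; z] by rewrite /= !inE; epsimp.
pose H := wgraph [:: x; y; z] [:: (6, (x, y)); (6, (y, z)); (4, (x, z))].
have HX t : (t \in vset H) = (t \in [:: x; y; z]) by rewrite inE.
apply: irred; exists G2, H; split.
- exact: liftseq_trans l1 l2.
- apply: wgraph_sub => //=; rewrite ?g1 ?g2 ?g3 //.
  + by rewrite /wedges /= !inE; epsimp.
  + by move=> t; rewrite S2 S1 !inE => /or3P[]/eqP->.
  + by epsimp.
- exact: triangle_Ngood.
apply: Sgood_contract; first by case: wf2.
- rewrite S2 S1 properE; apply/andP; split.
    by apply/subsetP => t; rewrite HX !inE => /or3P[]/eqP->.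
  by apply/subsetPn; exists u; rewrite // HX !inE; epsimp.
- by apply/set0Pn; exists x; rewrite HX inE eqxx.
rewrite {1}/is_part S2 S1 => P A iP AP /subsetP XA; have /andP[pP P2] := iP.
have [xA yA zA] : [/\ x \in A, y \in A & z \in A] by split; apply: XA; rewrite HX !inE eqxx ?orbT.
have via0 s t r : s \in A -> t \in A -> r \in A -> s != r -> t != r -> cr (via s t [:: r; r]) S P = 0.
  move=> sA tA rA sr tr.
  rewrite (eq_cr (g := fun a b => (epair a b s r + epair a b r t) + (epair a b s r + epair a b r t))) //.
    have := crD (fun a b => epair a b s r + epair a b r t) (fun a b => epair a b s r + epair a b r t) S P.
    have := crD (fun a b => epair a b s r) (fun a b => epair a b r t) S P.
    rewrite /= (cr_epair0 pP AP sA rA sr) (cr_epair0 pP AP rA tA) 1?eq_sym // => E ->.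
    by rewrite E.
  by move=> a b _ _; rewrite /via !big_cons !big_nil addn0.
have loss1 : cr (via x y [:: u; u]) S P <= 8.
  apply: (@cr_via _ _ _ x y [:: u; u]) => // t; rewrite !inE orbb => /eqP->.
  by rewrite ![u == _]eq_sym.
have loss2 : cr (via y z [:: u'; u']) S P <= 8.
  apply: (@cr_via _ _ _ y z [:: u'; u']) => // t; rewrite !inE orbb => /eqP->.
  by rewrite ![u' == _]eq_sym.
have pP1 : partition P (vset G1) by rewrite S1.
have := cr_loss pP1 m2; rewrite S1 => le2; have le1 := cr_loss pP m1.
have ev := cr_even mC m0 pP.
have evd := cr_even (f := mult G2) _ _ pP; have {}evd : ~~ odd (cr (mult G2) S P).
  by apply: evd; case: wf2.
have A3 : 2 < #|A|.
  rewrite -[3]/(size [:: x; y; z]) -(card_uniqP us3).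
  by apply/subset_leq_card/subsetP => t ts; apply: XA; rewrite HX.
(* The liftings through a vertex of A stay inside A and lose nothing, which halves the loss. *)
have [inA|outA] := boolP ((u \in A) || (u' \in A)).
  have loss : cr mu S P <= cr (mult G2) S P + 8.
    case/orP: inA => tA.
      by move: le1; rewrite (via0 x y u) //; move: le2 loss2; clear; lia.
    by move: le2; rewrite (via0 y z u') //; move: le1 loss1; clear; lia.
  have crb := cr_ge_bd wS bdG iP; rewrite (big_setD1 A) //= in crb.
  have bA : 16 <= bd #|A| by move: A3; clear; case: (bdP #|A|) => -[? ->]; lia.
  split=> [|P2'|P3].
  + by move: crb loss bA; clear; slia.
  + by have := cr_part2 wfG wS bdG n6 deg15 iP P2'; move: loss; clear; lia.
  + by have := cr_part3 wfG wS bdG n6 iP P3; move: loss; clear; lia.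
move: outA; rewrite negb_or => /andP[uA u'A].
have loss : cr mu S P <= cr (mult G2) S P + 16.
  by move: le1 le2 loss1 loss2; clear; lia.
split.
- have crb := cr_ge_bd wS bdG iP; rewrite (big_setD1 A) //= in crb.
  have bA : 16 <= bd #|A| by move: A3; clear; case: (bdP #|A|) => -[? ->]; lia.
  by move: crb loss bA; clear; slia.
- move=> P2'; have [B [BP BA EB cAB]] := parts2 pP AP P2'.
  (* Both outer vertices lie in the other part, so it is no singleton: [cr] is at least 46 + 29 - 42
     = 33, by parity 34 = 18 + 16. *)
  have B2 : 2 <= #|B| by apply/card_gt1P; exists u, u'; split=> //; rewrite EB inE ?uA ?u'A.
  have [B' [_ _ cAB' EF]] := sum_parts2 (fun X => bd #|X|) pP AP P2'.
  have b29 : 29 <= bd #|A| + bd #|B'|.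
    by move: B2 A3 n6 cAB cAB'; clear; case: (bdP #|A|) => -[? ->]; case: (bdP #|B'|) => -[? ->]; lia.
  have := cr_ge_bd wS bdG iP; rewrite EF P2'; move: b29 ev loss; move: (cr mu S P); clear; lia.
- move=> P3; have [B [C [[BP CP AB AC BC] ES EF]]] := sum_parts3 (fun X => bd #|X|) pP AP P3.
  have pB := partition_pos pP BP; have pC := partition_pos pP CP.
  (* If u and u' are the other two parts, at least 15 + 15 - 5 = 25 edges meet them, and 50 = 34 +
     16. *)
  have [c2|c2] := eqVneq (#|A| + 2) #|S|.
    have := cr_two_out iP AP P3 uu uA u'A uS u'S c2.
    have := deg15 uS; have := deg15 u'S; have := @mu_le5 u u' y uu yu yu'.
    rewrite [mu u y]mC [mu y u]mC => /(_ muy myu) => h5 d1 d2 E.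
    have : 50 <= cr mu S P by rewrite E; move: h5 d1 d2; clear; lia.
    by move: loss; clear; lia.
  have b25 : 25 <= bd #|A| + bd #|B| + bd #|C|.
    move: c2 A3 n6 ES pB pC; clear.
    by case: (bdP #|A|) => -[? ->]; case: (bdP #|B|) => -[? ->]; case: (bdP #|C|) => -[? ->]; lia.
  by have := cr_ge_bd wS bdG iP; rewrite EF P3; move: b25 loss; clear; lia.
Qed.
End TriangleReduction.

(** * Vertices of small degree *)

Section LiftsAtVertex.
Variable V : finType.
Implicit Types (G : mgraph V) (a b u v x y : V).

(** What the deletion arguments need to know about k liftings at v, in a form closed under
    composition. A lifting removes two edges, each counted twice by [cr], whence [4 * k]. *)
Record lifted v k G G'' : Prop := Lifted {
  lifted_seq : lifts_at v G G'';
  lifted_wf : wf G'';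
  lifted_vset : vset G'' = vset G;
  lifted_cr : forall P, partition P (vset G) ->
    cr (mult G) (vset G) P <= cr (mult G'') (vset G) P + 4 * k;
  lifted_degv : \sum_(y in vset G) mult G'' v y + 2 * k = \sum_(y in vset G) mult G v y;
  lifted_deg : forall u, u != v -> \sum_(y in vset G) mult G'' u y = \sum_(y in vset G) mult G u y;
  lifted_le : forall b, mult G'' v b <= mult G v b;
  lifted_ge : forall a b, a != v -> b != v -> mult G a b <= mult G'' a b;
  lifted_e2 : e2 (mult G'') (vset G :\ v) = e2 (mult G) (vset G :\ v) + 2 * k;
  lifted_e2_le : forall A : {set V}, v \notin A -> e2 (mult G'') A <= e2 (mult G) A + 2 * k }.

Lemma lifted0 v G : wf G -> lifted v 0 G G.
Proof. by move=> wfG; split=> //; try exact: liftseq0; move=> *; rewrite ?muln0 ?addn0. Qed.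

Lemma lifted_trans v k l G G1 G2 : lifted v k G G1 -> lifted v l G1 G2 -> lifted v (k + l) G G2.
Proof.
move=> [s1 w1 S1 c1 dv1 d1 b1 g1 e1 le1] [s2 w2 S2 c2 dv2 d2 b2 g2 e2' le2].
rewrite S1 in S2 c2 dv2 d2 e2'; split=> //.
- exact: liftseq_trans s1 s2.
- by move=> P pP; have := c1 P pP; have := c2 P pP; clear; lia.
- by move: dv1 dv2; clear; lia.
- by move=> u uv; rewrite d2 // d1.
- by move=> b; apply: leq_trans (b2 b) (b1 b).
- by move=> a b av bv; apply: leq_trans (g1 _ _ av bv) (g2 _ _ av bv).
- by rewrite e2' e1; clear; lia.
- by move=> A vA; have := le1 A vA; have := le2 A vA; clear; lia.
Qed.

Lemma lifted_step v x y G : wf G -> x != v -> y != v -> x != y -> 0 < mult G x v -> 0 < mult G v y ->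
  exists G1, [/\ lifted v 1 G G1,
    forall a b, a != v -> b != v -> mult G1 a b = mult G a b + epair a b x y &
    forall u, mult G1 v u + ((u == x) + (u == y)) = mult G v u].
Proof.
move=> wfG xv yv xy mx my; have [_ _ inS] := wfG.
have [xS vS] := inS _ _ mx; have [_ yS] := inS _ _ my.
have [G1 [l1 wf1 S1 m1]] := lift_step wfG xv yv xy mx my.
have mE a b : a != v -> b != v -> mult G1 a b = mult G a b + epair a b x y.
  by move=> av bv; have := m1 a b; epsimp.
have e2E (A : {set V}) : v \notin A ->
    e2 (mult G1) A = e2 (mult G) A + 2 * ((x \in A) && (y \in A)).
  move=> vA; rewrite -e2_epair // -e2D; apply: eq_e2 => a b aA bA.
  by apply: mE; [apply: contraNneq vA => <-|apply: contraNneq vA => <-].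
have deg u : \sum_(b in vset G) mult G1 u b + ((u == x) + (u == v) + ((u == v) + (u == y))) =
    \sum_(b in vset G) mult G u b + ((u == x) + (u == y)).
  have vy : v != y by rewrite eq_sym.
  rewrite -(degree_epair u xv xS vS) -(degree_epair u vy vS yS) -(degree_epair u xy xS yS).
  rewrite -!big_split /=.
  by apply: eq_bigr => b _; rewrite m1.
exists G1; split=> //; last first.
  move=> u; have := m1 v u; rewrite [epair v u x y]epair0_notin 1?eq_sym // addn0 => <-.
  by epsimp; rewrite [x == u]eq_sym.
split=> //.
- by apply: liftseqS l1 (liftseq0 _ _).
- move=> P pP; apply: leq_trans (cr_loss pP m1) _; rewrite leq_add2l.
  have /= -> := crD (fun a b => epair a b x v) (fun a b => epair a b v y) (vset G) P.
  rewrite -[4 * 1]/(2 + 2) leq_add // cr_epair_le // eq_sym //.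
- by have := deg v; rewrite eqxx ![v == _]eq_sym (negPf xv) (negPf yv); clear; lia.
- by move=> u uv; have := deg u; rewrite (negPf uv); clear; lia.
- by move=> b; have := m1 v b; rewrite [epair v b x y]epair0_notin 1?eq_sym //; clear; lia.
- by move=> a b av bv; rewrite mE // leq_addr.
- by rewrite e2E ?setD11 // !inE xv yv xS yS.
- by move=> A vA; rewrite e2E // leq_add2l; case: (_ && _).
Qed.

(** As long as a lifting remains to be done, v has degree at least 8, and since no multiplicity
    exceeds 7 it has two distinct neighbours. *)
Lemma lifted_exists v k G : wf G -> (forall x, mult G v x <= 7) ->
  2 * k + 6 <= \sum_(y in vset G) mult G v y -> exists G'', lifted v k G G''.
Proof.
elim: k G => [|k IH] G wfG le7 dk; first by exists G; apply: lifted0.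
have [mC m0 inS] := wfG.
have pick (A : {set V}) : 0 < \sum_(y in A) mult G v y -> exists2 x, x \in A & 0 < mult G v x.
  by rewrite lt0n sum_nat_eq0 negb_forall_in => /exists_inP[x xA mx]; exists x; rewrite // lt0n.
have [|x xS mx] := pick (vset G); first by move: dk; clear; lia.
have [|y] := pick (vset G :\ x).
  by move: dk (le7 x); rewrite (big_setD1 x) //=; clear; lia.
rewrite !inE => /andP[yx yS] my.
have neq z : 0 < mult G v z -> z != v by case: eqP => // ->; rewrite m0.
have xy : x != y by rewrite eq_sym.
have mx' : 0 < mult G x v by rewrite mC.
have [G1 [l1 _ _]] := lifted_step wfG (neq x mx) (neq y my) xy mx' my.
have [G2 l2] : exists G2, lifted v k G1 G2.
  apply: IH (lifted_wf l1) _ _.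
    by move=> z; apply: leq_trans (lifted_le l1 z) (le7 z).
  by rewrite (lifted_vset l1); have := lifted_degv l1; move: dk; clear; lia.
by exists G2; apply: lifted_trans l1 l2.
Qed.
End LiftsAtVertex.

(** * Lifting at a vertex and deleting it *)

Section Deletion.
Variables (V : finType) (G : mgraph V).
Local Notation S := (vset G).
Local Notation mu := (mult G).
Hypothesis wfG : wf G.
Hypothesis wS : 23 * #|S| <= e2 mu S + 42.
Hypothesis bdG : forall A : {set V}, A \proper S -> A != set0 ->
  e2 mu A + bd #|A| <= 23 * (#|A| - 1).
Hypothesis n5 : 4 < #|S|.

Let mC : forall x y, mu x y = mu y x. Proof. by case: wfG. Qed.
Let m0 : forall x, mu x x = 0. Proof. by case: wfG. Qed.
Let muS x y : 0 < mu x y -> x \in S /\ y \in S. Proof. by case: wfG => _ _; apply. Qed.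

Definition vertex_reducible := exists v G'',
  [/\ v \in S, lifts_at v G G'', Sgood (delv G'' v) &
      forall P, is_part G'' P -> ~ inN (quot G'' P)].

(** The deleted graph must avoid N and W*, hence 18 and 34; the lifted graph itself must only avoid
    N, hence 16 and 32. *)
Lemma vertex_reducible_intro v k G'' : v \in S -> lifted v k G G'' ->
  (forall P, partition P (S :\ v) -> 1 < #|P| ->
     [/\ 23 * #|P| <= cr (mult G'') (S :\ v) P + 42,
     #|P| = 2 -> 18 <= cr (mult G'') (S :\ v) P & #|P| = 3 -> 34 <= cr (mult G'') (S :\ v) P]) ->
  (forall P, is_part G P -> #|P| = 2 -> 16 <= cr (mult G'') S P) ->
  (forall P, is_part G P -> #|P| = 3 -> 32 <= cr (mult G'') S P) -> vertex_reducible.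
Proof.
move=> vS l H H2 H3; exists v, G''; have S'' := lifted_vset l.
have [mC'' _ _] := lifted_wf l.
split=> //; first exact: lifted_seq l.
- apply: Sgood_cr => /=; rewrite ?S''.
  + by move=> x y; rewrite andbC mC''.
  + by have := cardsD1 v S; rewrite vS; move: n5; clear; lia.
  + move=> P; rewrite /is_part /= S'' => /andP[pP P2].
    rewrite (eq_cr (g := mult G'')) //; first exact: H.
    by move=> x y; rewrite !inE => /andP[-> _] /andP[-> _].
- move=> P; rewrite /is_part S'' => iP; have /andP[pP _] := iP.
  move/inN_e2; rewrite /= quot_e2 ?S'' // => -[][E C].
    by have := leq_trans (H2 P iP E) C.
  by have := leq_trans (H3 P iP E) C.
Qed.

(** With n vertices, G has [e2] at least 23n - 42 and G - v at most 23(n - 2) - 20; the difference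
    is 24. *)
Lemma deg_ge12 v : v \in S -> 12 <= \sum_(y in S) mu v y.
Proof.
move=> vS; have := e2_D1 mC m0 vS.
have cD : #|S| = (#|S :\ v|).+1 by rewrite (cardsD1 v) vS.
have := bdG (A := S :\ v); rewrite properD1 // -card_gt0 => /(_ isT).
have b20 : bd #|S :\ v| = 20 by move: cD n5; clear; case: (bdP #|S :\ v|) => -[? ->]; lia.
rewrite b20; move: wS cD n5; move: (e2 _ _) (e2 _ _) (\sum_(_ in _) _); clear; lia.
Qed.

(** Liftings at v change no degree except that of v, which settles singleton parts. Otherwise the
    [bd] sum is at least 9 + 16, so [cr] was at least 29 before the liftings. *)
Lemma lifted_part2 v k G'' P : lifted v k G G'' -> is_part G P -> #|P| = 2 ->
  8 <= \sum_(y in S) mult G'' v y -> 16 + 4 * k <= 28 ->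
  16 <= cr (mult G'') S P.
Proof.
move=> l iP P2 d8 k3; have /andP[pP _] := iP.
have [A AP] : exists A, A \in P by apply/card_gt0P; rewrite P2.
have [B [BP _ ES EB]] := sum_parts2 (fun X => bd #|X|) pP AP P2.
have one X : X \in P -> #|X| = 1 -> 16 <= cr (mult G'') S P.
  move=> XP /eqP/cards1P[u Xu]; rewrite Xu in XP.
  have uS : u \in S by rewrite -sub1set (partitionS pP).
  have := @cr_part1 _ G'' (lifted_wf l) P u; rewrite /is_part (lifted_vset l) => /(_ iP XP P2) ->.
  have [->|uv] := eqVneq u v; first by move: d8; clear; lia.
  by rewrite (lifted_deg l uv); have := deg_ge12 uS; clear; lia.
have [A1|A1] := eqVneq #|A| 1; first exact: one AP A1.
have [B1|B1] := eqVneq #|B| 1; first exact: one BP B1.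
have := cr_ge_bd wS bdG iP; rewrite EB P2; have := lifted_cr l pP.
have b25 : 25 <= bd #|A| + bd #|B|.
  move: (partition_pos pP AP) (partition_pos pP BP) A1 B1 ES n5; clear.
  by case: (bdP #|A|) => -[? ->]; case: (bdP #|B|) => -[? ->]; lia.
by move: b25 k3; clear; lia.
Qed.

Lemma sum_bd_part3 P : is_part G P -> #|P| = 3 -> 16 <= \sum_(A in P) bd #|A|.
Proof.
move=> iP P3; have /andP[pP _] := iP.
have [A AP] : exists A, A \in P by apply/card_gt0P; rewrite P3.
have [B [C [[BP CP _ _ _] ES ->]]] := sum_parts3 (fun X => bd #|X|) pP AP P3.
move: (partition_pos pP AP) (partition_pos pP BP) (partition_pos pP CP) ES n5; clear.
by case: (bdP #|A|) => -[? ->]; case: (bdP #|B|) => -[? ->]; case: (bdP #|C|) => -[? ->]; lia.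
Qed.

Lemma mu_le7_all v x : mu v x <= 7.
Proof.
have [m|] := ltnP 0 (mu v x); last by rewrite leqn0 => /eqP->.
have [vS xS] := muS m; apply: mu_le7 => //; first by move: n5; clear; lia.
by case: eqP m => // ->; rewrite m0.
Qed.

Lemma e2_delete v : v \in S ->
  e2 mu (S :\ v) + 2 * \sum_(y in S) mu v y = e2 mu S.
Proof. by move=> vS; rewrite (e2_D1 mC m0 vS). Qed.

Lemma low_degree_reducible v : 5 < #|S| -> v \in S -> \sum_(y in S) mu v y <= 14 ->
  vertex_reducible.
Proof.
move=> n6 vS d14; have d12 := deg_ge12 vS.
have [d dE] : exists d, d = \sum_(y in S) mu v y by exists (\sum_(y in S) mu v y).
(* With d - 11 liftings, G'' - v has exactly 11 edges fewer than G. This lowers [e2] by 22, while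
   the bound for one vertex fewer drops by 23. The degree left at v is 22 - d >= 8. *)
have [k kE] : exists k, k = d - 11 by exists (d - 11).
rewrite -dE in d12 d14.
have [G'' l] : exists G'', lifted v k G G''.
  apply: lifted_exists wfG _ _; first exact: mu_le7_all.
  by rewrite -dE; move: kE d12 d14; clear; lia.
have [mC'' m0'' _] := lifted_wf l.
have cD : #|S| = (#|S :\ v|).+1 by rewrite (cardsD1 v) vS.
apply: (vertex_reducible_intro vS l).
- move=> P pP P2; have E'' := crE (mult G'') pP.
  have e2D := e2_delete vS; rewrite -dE in e2D.
  have [/forall_inP small|] := boolP [forall A in P, #|A| <= 1].
    have nP : #|P| = #|S :\ v|.
      rewrite (card_partition pP) -sum1_card; apply: eq_bigr => A AP.
      by have := small A AP; have := partition_pos pP AP; clear; lia.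
    have E0 : \sum_(A in P) e2 (mult G'') A = 0.
      rewrite big1 // => A AP; have /cards1P[u ->] : #|A| == 1.
        by have := small A AP; have := partition_pos pP AP; clear; lia.
      by rewrite e2_set1.
    rewrite E0 addn0 (lifted_e2 l) in E''; rewrite E'' nP.
    have := wS; rewrite -e2D cD.
    move: kE d12 d14 n6; rewrite cD; move: #|S :\ v| (e2 _ _); clear.
    by move=> n e *; split; lia.
  rewrite negb_forall_in => /exists_inP[A AP]; rewrite -ltnNge => A2.
  (* For partitions with a larger part the new edges are ignored: deleting v costs at most 2 * 14
     against a gain of 23, and [bd] covers the difference 5. *)
  have mono : cr mu (S :\ v) P <= cr (mult G'') (S :\ v) P.
    rewrite /cr; apply: leq_sum => B BP; apply: leq_sum => x xB; apply: leq_sum => y.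
    rewrite !inE => /and3P[_ yv _]; apply: lifted_ge l _ _ _ yv.
    by have := subsetP (partitionS pP BP) x xB; rewrite !inE => /andP[].
  have bdP' B : B \in P -> e2 mu B + bd #|B| <= 23 * (#|B| - 1).
    move=> BP; apply: bdG (partition_neq0 pP BP).
    exact: sub_proper_trans (partitionS pP BP) (properD1 vS).
  have sb := sum_e2_parts pP bdP'; have Emu := crE mu pP.
  have main : 23 * #|P| + \sum_(B in P) bd #|B| <= cr (mult G'') (S :\ v) P + 47.
    move: wS sb Emu mono e2D d14; rewrite cD; clear.
    move: (\sum_(_ in _) e2 _ _) (\sum_(_ in _) bd _) (cr _ _ _) (cr _ _ _) (e2 _ (S :\ v)) (e2 _ S) #|S :\ v|.
    slia.
  split=> [|P2'|P3].
  + have : 9 <= \sum_(B in P) bd #|B|.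
      rewrite (big_setD1 A) //=; move: A2; clear; case: (bdP #|A|) => -[? ->]; lia.
    by move: main; clear; slia.
  + have [B [BP _ ES EB]] := sum_parts2 (fun X => bd #|X|) pP AP P2'.
    rewrite EB P2' in main; move: main (partition_pos pP BP) A2 ES n6; rewrite cD; clear.
    by case: (bdP #|A|) => -[? ->]; case: (bdP #|B|) => -[? ->]; lia.
  + have [B [C [[BP CP _ _ _] ES EB]]] := sum_parts3 (fun X => bd #|X|) pP AP P3.
    have b16 : 16 <= bd #|A| + bd #|B| + bd #|C|.
      move: (partition_pos pP BP) (partition_pos pP CP) A2 ES n6; rewrite cD; clear.
      by case: (bdP #|A|) => -[? ->]; case: (bdP #|B|) => -[? ->]; case: (bdP #|C|) => -[? ->]; lia.
    by rewrite EB P3 in main; move: b16 main; clear; lia.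
- move=> P iP P2; apply: (lifted_part2 l iP P2).
    by have := lifted_degv l; rewrite -dE; move: kE d12 d14; clear; lia.
  by move: kE d12 d14; clear; lia.
- move=> P iP P3; have /andP[pP _] := iP.
  have [A AP] : exists A, A \in P by apply/card_gt0P; rewrite P3.
  have [B [C [[BP CP _ _ _] ES EB]]] := sum_parts3 (fun X => bd #|X|) pP AP P3.
  have := cr_ge_bd wS bdG iP; rewrite EB P3; have := lifted_cr l pP.
  have b20 : 20 <= bd #|A| + bd #|B| + bd #|C|.
    move: (partition_pos pP AP) (partition_pos pP BP) (partition_pos pP CP) ES n6; clear.
    by case: (bdP #|A|) => -[? ->]; case: (bdP #|B|) => -[? ->]; case: (bdP #|C|) => -[? ->]; lia.
  by move: kE b20 d14; clear; lia.
Qed.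

(** The bounds give [e2 A <= 16 * (#|A| - 1)] for every part, hence [cr >= 16 * #|P| - 14]. For two,
    three and four parts this is 18, 34 and 50 = 23 * 4 - 42, each exactly or more than what is
    required. *)
Lemma five_core v k G'' : #|S| = 5 -> v \in S -> lifted v k G G'' -> k <= 2 ->
  13 <= \sum_(y in S) mu v y -> e2 (mult G'') (S :\ v) = 50 ->
  (forall x y, x \in S :\ v -> y \in S :\ v -> x != y -> mult G'' x y <= 8) ->
  (forall u, u \in S :\ v -> e2 (mult G'') (S :\ v :\ u) <= 32) -> vertex_reducible.
Proof.
move=> n5' vS l k2 d13 E50 pairs triples; have [mC'' m0'' _] := lifted_wf l.
have cD : #|S :\ v| = 4 by have := cardsD1 v S; rewrite vS n5' => -[].
apply: (vertex_reducible_intro vS l).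
- move=> P pP P2; have := crE (mult G'') pP; rewrite E50.
  have le16 A : A \in P -> e2 (mult G'') A + 16 <= 16 * #|A|.
    move=> AP; have Apr := partition_proper pP P2 AP; have := proper_card Apr.
    have := partition_pos pP AP; have /subsetP AS := proper_sub Apr; rewrite cD.
    case: (ltngtP #|A| 2) => A2; last first.
    + have /eqP/cards2P[x [y [xy EA]]] := A2; rewrite EA e2_set2 // cards2 xy.
      have xA : x \in A by rewrite EA !inE eqxx.
      have yA : y \in A by rewrite EA !inE eqxx orbT.
      by have := pairs x y (AS x xA) (AS y yA) xy; clear; lia.
    + move=> _ A4; have /properP[Asub [u uS uA]] := Apr.
      have : e2 (mult G'') A <= e2 (mult G'') (S :\ v :\ u).
        apply: e2_sub; apply/subsetP => z zA; rewrite in_setD1 AS // andbT.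
        by apply: contraNneq uA => <-.
      by have := triples u uS; move: A2; clear; lia.
    + move=> A0 _; have /eqP/cards1P[x EA] : #|A| = 1 by move: A0 A2; clear; lia.
      by rewrite EA e2_set1 // cards1.
  have sum16 : \sum_(A in P) e2 (mult G'') A + 16 * #|P| <= 64.
    have -> : 16 * #|P| = \sum_(A in P) 16 by rewrite sum_nat_const mulnC.
    have -> : 64 = \sum_(A in P) 16 * #|A| by rewrite -big_distrr -(card_partition pP) cD.
    rewrite -big_split /=.
    by apply: leq_sum => A AP; apply: le16.
  have := card_partition_le pP; rewrite cD.
  move: (cr _ _ _) (\sum_(_ in _) _) sum16 P2 => c s; clear => *; split=> *; slia.
- move=> P iP P2; apply: (lifted_part2 l iP P2).
    by have := lifted_degv l; move: k2 d13; clear; lia.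
  by move: k2; clear; lia.
- move=> P iP P3; have /andP[pP _] := iP.
  have := sum_bd_part3 iP P3; have := cr_ge_bd wS bdG iP; rewrite P3.
  by have := lifted_cr l pP; move: k2; clear; lia.
Qed.

Lemma e2_triangle_le v u : #|S| = 5 -> v \in S -> u \in S :\ v -> e2 mu (S :\ v :\ u) <= 30.
Proof.
move=> n5' vS uS.
have c3 : #|S :\ v :\ u| = 3.
  have c4 : #|S :\ v| = 4 by have := cardsD1 v S; rewrite vS n5' => -[].
  by have := cardsD1 u (S :\ v); rewrite uS c4 => -[].
have := bdG (A := S :\ v :\ u); rewrite -card_gt0 c3 => /(_ _ isT).
by rewrite /bd /= => H; have {H} := H (sub_proper_trans (subD1set _ _) (properD1 vS)); clear; lia.
Qed.

Lemma five_vertices_reducible : #|S| = 5 -> vertex_reducible.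
Proof.
move=> n5'; have ev := e2_even mC m0 S.
have [v vS vmin] : exists2 v, v \in S & 5 * \sum_(y in S) mu v y <= e2 mu S.
  apply/exists_inP; apply: contraT; rewrite negb_exists_in => /forall_inP H.
  suff : \sum_(v in S) (e2 mu S).+1 <= \sum_(v in S) 5 * \sum_(y in S) mu v y.
    by rewrite sum_nat_const n5' -big_distrr /= -/(e2 mu S); clear; lia.
  by apply: leq_sum => v vS; rewrite ltnNge H.
have eD := e2_delete vS.
have c4 : #|S :\ v| = 4 by have := cardsD1 v S; rewrite vS n5' => -[].
have evD := e2_even mC m0 (S :\ v).
have E48 : e2 mu (S :\ v) <= 49.
  by have := bdG (properD1 vS); rewrite -card_gt0 c4 /bd /= => /(_ isT); clear; lia.
have w := wS; rewrite n5' in w.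
have [d dE] : exists d, d = \sum_(y in S) mu v y by exists (\sum_(y in S) mu v y).
rewrite -dE in vmin eD.
(* By parity [e2] is at least 74 on S and at most 48 on S - v. The choice of v gives 5d <=
   [e2 mu S], so [e2] on S - v is at least 3d as well as 74 - 2d. One or two liftings then reach the
   50 of [five_core]. *)
have [/andP[/eqP E /andP[d13 d16]]|/andP[/eqP E /andP[d14 d15]]] :
   (e2 mu (S :\ v) == 48) && (13 <= d <= 16) \/ (e2 mu (S :\ v) == 46) && (14 <= d <= 15).
  by move: ev evD eD E48 w vmin; move: (e2 _ _) (e2 _ _); clear; lia.
- have [G'' l] : exists G'', lifted v 1 G G''.
    apply: lifted_exists wfG _ _; first exact: mu_le7_all.
    by rewrite -dE; move: d13; clear; lia.
  apply: (five_core n5' vS l) => //; first by rewrite -dE.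
  + by rewrite (lifted_e2 l) E.
  + move=> x y; rewrite !inE => /andP[xv _] /andP[yv _] xy.
    have [mC'' m0'' _] := lifted_wf l.
    have := @lifted_e2_le _ _ _ _ _ l [set x; y]; rewrite !e2_set2 // !inE negb_or.
    by rewrite ![v == _]eq_sym xv yv => /(_ isT); have := mu_le7_all x y; clear; lia.
  + move=> u uS; have := @lifted_e2_le _ _ _ _ _ l (S :\ v :\ u).
    rewrite !inE eqxx andbF => /(_ isT); have := e2_triangle_le n5' vS uS; clear; lia.
(* The two liftings are a v b and c v e. They must not both raise a pair that has 7 edges already.
   They must cover all neighbours of v, so that a triple missing a neighbour gains at most one edge;
   a triple missing a non-neighbour has few edges by [deg_ge12]. *)
suff [a [b [c [e [ab ce cov [avail twice]]]]]] : exists a b c e,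
  [/\ a != b, c != e, (forall u, 0 < mu v u -> u \in [:: a; b; c; e]) &
    (forall u, count_mem u [:: a; b; c; e] <= mu v u) /\
    (7 <= mu a b -> ~~ (((c == a) && (e == b)) || ((c == b) && (e == a))))].
  have neq z : 0 < mu v z -> z != v by case: eqP => // ->; rewrite m0.
  have av : 0 < mu v a by apply: leq_trans (avail a); rewrite /= eqxx.
  have bv : 0 < mu v b by apply: leq_trans (avail b); rewrite /= eqxx; case: (_ == b).
  have cv : 0 < mu v c.
    by apply: leq_trans (avail c); rewrite /= eqxx; case: (a == c); case: (b == c).
  have ev' : 0 < mu v e.
    by apply: leq_trans (avail e); rewrite /= eqxx; case: (a == e); case: (b == e); case: (c == e).
  have [G1 [l1 m1 r1]] := lifted_step wfG (neq a av) (neq b bv) ab (etrans (congr1 _ (mC a v)) av) bv.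
  have wf1 := lifted_wf l1; have [mC1 _ _] := wf1.
  have [G2 [l2 m2 _]] : exists G2, [/\ lifted v 1 G1 G2,
      forall x y, x != v -> y != v -> mult G2 x y = mult G1 x y + epair x y c e &
      forall u, mult G2 v u + ((u == c) + (u == e)) = mult G1 v u].
    apply: lifted_step => //; rewrite ?neq //.
      by rewrite mC1; have := avail c; have := r1 c; rewrite /= eqxx ![_ == c]eq_sym; clear; lia.
    have := avail e; have := r1 e; rewrite /= eqxx ![_ == e]eq_sym.
    by clear; lia.
  have l := lifted_trans l1 l2.
  have mE x y : x != v -> y != v -> mult G2 x y = mu x y + epair x y a b + epair x y c e.
    by move=> xv yv; rewrite m2 // m1.
  apply: (five_core n5' vS l) => //; first by rewrite -dE; apply: leq_trans d14.
  - by rewrite (lifted_e2 l) E.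
  - move=> x y; rewrite !inE => /andP[xv _] /andP[yv _] xy; rewrite mE //.
    have := mu_le7_all x y; have := epair_le1 x y a b; have := epair_le1 x y c e.
    case: (ltnP 0 (epair x y a b)) => [/epair_gt0 pab|]; last by clear; lia.
    case: (ltnP 0 (epair x y c e)) => [/epair_gt0 pce|]; last by clear; lia.
    case: (leqP 7 (mu x y)) => [m7|]; last by clear; lia.
    have m7' : 7 <= mu a b by case: pab => -[<- <-] //; rewrite mC.
    have := twice m7'; rewrite negb_or.
    by case: pab => -[<- <-]; case: pce => -[<- <-]; rewrite !eqxx ?andbF.
  - move=> u uS; pose T := S :\ v :\ u; rewrite -/T.
    have T0 z : z \in T -> z != v by rewrite !inE => /and3P[].
    have -> : e2 (mult G2) T = e2 mu T + 2 * ((a \in T) && (b \in T)) + 2 * ((c \in T) && (e \in T)).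
      rewrite -!e2_epair // -!e2D; apply: eq_e2 => x y xT yT.
      by rewrite mE ?T0.
    have [m|] := ltnP 0 (mu v u).
      have := e2_triangle_le n5' vS uS; rewrite -/T.
      have uT : (u \in T) = false by rewrite !inE eqxx.
      have /or4P cu : [|| u == a, u == b, u == c | u == e] by have := cov u m; rewrite !inE.
      by case: cu => /eqP <-; rewrite uT ?andbF /=; case: (_ && _); clear; lia.
    rewrite leqn0 => /eqP muv; have uS' : u \in S by move: uS; rewrite inE => /andP[].
    have := e2_D1 mC m0 uS; rewrite E -/T.
    have := deg_ge12 uS'; rewrite (big_setD1 v) //= mC muv add0n.
    by case: (_ && _); case: (_ && _); clear; lia.
have nbr (u : V) : (u \in [set u in S | 0 < mu v u]) = (0 < mu v u).
  by rewrite inE; case: ltnP => m; rewrite ?andbF // andbT; case: (muS m).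
have sumN : \sum_(y <- enum [set u in S | 0 < mu v u]) mu v y = d.
  rewrite big_enum dE [RHS](big_setID [set u in S | 0 < mu v u]) /= [X in _ = _ + X]big1.
    by rewrite addn0; apply: eq_bigl => u; rewrite !inE; case: (u \in S).
  by move=> u; rewrite !inE => /andP[+ uS]; rewrite uS -leqNgt leqn0 => /eqP.
have le4 : size (enum [set u in S | 0 < mu v u]) <= 4.
  rewrite -cardE -c4; apply/subset_leq_card/subsetP => u; rewrite nbr => m.
  by rewrite !inE; case: (muS m) => _ ->; rewrite andbT; apply: contraTneq m => ->; rewrite m0.
have inN' u : (u \in enum [set u in S | 0 < mu v u]) = (0 < mu v u) by rewrite mem_enum nbr.
have uN := enum_uniq [set u in S | 0 < mu v u].
(* Since d >= 14, v has at least two neighbours. With exactly two, both multiplicities are 7 and a v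
   b is lifted twice; seven edges between a and b would then give {v, a, b} 21 edges. With three, a
   neighbour of multiplicity at least 2 serves twice. *)
case: (enum _) inN' uN sumN le4 => [|a [|b [|c [|e [|? ?]]]]] inN' uN sumN le4 //.
- by move: sumN d14; rewrite big_nil; clear; lia.
- by move: sumN d14 (mu_le7_all v a); rewrite big_seq1; clear; lia.
- have m7a : mu v a = 7.
    by move: sumN d14 (mu_le7_all v a) (mu_le7_all v b); rewrite big_cons big_seq1; clear; lia.
  have m7b : mu v b = 7.
    by move: sumN d14 (mu_le7_all v a) (mu_le7_all v b); rewrite big_cons big_seq1; clear; lia.
  move: uN; rewrite /= inE andbT => ab; exists a, b, a, b; split=> //.
    by move=> u; rewrite -inN' !inE => /orP[]->; rewrite ?orbT.
  split=> [u|m7].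
    rewrite /=; have [<-|_] := eqVneq a u; first by rewrite m7a [b == a]eq_sym (negPf ab).
    by have [<-|_] := eqVneq b u; rewrite ?m7b.
  have va : v != a by apply/eqP => E'; move: m7a; rewrite -E' m0.
  have vb : v != b by apply/eqP => E'; move: m7b; rewrite -E' m0.
  have [aS bS] : a \in S /\ b \in S by split; [case: (@muS v a)|case: (@muS v b)]; rewrite ?m7a ?m7b.
  have vN : v \notin [set a; b] by rewrite !inE negb_or va vb.
  have c3 : #|v |: [set a; b]| = 3 by rewrite cardsU1 vN cards2 ab.
  have := bdG (A := v |: [set a; b]); rewrite -card_gt0 c3 => /(_ _ isT).
  have -> : v |: [set a; b] \proper S.
    by rewrite properEcard c3 n5' !subUset !sub1set vS aS bS.
  move=> /(_ isT); rewrite e2_setU1 // e2_set2 // big_setU1 ?inE // big_set1 m7a m7b /bd /=.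
  by move: m7; clear; lia.
- have covE u : 0 < mu v u -> u \in [:: a; b; c] by rewrite inN'.
  have [ma mb mc] : [/\ 0 < mu v a, 0 < mu v b & 0 < mu v c].
    by split; rewrite -inN' !inE eqxx ?orbT.
  move: uN; rewrite /= !inE negb_or andbT => /andP[/andP[ab ac] bc].
  have [m2|m2] := leqP 2 (mu v a).
    exists a, b, a, c; split=> //; first by move=> u /covE; rewrite !inE => /or3P[]->; rewrite ?orbT.
    split=> [u|_]; last by epsimp.
    rewrite /=; have [<-|_] := eqVneq a u; first by epsimp.
    have [<-|_] := eqVneq b u; first by epsimp.
    by case: eqVneq => [<-|].
  have {}m2 : 2 <= mu v b.
    move: sumN d14 m2 (mu_le7_all v c); rewrite !big_cons big_nil; clear; lia.
  exists b, a, b, c; split=> //; first by rewrite eq_sym.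
    by move=> u /covE; rewrite !inE => /or3P[]->; rewrite ?orbT.
  split=> [u|_]; last by epsimp.
  rewrite /=; have [<-|_] := eqVneq b u; first by epsimp.
  have [<-|_] := eqVneq a u; first by epsimp.
  by case: eqVneq => [<-|].
- have us := uN; move: uN; rewrite /= !inE !negb_or andbT.
  case/and3P=> /and3P[ab ac ae] /andP[bc be] ce.
  exists a, b, c, e; split=> //; first by move=> u; rewrite -inN'.
  split=> [u|_]; last by epsimp.
  by have := count_uniq_mem u us; rewrite inN' /= => ->; case: (mu v u).
Qed.
End Deletion.

(** * Bundles of parallel edges in an embedding *)

Section Embedding.
Variables (V : finType) (G : mgraph V) (D : finType) (tail : D -> V) (inv rot : {perm D}).
Local Notation mu := (mult G).
Hypothesis m0 : forall x, mu x x = 0.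
Hypothesis inv_ok : forall d, inv (inv d) = d /\ inv d != d.
Hypothesis card_mult : forall x y, #|[set d | (tail d == x) && (tail (inv d) == y)]| = mu x y.
Hypothesis rot_orbit : forall d, porbit rot d = [set e | tail e == tail d].
Hypothesis two_nbrs : forall d, exists2 e, tail e = tail d & tail (inv e) != tail (inv d).
Implicit Types d e : D.

Definition dart_head d := tail (inv d).
Definition face_perm : {perm D} := (inv * rot)%g.

Lemma invK d : inv (inv d) = d. Proof. by case: (inv_ok d). Qed.
Lemma phiE d : face_perm d = rot (inv d). Proof. by rewrite permM. Qed.

Lemma tail_rot d : tail (rot d) = tail d.
Proof.
have : rot d \in porbit rot d by rewrite -{1}[rot]expg1 mem_porbit.
by rewrite rot_orbit inE => /eqP.
Qed.

Lemma tail_phi d : tail (face_perm d) = dart_head d. Proof. by rewrite phiE tail_rot. Qed.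
Lemma target_inv d : dart_head (inv d) = tail d. Proof. by rewrite /dart_head invK. Qed.

Lemma mu_dart d : 0 < mu (tail d) (dart_head d).
Proof. by rewrite -card_mult; apply/card_gt0P; exists d; rewrite inE !eqxx. Qed.

Lemma tail_target d : tail d != dart_head d.
Proof. by apply/eqP => E; have := mu_dart d; rewrite -E m0. Qed.

(** Fails exactly on faces of length two, since a face of length one would come from a loop. *)
Definition nondigon d := face_perm (face_perm d) != d.

Lemma nd_phi d : nondigon (face_perm d) = nondigon d.
Proof. by rewrite /nondigon (inj_eq (@perm_inj _ face_perm)). Qed.

(* Rotating backwards across digons leads to the first dart of a bundle of parallel edges. *)
Definition back d := if nondigon d then d else inv (face_perm d).
Definition start d := iter #|D| back d.

Lemma rot_back d : ~~ nondigon d -> rot (back d) = d.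
Proof. by move=> nnd; rewrite /back (negPf nnd) -phiE; apply/eqP; rewrite -[_ == _]negbK. Qed.

Lemma tail_back d : tail (back d) = tail d.
Proof. by have [nnd|nnd] := boolP (nondigon d); [rewrite /back nnd|rewrite -[in RHS](rot_back nnd) tail_rot]. Qed.

Lemma target_back d : dart_head (back d) = dart_head d.
Proof. by rewrite /back; case: ifP => // _; rewrite target_inv tail_phi. Qed.

Lemma iter_back_tail n d : tail (iter n back d) = tail d /\ dart_head (iter n back d) = dart_head d.
Proof. by elim: n => //= n [<- <-]; rewrite tail_back target_back. Qed.

Lemma tail_start d : tail (start d) = tail d. Proof. by case: (iter_back_tail #|D| d). Qed.
Lemma target_start d : dart_head (start d) = dart_head d. Proof. by case: (iter_back_tail #|D| d). Qed.

Lemma back_id d : nondigon d -> back d = d. Proof. by rewrite /back => ->. Qed.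

(** If only digons were met, rotating backwards would run through all darts at the tail of d with
    the same head throughout, against [two_nbrs]. *)
Lemma nd_start d : nondigon (start d).
Proof.
apply: contraT => nds.
have nnd n : n <= #|D| -> ~~ nondigon (iter n back d).
  move=> nD; apply: contra nds => ndn; rewrite /start -(subnK nD) iterD.
  by elim: (#|D| - n) => //= k IH; rewrite back_id.
have E n : n <= #|D| -> iter n back d = ((rot^-1)^+n)%g d.
  elim: n => [|n IH] nD; first by rewrite expg0 perm1.
  apply: (@perm_inj _ rot).
  by rewrite /= rot_back ?nnd 1?ltnW // IH 1?ltnW // expgSr permM permKV.
have [e te] := two_nbrs d.
have : e \in porbit (rot^-1)%g d by rewrite porbitV rot_orbit inE te.
rewrite porbit_traject => /trajectP[i ilt ->]; rewrite -permX -E; last first.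
  by apply: ltnW; apply: leq_trans ilt (max_card _).
by rewrite -/(dart_head _) (iter_back_tail i d).2 eqxx.
Qed.

Lemma start_id d : nondigon d -> start d = d.
Proof. by move=> ndd; rewrite /start; elim: #|D| => //= n ->; rewrite back_id. Qed.

Lemma start_back d : start (back d) = start d.
Proof. by rewrite {1}/start -iterSr /= -/(start d) back_id // nd_start. Qed.

(* The first dart of the same bundle seen from the other end. *)
Definition bundle_mate d := start (inv d).

Lemma nd_mate d : nondigon (bundle_mate d). Proof. exact: nd_start. Qed.
Lemma tail_mate d : tail (bundle_mate d) = dart_head d. Proof. exact: tail_start. Qed.
Lemma target_mate d : dart_head (bundle_mate d) = tail d. Proof. by rewrite target_start target_inv. Qed.

Lemma mate_back d : bundle_mate (back d) = bundle_mate d.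
Proof.
rewrite /back; case: ifP => // /negbT nnd; rewrite /bundle_mate invK -start_back /back nd_phi (negPf nnd).
by move: nnd; rewrite negbK => /eqP ->.
Qed.

Lemma mate_start d : bundle_mate (start d) = bundle_mate d.
Proof. by rewrite /start; elim: #|D| => //= n IH; rewrite mate_back. Qed.

Lemma mateK d : nondigon d -> bundle_mate (bundle_mate d) = d.
Proof. by move=> ndd; rewrite mate_start /bundle_mate invK start_id. Qed.

Definition bundle_size d := #|[set e | start e == d]|.

Lemma sum_bsize : \sum_d bundle_size d = #|D|.
Proof.
rewrite -cardsT -sum1_card [RHS](partition_big start predT) //=; apply: eq_bigr => d _.
by rewrite /bundle_size -sum1_card; apply: eq_bigl => e; rewrite !inE.
Qed.

Lemma bsize_digon d : ~~ nondigon d -> bundle_size d = 0.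
Proof.
move=> nnd; apply/eqP; rewrite cards_eq0; apply/eqP/setP => e; rewrite !inE.
by apply: contraNF nnd => /eqP <-; apply: nd_start.
Qed.

Lemma bsize_gt0 d : nondigon d -> 0 < bundle_size d.
Proof. by move=> ndd; apply/card_gt0P; exists d; rewrite inE start_id. Qed.

Lemma bsize2_le d d' : d != d' -> tail d = tail d' -> dart_head d = dart_head d' ->
  bundle_size d + bundle_size d' <= mu (tail d) (dart_head d).
Proof.
move=> dd' td hd; rewrite -card_mult /bundle_size -cardsUI [X in _ + X](_ : _ = 0) ?addn0.
  apply/subset_leq_card/subsetP => e; rewrite !inE -/(dart_head e) -target_start -tail_start.
  by case/orP => /eqP ->; rewrite ?td ?hd !eqxx.
apply/eqP; rewrite cards_eq0; apply/eqP/setP => e; rewrite !inE.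
by apply: contraNF dd' => /andP[/eqP <- /eqP <-].
Qed.

Lemma bsize_le d : bundle_size d <= mu (tail d) (dart_head d).
Proof.
rewrite -card_mult; apply/subset_leq_card/subsetP => e; rewrite !inE -/(dart_head e).
by rewrite -target_start -tail_start => /eqP ->; rewrite !eqxx.
Qed.

Lemma bsize_mate d : nondigon d -> bundle_size (bundle_mate d) = bundle_size d.
Proof.
have le e : nondigon e -> bundle_size e <= bundle_size (bundle_mate e).
  move=> nde; rewrite /bundle_size -[X in X <= _](card_imset _ (@perm_inj _ inv)); apply/subset_leq_card/subsetP => f.
  case/imsetP => c; rewrite !inE => /eqP <- ->.
  by rewrite mate_start.
move=> ndd; apply/eqP; rewrite eqn_leq le // andbT.
by have := le _ (nd_mate d); rewrite mateK.
Qed.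

(* [face_perm (bundle_mate b)] starts the bundle that follows [b] around its tail. *)
Lemma degree_bundles (B : {set D}) b (S : {set V}) : b \in B -> {in B, forall e, nondigon e} ->
  {in B, forall e, face_perm (bundle_mate e) \in B} -> (forall e, tail e \in S) ->
  \sum_(y in S) mu (tail b) y <= \sum_(e in B) bundle_size e.
Proof.
move=> bB ndB clB tS.
have F e : tail e = tail b -> start e \in B.
  move=> te; have : e \in porbit rot b by rewrite rot_orbit inE te.
  case/porbitP => i -> {e te}; rewrite permX.
  elim: i => [|i IH] /=; first by rewrite start_id // ndB.
  set c := iter i rot b in IH *.
  (* Across a digon the next dart belongs to the same bundle; otherwise it starts the following
     bundle, which is in B by closure. *)
  have [ndc|ndc] := boolP (nondigon (rot c)); last first.
    rewrite -start_back; suff -> : back (rot c) = c by [].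
    by apply: (@perm_inj _ rot); rewrite rot_back.
  rewrite start_id //; have E : rot c = face_perm (inv c) by rewrite phiE invK.
  rewrite E nd_phi in ndc.
  have -> : rot c = face_perm (bundle_mate (start c)) by rewrite mate_start /bundle_mate start_id.
  exact: clB.
have -> : \sum_(y in S) mu (tail b) y = #|[set e | tail e == tail b]|.
  rewrite -sum1_card (partition_big dart_head [in S]) /=; last by move=> e _; apply: tS.
  apply: eq_bigr => y _; rewrite -card_mult -sum1_card.
  by apply: eq_bigl => e; rewrite !inE.
rewrite -sum1_card (partition_big start [in B]) /=; last first.
  by move=> e; rewrite inE => /eqP; apply: F.
apply: leq_sum => c cB; rewrite sum1_card; apply: subset_leq_card.
by apply/subsetP => e; rewrite unfold_in !inE => /andP[_].
Qed.
End Embedding.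

(** * Faces and discharging *)

Section Faces.
Variables (V : finType) (G : mgraph V).
Local Notation S := (vset G).
Local Notation mu := (mult G).
Hypothesis wfG : wf G.
Hypothesis wS : 23 * #|S| <= e2 mu S + 42.
Hypothesis bdG : forall A : {set V}, A \proper S -> A != set0 ->
  e2 mu A + bd #|A| <= 23 * (#|A| - 1).
Hypothesis n6 : 5 < #|S|.
Hypothesis deg15 : forall v, v \in S -> 15 <= \sum_(y in S) mu v y.
Hypothesis irred : ~ lift_reducible G.

Variables (D : finType) (tail : D -> V) (inv rot : {perm D}).
Hypothesis inv_ok : forall d, inv (inv d) = d /\ inv d != d.
Hypothesis card_mult : forall x y, #|[set d | (tail d == x) && (tail (inv d) == y)]| = mu x y.
Hypothesis rot_orbit : forall d, porbit rot d = [set e | tail e == tail d].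
Implicit Types d e : D.

Let mC : forall x y, mu x y = mu y x. Proof. by case: wfG. Qed.
Let m0 : forall x, mu x x = 0. Proof. by case: wfG. Qed.
Let muS x y : 0 < mu x y -> x \in S /\ y \in S. Proof. by case: wfG => _ _; apply. Qed.

Local Notation target := (dart_head tail inv).
Local Notation phi := (face_perm inv rot).
Local Notation nd := (nondigon inv rot).
Local Notation mate := (bundle_mate inv rot).
Local Notation bs := (bundle_size inv rot).

Lemma tail_in d : tail d \in S.
Proof. by case: (muS (mu_dart card_mult d)). Qed.

Lemma two_nbrs d : exists2 e, tail e = tail d & tail (inv e) != tail (inv d).
Proof.
have := deg15 (tail_in d); rewrite (bigID (pred1 (target d))) /=.
rewrite (big_pred1 (target d)); last first.
  by move=> y; rewrite /= andb_idl // => /eqP ->; case: (muS (mu_dart card_mult d)).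
move=> dg; have : 0 < \sum_(y in S | y != target d) mu (tail d) y.
  by have := mu7 wfG wS bdG n6 (tail d) (target d); move: dg; clear; lia.
rewrite lt0n sum_nat_eq0 negb_forall => /existsP[y]; rewrite negb_imply => /andP[/andP[_ yh]].
rewrite -lt0n -card_mult => /card_gt0P[e]; rewrite inE => /andP[/eqP te /eqP he].
by exists e; rewrite ?te // he.
Qed.

Let nd_mateP d : nd (mate d). Proof. exact: nd_mate two_nbrs _. Qed.
Let tail_mateP d : tail (mate d) = target d. Proof. exact: tail_mate. Qed.
Let target_mateP d : target (mate d) = tail d. Proof. exact: target_mate. Qed.
Let mateKP d : nd d -> mate (mate d) = d. Proof. exact: mateK two_nbrs _. Qed.
Let bs_mateP d : nd d -> bs (mate d) = bs d. Proof. exact: bsize_mate two_nbrs _. Qed.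
Let bs2 d d' : d != d' -> tail d = tail d' -> target d = target d' ->
  bs d + bs d' <= mu (tail d) (target d).
Proof. exact: bsize2_le. Qed.
Let bs1 d : bs d <= mu (tail d) (target d). Proof. exact: bsize_le. Qed.
Let bs_gt0 d : nd d -> 0 < bs d. Proof. exact: bsize_gt0. Qed.
Let bs_digonP d : ~~ nd d -> bs d = 0. Proof. exact: bsize_digon two_nbrs _. Qed.
Let tail_phiP d : tail (phi d) = target d. Proof. exact: tail_phi. Qed.

Lemma target_tail d : target d = tail (phi d). Proof. by rewrite tail_phiP. Qed.

Lemma mu_phi d : 0 < mu (tail d) (tail (phi d)).
Proof. by rewrite tail_phiP (mu_dart card_mult). Qed.

Lemma tail_neq d : tail d != tail (phi d).
Proof. by rewrite tail_phiP (tail_target m0 card_mult). Qed.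

Lemma bs7 d : bs d <= 7.
Proof. exact: leq_trans (bs1 d) (mu7 wfG wS bdG n6 _ _). Qed.

(** Used for contradiction: one, two or three small bundles that close up around a vertex cannot
    reach degree 15. *)
Lemma bundles_degree (s : seq D) b : b \in s -> all nd s ->
  all (fun e => phi (mate e) \in s) s -> 15 <= sumn (map bs s).
Proof.
move=> bs' /allP nds /allP cls.
have := degree_bundles inv_ok card_mult rot_orbit two_nbrs (B := [set e in s]) (b := b) _ _ _ tail_in.
rewrite inE bs' => /(_ isT) H.
apply: leq_trans (deg15 (tail_in b)) _; apply: leq_trans (H _ _) _.
- by move=> e; rewrite inE => /nds.
- by move=> e; rewrite !inE => /cls.
rewrite sumnE big_map; elim: s {bs' nds cls H} => [|a s IH].
  by rewrite big1 // => e; rewrite inE.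
rewrite big_cons; case: (boolP (a \in s)) => aS.
  apply: leq_trans (leq_trans IH (leq_addl _ _)); apply: eq_leq; apply: eq_bigl => e.
  by rewrite !inE; case: eqP => [->|//]; rewrite aS.
rewrite (_ : [set e in a :: s] = a |: [set e in s]); last by apply/setP => e; rewrite !inE.
by rewrite big_setU1 ?inE //= leq_add2l.
Qed.

(* The bundles on both sides of that of d at the head of d, when they lead to the
   same vertex, are distinct, or the head of d would have only two neighbours. *)
Lemma corner d e : nd d -> nd e -> phi e = mate d -> tail e = tail (phi (phi d)) ->
  bs d + bs e < 15 -> bs (phi d) + bs e <= mu (tail (phi d)) (tail e).
Proof.
move=> ndd nde Ee te small.
have he : target e = target d by rewrite target_tail Ee tail_mateP.
have neq : mate e != phi d.
  apply/eqP => E; move: small; rewrite ltnNge => /negP; apply.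
  have := @bundles_degree [:: mate d; mate e] (mate d); rewrite !inE eqxx /= => /(_ isT).
  rewrite !nd_mateP !mateKP // Ee -E !inE !eqxx ?orbT /= => /(_ isT isT).
  by rewrite !bs_mateP // addn0.
have E1 : tail (mate e) = tail (phi d) by rewrite tail_mateP he target_tail.
have E2 : target (mate e) = target (phi d) by rewrite target_mateP te -target_tail.
by have := bs2 neq E1 E2; rewrite bs_mateP // E1 target_mateP addnC.
Qed.

(** * Triangles, 4-faces and 5-faces *)

Definition tri d := phi (phi (phi d)) == d.
(** A face of length four may run back along itself, so distinct opposite corners are required; for
    a triangle distinct corners follow from the absence of loops. *)
Definition quad d := [&& phi (phi (phi (phi d))) == d, tail d != tail (phi (phi d)) &
  tail (phi d) != tail (phi (phi (phi d)))].

Lemma triE d : tri d -> phi (phi (phi d)) = d. Proof. by move/eqP. Qed.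
Lemma quadE d : quad d -> phi (phi (phi (phi d))) = d. Proof. by case/and3P=> /eqP. Qed.

Lemma nd_tail d : tail d != tail (phi (phi d)) -> nd d.
Proof. by apply: contraNneq => ->. Qed.

Lemma tri_phi d : tri (phi d) = tri d.
Proof. by rewrite /tri (inj_eq (@perm_inj _ phi)). Qed.

Lemma quad_phi d : quad d -> quad (phi d).
Proof.
move=> q; have E := quadE q; move: q; rewrite /quad => /and3P[_ n1 n2].
by rewrite E eqxx n2 eq_sym n1.
Qed.

Lemma tri_tail d : tri d -> tail d != tail (phi (phi d)).
Proof. by move=> t; rewrite -{1}(triE t) eq_sym tail_neq. Qed.

Lemma nd_tri d : tri d -> nd d. Proof. by move/tri_tail/nd_tail. Qed.
Lemma nd_quad d : quad d -> nd d. Proof. by case/and3P=> _ /nd_tail. Qed.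

Lemma mu_phi' d : 0 < mu (tail (phi d)) (tail d). Proof. by rewrite mC mu_phi. Qed.

(** On a face bounded by a cycle of length 3, 4 or 5, the rest of the boundary is such a path, so
    none of its bundles has size 7. *)
Lemma mu_le6_path d s : uniq (tail d :: s) -> path (fun u v => 0 < mu u v) (tail d) s ->
  1 < size s <= 4 -> last (tail d) s = tail (phi d) -> mu (tail d) (tail (phi d)) <= 6.
Proof. by move=> us ps sz <-; apply: (path_mult_le6 wfG wS bdG n6 deg15 irred us ps). Qed.

Lemma tri_mu d : tri d -> mu (tail d) (tail (phi d)) <= 6.
Proof.
move=> t; have := tri_tail t; have n1 := tail_neq d; have n2 := tail_neq (phi d) => n3.
apply: (mu_le6_path (s := [:: tail (phi (phi d)); tail (phi d)])) => //=.
  by rewrite !inE; epsimp.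
have := mu_phi' (phi (phi d)); rewrite (triE t) => ->; by rewrite (mu_phi' (phi d)).
Qed.

Lemma quad_mu d : quad d -> mu (tail d) (tail (phi d)) <= 6.
Proof.
move=> q; have E := quadE q; have /and3P[_ n1 n2] := q.
have n3 := tail_neq d; have n4 := tail_neq (phi d); have n5 := tail_neq (phi (phi d)).
have n6' := tail_neq (phi (phi (phi d))); rewrite E in n6'.
apply: (mu_le6_path (s := [:: tail (phi (phi (phi d))); tail (phi (phi d)); tail (phi d)])) => //=.
  by rewrite !inE; epsimp.
have := mu_phi' (phi (phi (phi d))); rewrite E => ->.
by rewrite (mu_phi' (phi d)) (mu_phi' (phi (phi d))).
Qed.

Lemma bs_mu d : bs d <= mu (tail d) (tail (phi d)).
Proof. by rewrite -target_tail. Qed.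

Lemma tri_bs d : tri d -> bs d <= 6.
Proof. by move=> t; apply: leq_trans (bs_mu d) (tri_mu t). Qed.

Lemma quad_bs d : quad d -> bs d <= 6.
Proof. by move=> q; apply: leq_trans (bs_mu d) (quad_mu q). Qed.

Lemma pent_bs d : phi (phi (phi (phi (phi d)))) = d ->
  uniq [:: tail d; tail (phi d); tail (phi (phi d)); tail (phi (phi (phi d)));
           tail (phi (phi (phi (phi d))))] -> bs d <= 6.
Proof.
move=> E us; apply: leq_trans (bs_mu d) _.
apply: (mu_le6_path (s := [:: tail (phi (phi (phi (phi d)))); tail (phi (phi (phi d)));
  tail (phi (phi d)); tail (phi d)])) => //=.
  move: us; rewrite /= !inE !negb_or => /and5P[/and4P[? ? ? ?] /and3P[? ? ?] /andP[? ?] ? _].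
  by epsimp.
have := mu_phi' (phi (phi (phi (phi d)))); rewrite E => ->.
by rewrite (mu_phi' (phi d)) (mu_phi' (phi (phi d))) (mu_phi' (phi (phi (phi d)))).
Qed.

(* If the bundle of d is also the next one on its face, then the vertex between
   them has a single neighbour. *)
Lemma backtrack d : nd d -> tail (phi (phi d)) = tail d -> bs d + bs (phi d) <= 7.
Proof.
move=> ndd E; have [Em|ne] := eqVneq (phi d) (mate d).
  have := @bundles_degree [:: mate d] (mate d); rewrite !inE eqxx /= => /(_ isT).
  rewrite nd_mateP mateKP // Em !inE eqxx /= => /(_ isT isT).
  by rewrite bs_mateP // addn0; have := bs7 d; clear; lia.
have E1 : tail (mate d) = tail (phi d) by rewrite tail_mateP target_tail.
have E2 : target (mate d) = target (phi d) by rewrite target_mateP -E -target_tail.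
rewrite eq_sym in ne; have := bs2 ne E1 E2; rewrite bs_mateP // => H.
exact: leq_trans H (mu7 wfG wS bdG n6 _ _).
Qed.

(** This and the next three lemmas complete 8K_2 as 6 + 2 or 5 + 3, through one or two intermediate
    vertices. *)
Lemma mu6_via x y z : mu x y = 6 -> 2 <= mu x z -> 2 <= mu z y -> False.
Proof.
move=> m6 m1 m2.
have xy : x != y by apply: (mu_neq wfG); rewrite m6.
have xz : x != z by apply: (mu_neq wfG); apply: leq_trans m1.
have zy : z != y by apply: (mu_neq wfG); apply: leq_trans m2.
have [xS yS] : x \in S /\ y \in S by apply: muS; rewrite m6.
apply: (via_irred wfG wS bdG n6 deg15 irred (zs := [:: z; z]) (k := 2) xy) => //; rewrite ?m6 //.
move=> t; rewrite !inE orbb => /eqP ->; rewrite /= eqxx /= addn0.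
by split; rewrite // eq_sym.
Qed.

Lemma mu6_via2 x y z z' : mu x y = 6 -> z != z' -> 0 < mu x z -> 0 < mu z y ->
  0 < mu x z' -> 0 < mu z' y -> False.
Proof.
move=> m6 zz m1 m2 m3 m4.
have xy : x != y by apply: (mu_neq wfG); rewrite m6.
have xz := mu_neq wfG m1; have zy := mu_neq wfG m2.
have xz' := mu_neq wfG m3; have z'y := mu_neq wfG m4.
have [xS yS] : x \in S /\ y \in S by apply: muS; rewrite m6.
apply: (via_irred wfG wS bdG n6 deg15 irred (zs := [:: z; z']) (k := 2) xy) => //; rewrite ?m6 //.
by move=> t; rewrite !inE => /orP[]/eqP -> /=; split; epsimp.
Qed.

Lemma mu5_via x y z : mu x y = 5 -> 3 <= mu x z -> 3 <= mu z y -> False.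
Proof.
move=> m5 m1 m2.
have xy : x != y by apply: (mu_neq wfG); rewrite m5.
have xz : x != z by apply: (mu_neq wfG); apply: leq_trans m1.
have zy : z != y by apply: (mu_neq wfG); apply: leq_trans m2.
have [xS yS] : x \in S /\ y \in S by apply: muS; rewrite m5.
apply: (via_irred wfG wS bdG n6 deg15 irred (zs := [:: z; z; z]) (k := 3) xy) => //; rewrite ?m5 //.
move=> t; rewrite !inE !orbb => /eqP ->; rewrite /= eqxx /= addn0.
by split; rewrite // eq_sym.
Qed.

Lemma mu5_via2 x y z z' : mu x y = 5 -> z != z' -> 2 <= mu x z -> 2 <= mu z y ->
  0 < mu x z' -> 0 < mu z' y -> False.
Proof.
move=> m5 zz m1 m2 m3 m4.
have xy : x != y by apply: (mu_neq wfG); rewrite m5.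
have xz : x != z by apply: (mu_neq wfG); apply: leq_trans m1.
have zy : z != y by apply: (mu_neq wfG); apply: leq_trans m2.
have xz' := mu_neq wfG m3; have z'y := mu_neq wfG m4.
have [xS yS] : x \in S /\ y \in S by apply: muS; rewrite m5.
apply: (via_irred wfG wS bdG n6 deg15 irred (zs := [:: z; z; z']) (k := 3) xy) => //; rewrite ?m5 //.
by move=> t; rewrite !inE orbA orbb => /orP[]/eqP -> /=; split; epsimp.
Qed.

Lemma tri_bs_mu d : tri d ->
  bs (phi d) <= mu (tail (phi d)) (tail (phi (phi d))) /\
  bs (phi (phi d)) <= mu (tail (phi (phi d))) (tail d).
Proof. by move=> t; have := bs_mu (phi (phi d)); rewrite (triE t); have := bs_mu (phi d). Qed.

Lemma tri_bs6 d : tri d -> bs d = 6 -> 2 <= bs (phi d) -> 2 <= bs (phi (phi d)) -> False.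
Proof.
move=> t b6 b1 b2; have [m1 m2] := tri_bs_mu t.
apply: (@mu6_via (tail d) (tail (phi d)) (tail (phi (phi d)))).
- by apply/eqP; rewrite eqn_leq tri_mu // -b6 bs_mu.
- by rewrite mC; apply: leq_trans m2.
- by rewrite mC; apply: leq_trans m1.
Qed.

Lemma tri_mu5 d : tri d -> bs d = 5 -> 2 <= bs (phi d) -> 2 <= bs (phi (phi d)) ->
  mu (tail d) (tail (phi d)) = 5.
Proof.
move=> t b5 b1 b2; have [m1 m2] := tri_bs_mu t.
have := tri_mu t; have := bs_mu d; rewrite b5 leq_eqVlt => /orP[/eqP <- //|m6 m6'].
exfalso; apply: (@mu6_via (tail d) (tail (phi d)) (tail (phi (phi d)))).
- by apply/eqP; rewrite eqn_leq m6'.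
- by rewrite mC; apply: leq_trans m2.
- by rewrite mC; apply: leq_trans m1.
Qed.

Lemma tri_bs5 d : tri d -> bs d = 5 -> 3 <= bs (phi d) -> 3 <= bs (phi (phi d)) -> False.
Proof.
move=> t b5 b1 b2; have [m1 m2] := tri_bs_mu t.
apply: (@mu5_via (tail d) (tail (phi d)) (tail (phi (phi d)))).
- by apply: tri_mu5 => //; apply: ltnW.
- by rewrite mC; apply: leq_trans m2.
- by rewrite mC; apply: leq_trans m1.
Qed.

Lemma tail_phi_mate d : nd d -> tail (mate d) = tail (phi d) /\ tail (phi (mate d)) = tail d.
Proof.
by move=> ndd; split; [rewrite tail_mateP target_tail|rewrite tail_phiP target_mateP].
Qed.

(** If the triangles on both sides of a bundle have the same third vertex, [corner] makes its
    bundles in the two triangles distinct at either end, so their sizes add up. *)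
Lemma same_apex d : tri d -> tri (mate d) ->
  tail (phi (phi (mate d))) = tail (phi (phi d)) ->
  bs (phi d) + bs (phi (phi (mate d))) <= mu (tail (phi d)) (tail (phi (phi d))) /\
  bs (phi (phi d)) + bs (phi (mate d)) <= mu (tail d) (tail (phi (phi d))).
Proof.
move=> t t' E; have ndd := nd_tri t; have nd' := nd_tri t'.
have [T1 T2] := tail_phi_mate ndd.
have le6 e : tri e -> bs e <= 6 := @tri_bs e.
split.
  have := @corner d (phi (phi (mate d))) ndd _ (triE t') E.
  rewrite E; apply; first by rewrite !nd_phi.
  have := le6 d t; have := le6 (phi (phi (mate d))); rewrite !tri_phi => /(_ t').
  by clear; lia.
rewrite addnC; have := @corner (mate d) (phi (phi d)) nd'; rewrite mateKP // T2; apply=> //.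
- by rewrite !nd_phi.
- exact: triE.
- have := le6 (mate d) t'; have := le6 (phi (phi d)); rewrite !tri_phi => /(_ t).
  by clear; lia.
Qed.

(** The two apexes allow one lifting each; if they coincide, [same_apex] allows two liftings at the
    common apex. *)
Lemma bs6_tri_tri d : tri d -> bs d = 6 -> tri (mate d) -> False.
Proof.
move=> t b6 t'; have ndd := nd_tri t; have nd' := nd_tri t'.
have m6 : mu (tail d) (tail (phi d)) = 6 by apply/eqP; rewrite eqn_leq tri_mu // -b6 bs_mu.
have [T1 T2] := tail_phi_mate ndd.
have P1 := mu_phi (phi d); have := mu_phi (phi (phi d)); rewrite (triE t) => P2.
have := mu_phi (phi (mate d)); rewrite T2 => Q1.
have := mu_phi (phi (phi (mate d))); rewrite (triE t') T1 => Q2.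
have [E|ne] := eqVneq (tail (phi (phi (mate d)))) (tail (phi (phi d))).
  have [H1 H2] := same_apex t t' E.
  have g e : nd e -> 0 < bs e := @bs_gt0 e.
  have g1 := g (phi d); have g2 := g (phi (phi d)).
  have g3 := g (phi (mate d)); have g4 := g (phi (phi (mate d))).
  rewrite !nd_phi in g1 g2 g3 g4.
  apply: (mu6_via m6 (z := tail (phi (phi d)))).
    by apply: leq_trans H2; move: (g2 ndd) (g3 nd'); clear; lia.
  by rewrite mC; apply: leq_trans H1; move: (g1 ndd) (g4 nd'); clear; lia.
by apply: (mu6_via2 m6 ne) => //; rewrite mC.
Qed.

(** The rest of the triangle and the rest of the 4-face are the two paths of [mu6_irred]. Where the
    apex is also a corner of the 4-face, [corner] supplies the second parallel edge. *)
Lemma bs6_tri_quad d : tri d -> bs d = 6 -> quad (mate d) -> False.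
Proof.
move=> t b6 q; have ndd := nd_tri t; have nd' := nd_quad q.
have m6 : mu (tail d) (tail (phi d)) = 6 by apply/eqP; rewrite eqn_leq tri_mu // -b6 bs_mu.
have [T1 T2] := tail_phi_mate ndd.
have P1 := mu_phi (phi d); have := mu_phi (phi (phi d)); rewrite (triE t) => P2.
have := mu_phi (phi (mate d)); rewrite T2 => Q1.
have Q2 := mu_phi (phi (phi (mate d))).
have := mu_phi (phi (phi (phi (mate d)))); rewrite (quadE q) T1 => Q3.
have /and3P[_] := q; rewrite T1 T2 => n1 n2.
have xy := mu_neq wfG (mu_phi d); have yz := mu_neq wfG P1; have zx := mu_neq wfG P2.
have xw := mu_neq wfG Q1; have wv := mu_neq wfG Q2; have vy := mu_neq wfG Q3.
have g e : nd e -> 0 < bs e := @bs_gt0 e.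
have g1 := g (phi d); have g2 := g (phi (phi d)).
have g3 := g (phi (mate d)); have g4 := g (phi (phi (phi (mate d)))).
rewrite !nd_phi in g1 g2 g3 g4.
have tb : bs (phi (phi d)) <= 6 by apply: tri_bs; rewrite !tri_phi.
have qb : bs (phi (phi (phi (mate d)))) <= 6 by apply: quad_bs; do 3!apply: quad_phi.
apply: (mu6_irred wfG wS bdG n6 deg15 irred (z := tail (phi (phi d)))
  (w := tail (phi (phi (mate d)))) (v := tail (phi (phi (phi (mate d))))) m6) => //.
- by rewrite /= !inE; epsimp.
- by rewrite /= !inE; epsimp.
- case: eqP => [E|_]; last by rewrite addn0 mC.
  have := @corner (mate d) (phi (phi d)) nd'; rewrite mateKP // T2 => H.
  apply: leq_trans (H _ _ _ _); rewrite ?nd_phi ?triE //.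
    by move: (g2 ndd) (g3 nd'); clear; lia.
  by rewrite bs_mateP // b6; move: tb; clear; lia.
- case: eqP => [E|_]; last by rewrite addn0 mC.
  have := @corner d (phi (phi (phi (mate d)))) ndd; rewrite E => H.
  rewrite mC; apply: leq_trans (H _ _ _ _); rewrite ?nd_phi ?quadE //.
    by move: (g1 ndd) (g4 nd'); clear; lia.
  by rewrite b6; move: qb; clear; lia.
Qed.

(** The three missing edges come from two liftings at the apex of the triangle of d and one at the
    other apex; coinciding apexes are again covered by [same_apex]. *)
Lemma bs5_tri_tri d : tri d -> bs d = 5 -> 2 <= bs (phi d) -> 2 <= bs (phi (phi d)) ->
  tri (mate d) -> False.
Proof.
move=> t b5 b1 b2 t'; have ndd := nd_tri t; have nd' := nd_tri t'.
have m5 := tri_mu5 t b5 b1 b2; have [M1 M2] := tri_bs_mu t.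
have [T1 T2] := tail_phi_mate ndd.
have := mu_phi (phi (mate d)); rewrite T2 => Q1.
have := mu_phi (phi (phi (mate d))); rewrite (triE t') T1 => Q2.
have [E|] := eqVneq (tail (phi (phi (mate d)))) (tail (phi (phi d))).
  have [H1 H2] := same_apex t t' E.
  have g e : nd e -> 0 < bs e := @bs_gt0 e.
  have g3 := g (phi (mate d)); have g4 := g (phi (phi (mate d))).
  rewrite !nd_phi in g3 g4.
  apply: (mu5_via m5 (z := tail (phi (phi d)))).
    by apply: leq_trans H2; move: b2 (g3 nd'); clear; lia.
  by rewrite mC; apply: leq_trans H1; move: b1 (g4 nd'); clear; lia.
rewrite eq_sym => ne; apply: (mu5_via2 m5 ne) => //; rewrite mC.
  exact: leq_trans M2.
exact: leq_trans M1.
Qed.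

Definition tri444 d := [&& tri d, bs d == 4, bs (phi d) == 4 & bs (phi (phi d)) == 4].

Lemma tri444_phi d : tri444 d -> tri444 (phi d).
Proof.
case/and4P=> t b1 b2 b3; apply/and4P; split=> //; first by rewrite tri_phi.
by rewrite triE.
Qed.

(** The outer apexes of the two neighbouring triangles are the u and u' of [triangle_irred]. Any
    coincidence produces two bundles of size 4 between the same vertices, more than 7 edges, or a
    vertex of too small degree. *)
Lemma tri444_irred d : tri444 d -> tri444 (mate d) -> tri444 (mate (phi d)) -> False.
Proof.
move=> /and4P[t /eqP b1 /eqP b2 /eqP b3] /and4P[t' /eqP c1 /eqP c2 /eqP c3].
move=> /and4P[s /eqP e1 /eqP e2 /eqP e3].
have ndd := nd_tri t; have nd' := nd_tri t'; have ndp : nd (phi d) by rewrite nd_phi.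
have [T1 T2] := tail_phi_mate ndd; have [U1 U2] := tail_phi_mate ndp.
have [M1 M2] := tri_bs_mu t; have [N1 N2] := tri_bs_mu t'; have [R1 R2] := tri_bs_mu s.
have M0 := bs_mu d; rewrite T1 T2 in N1 N2; rewrite U1 U2 in R1 R2.
rewrite b1 in M0; rewrite b2 in M1; rewrite b3 in M2.
rewrite c2 in N1; rewrite c3 in N2; rewrite e2 in R1; rewrite e3 in R2.
have pos a b : 4 <= mu a b -> a != b.
  by move=> m4; apply: (mu_neq wfG); apply: leq_trans m4.
have no8 a b : 4 + 4 <= mu a b -> False.
  by have := mu7 wfG wS bdG n6 a b; clear; lia.
have ndf : nd (phi (phi (mate d))) by rewrite !nd_phi.
have nds : nd (phi (phi (mate (phi d)))) by rewrite !nd_phi; apply: nd_tri.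
apply: (triangle_irred wfG wS bdG n6 deg15 irred (x := tail d) (y := tail (phi d))
  (z := tail (phi (phi d))) (u := tail (phi (phi (mate d))))
  (u' := tail (phi (phi (mate (phi d)))))).
- have xy := pos _ _ M0; have yz := pos _ _ M1; have zx := pos _ _ M2.
  have xu := pos _ _ N1; have uy := pos _ _ N2; have yu' := pos _ _ R1; have u'z := pos _ _ R2.
  have uz : tail (phi (phi (mate d))) != tail (phi (phi d)).
    apply/eqP => E; apply: (no8 (tail (phi d)) (tail (phi (phi (mate d))))).
    by have := corner ndd ndf (triE t') E; rewrite b1 b2 c3; apply.
  have u'x : tail (phi (phi (mate (phi d)))) != tail d.
    apply/eqP => E; apply: (no8 (tail (phi (phi d))) (tail (phi (phi (mate (phi d)))))).
    by have := corner ndp nds (triE s); rewrite (triE t) b2 b3 e3; apply.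
  (* If u = u', their bundles at the middle vertex are distinct and give 8 parallel edges, or equal,
     and then that vertex has only three bundles of size 4. *)
  have uu : tail (phi (phi (mate d))) != tail (phi (phi (mate (phi d)))).
    apply/eqP => E; set f := phi (phi (mate d)) in ndf E *.
    have Ef : phi f = mate d := triE t'.
    have Tf : target f = tail (phi d) by rewrite target_tail Ef T1.
    have [Em|ne] := eqVneq (mate f) (phi (mate (phi d))).
      have := @bundles_degree [:: mate f; mate d; phi d] (phi d).
      rewrite !inE eqxx !orbT /= => /(_ isT).
      rewrite !nd_mateP ndp !mateKP // Ef -Em !inE !eqxx !orbT /= => /(_ isT isT).
      by rewrite !bs_mateP // b1 b2 c3.
    apply: (no8 (tail (mate f)) (target (mate f))).
    have E1 : tail (mate f) = tail (phi (mate (phi d))) by rewrite tail_mateP Tf U2.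
    have E2 : target (mate f) = target (phi (mate (phi d))).
      by rewrite target_mateP E -target_tail.
    by have := bs2 ne E1 E2; rewrite bs_mateP // c3 e2.
  by rewrite /= !inE; epsimp.
- exact: M0.
- exact: M1.
- by rewrite mC.
- exact: leq_trans N1.
- exact: leq_trans N2.
- exact: leq_trans R1.
- exact: leq_trans R2.
Qed.

Lemma quad_data d : quad d ->
  [/\ uniq [:: tail d; tail (phi d); tail (phi (phi d)); tail (phi (phi (phi d)))],
      bs (phi d) <= mu (tail (phi d)) (tail (phi (phi d))) <= 6,
      bs (phi (phi d)) <= mu (tail (phi (phi d))) (tail (phi (phi (phi d)))) <= 6 &
      bs (phi (phi (phi d))) <= mu (tail (phi (phi (phi d)))) (tail d) <= 6].
Proof.
move=> q; have E := quadE q; have /and3P[_ n1 n2] := q.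
have q1 := quad_phi q; have q2 := quad_phi q1; have q3 := quad_phi q2.
split.
- have n3 := tail_neq d; have n4 := tail_neq (phi d); have n5 := tail_neq (phi (phi d)).
  have n6' := tail_neq (phi (phi (phi d))); rewrite E in n6'.
  by rewrite /= !inE; epsimp.
- by rewrite bs_mu quad_mu.
- by rewrite bs_mu quad_mu.
- by have := bs_mu (phi (phi (phi d))); have := quad_mu q3; rewrite E => -> ->.
Qed.

(** The rest of the second 4-face is the detour of [quad_path_irred]. A corner of it equal to the
    adjacent corner of the first face would push a multiplicity above 6 by [corner]; equal to the
    opposite one, it would give a diagonal and thus 25 edges on four vertices. *)
Lemma quad6666_quad d : quad d -> bs d = 6 -> bs (phi d) = 6 -> bs (phi (phi d)) = 6 ->
  bs (phi (phi (phi d))) = 6 -> quad (mate d) -> False.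
Proof.
move=> q b0 b1 b2 b3 q'; have ndd := nd_quad q; have nd' := nd_quad q'.
have [us /andP[M1 L1] /andP[M2 L2] /andP[M3 L3]] := quad_data q.
have [us' _ _ _] := quad_data q'.
have M0 := bs_mu d; rewrite b0 in M0; rewrite b1 in M1; rewrite b2 in M2; rewrite b3 in M3.
have [T1 T2] := tail_phi_mate ndd; rewrite T1 T2 in us'.
have := mu_phi (phi (mate d)); rewrite T2 => Q1.
have Q2 := mu_phi (phi (phi (mate d))).
have := mu_phi (phi (phi (phi (mate d)))); rewrite (quadE q') T1 => Q3.
have g e : nd e -> 0 < bs e := @bs_gt0 e.
have g3 := g (phi (mate d)); have g4 := g (phi (phi (phi (mate d)))).
rewrite !nd_phi in g3 g4.
have ww : tail (phi (phi (mate d))) != tail (phi (phi (phi d))).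
  apply/eqP => E; have := @corner (mate d) (phi (phi (phi d))) nd'.
  rewrite !nd_phi mateKP // T2 quadE // E bs_mateP // b0 b3 => /(_ ndd erefl erefl isT).
  by rewrite mC; move: L3 (g3 nd'); clear; lia.
have qb : bs (phi (phi (phi (mate d)))) <= 6 by apply: quad_bs; do 3!apply: quad_phi.
have vv : tail (phi (phi (phi (mate d)))) != tail (phi (phi d)).
  apply/eqP => E; have := @corner d (phi (phi (phi (mate d)))) ndd.
  rewrite !nd_phi quadE // E b0 b1 => /(_ nd' erefl erefl).
  by move: L1 (g4 nd') qb; clear; lia.
have sS : {subset [:: tail d; tail (phi d); tail (phi (phi d)); tail (phi (phi (phi d)))] <= S}.
  by move=> t; rewrite !inE => /or4P[]/eqP ->; apply: tail_in.
have n5 : 4 < #|S| by apply: ltnW.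
have le24 := set4_le wfG bdG n5 sS us.
have wv : tail (phi (phi (mate d))) != tail (phi (phi d)).
  apply/eqP => E; move: Q1; rewrite E; move: M0 M1 M2 M3 le24.
  by rewrite [mu _ (tail d)]mC; clear; lia.
have vw : tail (phi (phi (phi (mate d)))) != tail (phi (phi (phi d))).
  apply/eqP => E; move: Q3; rewrite E [mu _ (tail (phi d))]mC; move: M0 M1 M2 M3 le24.
  by rewrite [mu _ (tail d)]mC; clear; lia.
apply: (quad_path_irred wfG wS bdG n6 deg15 irred us M0 M1 M2 M3 _ Q1 Q2 Q3).
move: us us'; rewrite /= !inE !negb_or.
case/and4P => /and3P[? ? ?] /andP[? ?] ? _; case/and4P => /and3P[? ? ?] /andP[? ?] ? _.
by epsimp.
Qed.

(** By [corner] the apex of the triangle lies off the 4-cycle, and two liftings there raise the five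
    edges to seven. *)
Lemma quad5666_tri d : quad d -> bs d = 5 -> bs (phi d) = 6 -> bs (phi (phi d)) = 6 ->
  bs (phi (phi (phi d))) = 6 -> tri (mate d) -> 2 <= bs (phi (mate d)) ->
  2 <= bs (phi (phi (mate d))) -> False.
Proof.
move=> q b0 b1 b2 b3 t c1 c2; have ndd := nd_quad q; have nd' := nd_tri t.
have [us /andP[M1 L1] /andP[M2 L2] /andP[M3 L3]] := quad_data q.
have M0 := bs_mu d; rewrite b0 in M0; rewrite b1 in M1; rewrite b2 in M2; rewrite b3 in M3.
have [T1 T2] := tail_phi_mate ndd; have [N1 N2] := tri_bs_mu t; rewrite T1 T2 in N1 N2.
have zw : tail (phi (phi (mate d))) != tail (phi (phi (phi d))).
  apply/eqP => E; have := @corner (mate d) (phi (phi (phi d))) nd'.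
  rewrite !nd_phi mateKP // T2 quadE // E bs_mateP // b0 b3 => /(_ ndd erefl erefl isT).
  by rewrite mC; move: L3 c1; clear; lia.
have tb : bs (phi (phi (mate d))) <= 6 by apply: tri_bs; rewrite !tri_phi.
have zv : tail (phi (phi (mate d))) != tail (phi (phi d)).
  apply/eqP => E; have := @corner d (phi (phi (mate d))) ndd.
  rewrite !nd_phi triE // E b0 b1 => /(_ nd' erefl erefl).
  by move: L1 c2 tb; clear; lia.
have n1 := tail_neq (phi (mate d)); rewrite T2 in n1.
have := tail_neq (phi (phi (mate d))); rewrite (triE t) T1 => n2.
apply: (quad_via_irred wfG wS bdG n6 deg15 irred (z := tail (phi (phi (mate d)))) _ M0 M1 M2 M3).
- move: us; rewrite /= !inE !negb_or.
  case/and4P => /and3P[? ? ?] /andP[? ?] ? _.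
  by epsimp.
- exact: leq_trans N1.
- exact: leq_trans N2.
Qed.

(** * Discharging rules and the final charge of a face *)

Definition small d := tri d || quad d.

(* Doubled, since some transfers are of half a unit of charge: what the face of d
   receives across the bundle of d. *)
Definition received d : nat :=
  if bs d == 6 then 3 * (small d && ~~ small (mate d))
  else if bs d == 5 then
    nat_of_bool [&& tri d, 1 < bs (phi d), 1 < bs (phi (phi d)) & ~~ tri (mate d)]
  else if bs d == 4 then nat_of_bool (tri444 d && ~~ tri444 (mate d))
  else 0.

Definition given d := if nd d then received (mate d) else 0.

Lemma given_le3 d : given d <= 3.
Proof.
rewrite /given /received; case: ifP => // _; case: ifP => _; first by case: (_ && _).
case: ifP => _; first by case: (andb _ _).
by case: ifP => // _; case: (andb _ _).
Qed.

Lemma given_le1 d : bs d != 6 -> given d <= (bs d < 6).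
Proof.
rewrite /given; case: ifP => // ndd b6; rewrite /received bs_mateP // (negPf b6).
case: eqP => [->|_]; first by case: (andb _ _).
by case: eqP => // ->; case: (andb _ _).
Qed.

(** A bundle of size 7 carries 28 and gives nothing. As 28l <= 46l - 92 from l = 6 on, long faces
    need no further analysis. *)
Lemma given_load d : 4 * bs d + given d <= 28.
Proof.
have := bs7 d; have := given_le3 d; have := @given_le1 d; case: eqP => [->|ne] /= H g3 b7.
  by move: g3; clear; lia.
by move: (H isT) ne b7; case: leqP; clear; lia.
Qed.

Lemma given_load6 d : bs d <= 6 -> 4 * bs d + given d <= 27.
Proof.
have := given_le3 d; have := @given_le1 d; case: eqP => [->|ne] /= H g3 b7.
  by move: g3; clear; lia.
by move: (H isT) ne b7; case: leqP; clear; lia.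
Qed.

Lemma given_tri d : tri d -> given d <= 1 /\ (given d = 1 -> bs d = 4).
Proof.
move=> t; have ndd := nd_tri t; rewrite /given ndd /received bs_mateP // mateKP // /small t /=.
case: eqP => [|_]; first by rewrite andbF.
case: eqP => [|_]; first by rewrite !andbF.
by case: eqP => //; case: (_ && _).
Qed.

Lemma given_tri444 d : tri444 d -> given d = 0.
Proof.
move=> t; have /and4P[t' /eqP b1 _ _] := t; have ndd := nd_tri t'.
by rewrite /given ndd /received bs_mateP // mateKP // b1 /= t andbF.
Qed.

Lemma received_tri6 d : tri d -> bs d = 6 -> received d = 3.
Proof.
move=> t b6; rewrite /received b6 /= /small t /= negb_or.
case: (boolP (tri (mate d))) => [/(bs6_tri_tri t b6)//|_].
by case: (boolP (quad (mate d))) => [/(bs6_tri_quad t b6)|].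
Qed.

Lemma received_tri5 d : tri d -> bs d = 5 -> 1 < bs (phi d) -> 1 < bs (phi (phi d)) ->
  received d = 1.
Proof.
move=> t b5 b1 b2; rewrite /received b5 /= t b1 b2 /=.
by case: (boolP (tri (mate d))) => [/(bs5_tri_tri t b5 b1 b2)|].
Qed.

(** By [tri444_irred] at most one of the three adjacent faces is again a (4,4,4) triangle, so at
    least two of the bundles bring a half unit. *)
Lemma received_tri444 d : tri444 d -> 2 <= received d + received (phi d) + received (phi (phi d)).
Proof.
move=> t; have /and4P[t' /eqP b1 /eqP b2 /eqP b3] := t.
have s1 := tri444_phi t; have s2 := tri444_phi s1.
rewrite /received b1 b2 b3 /= t s1 s2 /=.
have i1 := tri444_irred t; have i2 := tri444_irred s1; have i3 := tri444_irred s2.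
rewrite (triE t') in i3.
case: (boolP (tri444 (mate d))) => c1; case: (boolP (tri444 (mate (phi d)))) => c2;
  case: (boolP (tri444 (mate (phi (phi d))))) => c3 //; exfalso; auto.
Qed.

(* [tri_ok a b c]: the bundle size [a] is admissible next to [b] and [c];
   [tri_rec a b c]: what its face then receives across it. *)
Definition tri_ok a b c :=
  ~~ [&& a == 6, 1 < b & 1 < c] && ~~ [&& a == 5, 2 < b & 2 < c].
Definition tri_rec a b c := if a == 6 then 3 else nat_of_bool [&& a == 5, 1 < b & 1 < c].

Lemma tri_arith a b c : 0 < a <= 6 -> 0 < b <= 6 -> 0 < c <= 6 ->
  tri_ok a b c -> tri_ok b c a -> tri_ok c a b -> ~~ [&& a == 4, b == 4 & c == 4] ->
  4 * (a + b + c) + ((a == 4) + (b == 4) + (c == 4)) <=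
  46 + (tri_rec a b c + tri_rec b c a + tri_rec c a b).
Proof.
pose P a b c := [&& tri_ok a b c, tri_ok b c a, tri_ok c a b & ~~ [&& a == 4, b == 4 & c == 4]] ==>
  (4 * (a + b + c) + ((a == 4) + (b == 4) + (c == 4)) <=
   46 + (tri_rec a b c + tri_rec b c a + tri_rec c a b)).
have /allP H : all (fun a => all (fun b => all (P a b) (iota 1 6)) (iota 1 6)) (iota 1 6) by [].
move=> ia ib ic o1 o2 o3 n4; have := H a; rewrite mem_iota => /(_ ia)/allP/(_ b).
rewrite mem_iota => /(_ ib)/allP/(_ c); rewrite mem_iota => /(_ ic).
by rewrite /P o1 o2 o3 n4.
Qed.

Lemma tri_ok_bs d : tri d -> tri_ok (bs d) (bs (phi d)) (bs (phi (phi d))).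
Proof.
move=> t; apply/andP; split; apply/negP => /and3P[/eqP b0 b1 b2].
  exact: (tri_bs6 t b0 b1 b2).
exact: (tri_bs5 t b0 b1 b2).
Qed.

Lemma tri_rec_bs d : tri d -> tri_rec (bs d) (bs (phi d)) (bs (phi (phi d))) <= received d.
Proof.
move=> t; rewrite /tri_rec; case: eqP => [b6|_]; first by rewrite received_tri6.
by case: and3P => // -[/eqP b5 b1 b2]; rewrite received_tri5.
Qed.

Lemma given_tri_le d : tri d -> given d <= (bs d == 4).
Proof.
move=> t; have [] := given_tri t; case: (given d) => [|[|?]] // _ E.
by rewrite E.
Qed.

Lemma tri_charge d : tri d ->
  92 + (4 * bs d + given d + (4 * bs (phi d) + given (phi d) +
        (4 * bs (phi (phi d)) + given (phi (phi d))))) <=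
  46 * 3 + (received d + (received (phi d) + received (phi (phi d)))).
Proof.
move=> t; have t1 : tri (phi d) by rewrite tri_phi.
have t2 : tri (phi (phi d)) by rewrite tri_phi.
have [t4|t4] := boolP (tri444 d).
  have s1 := tri444_phi t4; have s2 := tri444_phi s1.
  have := received_tri444 t4; rewrite !given_tri444 //.
  by case/and4P: t4 => _ /eqP -> /eqP -> /eqP ->; clear; lia.
have g0 := given_tri_le t; have g1 := given_tri_le t1; have g2 := given_tri_le t2.
have r0 := tri_rec_bs t; have r1 := tri_rec_bs t1; have r2 := tri_rec_bs t2.
rewrite (triE t) in r1 r2.
have rng e : tri e -> 0 < bs e <= 6 by move=> te; rewrite bs_gt0 ?nd_tri // tri_bs.
have := tri_arith (rng _ t) (rng _ t1) (rng _ t2).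
have := tri_ok_bs t2; have := tri_ok_bs t1; have := tri_ok_bs t; rewrite (triE t).
rewrite /tri444 t /= in t4; move=> -> -> -> /(_ isT isT isT t4).
move: g0 g1 g2 r0 r1 r2; move: (_ == 4) (_ == 4) (_ == 4) => x y z.
move: (tri_rec _ _ _) (tri_rec _ _ _) (tri_rec _ _ _); clear; lia.
Qed.

Lemma given_quad d : quad d -> 4 * bs d + given d <= 24 /\ (bs d != 6 -> 4 * bs d + given d <= 21).
Proof.
move=> q; have b6 := quad_bs q; have := @given_le1 d; case: eqP => [E6|ne] H; last first.
  have := H isT; have : bs d <= 5 by move: b6 ne; clear; lia.
  by case: leqP; clear; lia.
split=> //; rewrite /given nd_quad // /received bs_mateP ?nd_quad // E6 eqxx mateKP ?nd_quad //.
by rewrite /small q orbT andbF.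
Qed.

Lemma given_quad5666 d : quad d -> bs d != 6 -> bs (phi d) = 6 -> bs (phi (phi d)) = 6 ->
  bs (phi (phi (phi d))) = 6 -> 4 * bs d + given d <= 20.
Proof.
move=> q n6' b1 b2 b3; have b6 := quad_bs q; have := given_le1 n6'.
have [b5|b5] := eqVneq (bs d) 5; last first.
  have : bs d <= 4 by move: b6 n6' b5; clear; lia.
  by case: leqP; clear; lia.
move=> _; suff -> : given d = 0 by rewrite b5.
rewrite /given nd_quad // /received bs_mateP ?nd_quad // b5 /=.
by case: and4P => // -[t c1 c2 _]; case: (quad5666_tri q b5 b1 b2 b3 t c1 c2).
Qed.

Lemma received_quad6666 d : quad d -> bs d = 6 -> bs (phi d) = 6 -> bs (phi (phi d)) = 6 ->
  bs (phi (phi (phi d))) = 6 -> received d = 3.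
Proof.
move=> q b0 b1 b2 b3; rewrite /received b0 /= /small q orbT /= negb_or.
have ndd := nd_quad q.
have -> : ~~ tri (mate d).
  by apply/negP => t; apply: (bs6_tri_quad t); rewrite ?bs_mateP // mateKP.
by have -> : ~~ quad (mate d) by apply/negP => /(quad6666_quad q b0 b1 b2 b3).
Qed.

(** A 4-face can carry 46 * 4 - 92 = 92. Sizes (6,6,6,6) load 96 and receive at least 6; one bundle
    below 6 gives at most 72 + 20, because a bundle of size 5 gives nothing there; two give at most
    48 + 42. *)
Lemma quad_charge d : quad d ->
  92 + (4 * bs d + given d + (4 * bs (phi d) + given (phi d) +
        (4 * bs (phi (phi d)) + given (phi (phi d)) +
        (4 * bs (phi (phi (phi d))) + given (phi (phi (phi d))))))) <=
  46 * 4 + (received d + (received (phi d) + (received (phi (phi d)) +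
            received (phi (phi (phi d)))))).
Proof.
move=> q; have E := quadE q.
have q1 := quad_phi q; have q2 := quad_phi q1; have q3 := quad_phi q2.
have [x0 y0] := given_quad q; have [x1 y1] := given_quad q1.
have [x2 y2] := given_quad q2; have [x3 y3] := given_quad q3.
have z0 := given_quad5666 q; have z1 := given_quad5666 q1.
have z2 := given_quad5666 q2; have z3 := given_quad5666 q3.
have r0 := received_quad6666 q; have r1 := received_quad6666 q1.
rewrite E in z1 z2 z3 r1.
suff : (4 * bs d + given d) + (4 * bs (phi d) + given (phi d)) +
  (4 * bs (phi (phi d)) + given (phi (phi d))) +
  (4 * bs (phi (phi (phi d))) + given (phi (phi (phi d)))) <= 92 + (received d + received (phi d)).
  by clear; lia.
move: x0 x1 x2 x3 y0 y1 y2 y3 z0 z1 z2 z3 r0 r1.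
move: (4 * bs d + given d) (4 * bs (phi d) + given (phi d)) (4 * bs (phi (phi d)) + given (phi (phi d))).
move: (4 * bs (phi (phi (phi d))) + given (phi (phi (phi d)))) (received d) (received (phi d)).
move: (bs d) (bs (phi d)) (bs (phi (phi d))) (bs (phi (phi (phi d)))).
clear => b0 b1 b2 b3 X3 r0 r1 X0 X1 X2 x0 x1 x2 x3 y0 y1 y2 y3 z0 z1 z2 z3 R0 R1.
have [e0|n0] := eqVneq b0 6; have [e1|n1] := eqVneq b1 6;
  have [e2'|n2] := eqVneq b2 6; have [e3|n3] := eqVneq b3 6.
- by rewrite (R0 e0 e1 e2' e3) (R1 e1 e2' e3 e0); clear -x0 x1 x2 x3; lia.
- by have := z3 n3 e0 e1 e2'; clear -x0 x1 x2; lia.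
- by have := z2 n2 e3 e0 e1; clear -x0 x1 x3; lia.
- by have := y2 n2; have := y3 n3; clear -x0 x1; lia.
- by have := z1 n1 e2' e3 e0; clear -x0 x2 x3; lia.
- by have := y1 n1; have := y3 n3; clear -x0 x2; lia.
- by have := y1 n1; have := y2 n2; clear -x0 x3; lia.
- by have := y1 n1; have := y2 n2; clear -x0 x3; lia.
- by have := z0 n0 e1 e2' e3; clear -x1 x2 x3; lia.
- by have := y0 n0; have := y3 n3; clear -x1 x2; lia.
- by have := y0 n0; have := y2 n2; clear -x1 x3; lia.
- by have := y0 n0; have := y2 n2; clear -x1 x3; lia.
- by have := y0 n0; have := y1 n1; clear -x2 x3; lia.
- by have := y0 n0; have := y1 n1; clear -x2 x3; lia.
- by have := y0 n0; have := y1 n1; clear -x2 x3; lia.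
- by have := y0 n0; have := y1 n1; clear -x2 x3; lia.
Qed.

(** 34 = 4 * 7 + 3 + 3. Two such pairs fit into the 92 of a 4-face, and one pair with three full
    loads of 28 into the 138 of a 5-face. *)
Lemma backtrack_charge d : nd d -> tail (phi (phi d)) = tail d ->
  4 * bs d + given d + (4 * bs (phi d) + given (phi d)) <= 34.
Proof.
move=> ndd E; have := backtrack ndd E; have := given_le3 d; have := given_le3 (phi d).
by clear; lia.
Qed.

Lemma sum_face (f : D -> nat) d :
  \sum_(e in porbit phi d) f e = \sum_(e <- traject phi d #|porbit phi d|) f e.
Proof.
rewrite [RHS]big_uniq ?uniq_traject_porbit //=.
by apply: eq_bigl => e; rewrite porbit_traject.
Qed.

Lemma given_digon d : ~~ nd d -> 4 * bs d + given d = 0.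
Proof. by move=> nnd; rewrite /given (negPf nnd) bs_digonP. Qed.

(** 138 is 46 * 5 - 92. Either the boundary backtracks, or it is a 5-cycle, whose bundles have size
    at most 6 and load at most 27 each. *)
Lemma pent_charge d : nd d -> phi (phi (phi (phi (phi d)))) = d ->
  4 * bs d + given d + (4 * bs (phi d) + given (phi d) +
  (4 * bs (phi (phi d)) + given (phi (phi d)) +
  (4 * bs (phi (phi (phi d))) + given (phi (phi (phi d))) +
  (4 * bs (phi (phi (phi (phi d)))) + given (phi (phi (phi (phi d)))))))) <= 138.
Proof.
move=> ndd E; pose d1 := phi d; pose d2 := phi d1; pose d3 := phi d2; pose d4 := phi d3.
have E1 : phi d4 = d := E.
have nd1 : nd d1 by rewrite nd_phi. have nd2 : nd d2 by rewrite nd_phi.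
have nd3 : nd d3 by rewrite nd_phi. have nd4 : nd d4 by rewrite nd_phi.
have t0 := tail_neq d; have t1 := tail_neq d1; have t2 := tail_neq d2; have t3 := tail_neq d3.
have := tail_neq d4; rewrite E1 => t4.
rewrite -/d1 -/d2 -/d3 -/d4.
have l0 := given_load d; have l1 := given_load d1; have l2 := given_load d2.
have l3 := given_load d3; have l4 := given_load d4.
have [e0|n0] := eqVneq (tail d2) (tail d).
  by have := backtrack_charge ndd e0; rewrite -/d1; clear -l2 l3 l4; lia.
have [e1|n1] := eqVneq (tail d3) (tail d1).
  by have := backtrack_charge nd1 e1; rewrite -/d2; clear -l0 l3 l4; lia.
have [e2'|n2] := eqVneq (tail d4) (tail d2).
  by have := backtrack_charge nd2 e2'; rewrite -/d3; clear -l0 l1 l4; lia.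
have [e3|n3] := eqVneq (tail d) (tail d3).
  by have := @backtrack_charge d3 nd3; rewrite -/d4 E1 => /(_ e3); clear -l0 l1 l2; lia.
have [e4|n4] := eqVneq (tail d1) (tail d4).
  by have := @backtrack_charge d4 nd4; rewrite E1 => /(_ e4); clear -l1 l2 l3; lia.
have us : uniq [:: tail d; tail d1; tail d2; tail d3; tail d4].
  by rewrite /= !inE -/d1 -/d2 -/d3 -/d4 in t0 t1 t2 t3 t4 *; epsimp.
have rot_us n : uniq (seq.rot n [:: tail d; tail d1; tail d2; tail d3; tail d4]) by rewrite rot_uniq.
have b0 := given_load6 (pent_bs (d := d) E us).
have b1 : 4 * bs d1 + given d1 <= 27.
  by apply/given_load6/pent_bs; rewrite -/d2 -/d3 -/d4 E1 //; apply: (rot_us 1).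
have b2 : 4 * bs d2 + given d2 <= 27.
  by apply/given_load6/pent_bs; rewrite -/d3 -/d4 E1 -/d1 //; apply: (rot_us 2).
have b3 : 4 * bs d3 + given d3 <= 27.
  by apply/given_load6/pent_bs; rewrite -/d4 E1 -/d1 -/d2 //; apply: (rot_us 3).
have b4 : 4 * bs d4 + given d4 <= 27.
  by apply/given_load6/pent_bs; rewrite E1 -/d1 -/d2 -/d3 //; apply: (rot_us 4).
by clear -b0 b1 b2 b3 b4; lia.
Qed.

Lemma face_charge d :
  92 + \sum_(e in porbit phi d) (4 * bs e + given e) <=
  46 * #|porbit phi d| + \sum_(e in porbit phi d) received e.
Proof.
rewrite !sum_face; have := uniq_traject_porbit phi d; have := iter_porbit phi d.
have : 0 < #|porbit phi d| by apply/card_gt0P; exists d; apply: porbit_id.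
have [l6 _ _ _|] := leqP 6 #|porbit phi d|.
  have : \sum_(e <- traject phi d #|porbit phi d|) (4 * bs e + given e) <= 28 * #|porbit phi d|.
    rewrite -[X in _ <= 28 * X](size_traject phi d) -sum1_size big_distrr /=.
    by apply: leq_sum => e _; rewrite muln1 given_load.
  by move: l6; clear; lia.
case: #|porbit phi d| => [|[|[|[|[|[|n]]]]]] //= _ _ E us; rewrite ?big_cons ?big_nil /= ?addn0.
(* Length one is a loop. A digon balances exactly, 92 = 46 * 2, since all its bundle sizes are 0. *)
- by have := tail_neq d; rewrite E eqxx.
- by rewrite !given_digon // ?nd_phi /nondigon E eqxx.
- by apply: tri_charge; apply/eqP.
- have ndd : nd d.
    by rewrite /nondigon eq_sym; case/andP: us; rewrite !inE !negb_or => /and3P[].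
  have [e0|n0] := eqVneq (tail d) (tail (phi (phi d))).
    have := backtrack_charge ndd (esym e0).
    have := @backtrack_charge (phi (phi d)); rewrite E !nd_phi => /(_ ndd e0).
    by clear; lia.
  have [e1|n1] := eqVneq (tail (phi d)) (tail (phi (phi (phi d)))).
    have := @backtrack_charge (phi d); rewrite nd_phi => /(_ ndd (esym e1)).
    have := @backtrack_charge (phi (phi (phi d))); rewrite E !nd_phi => /(_ ndd e1).
    by clear; lia.
  by apply: quad_charge; rewrite /quad E eqxx n0.
- have ndd : nd d.
    by rewrite /nondigon eq_sym; case/andP: us; rewrite !inE !negb_or => /and4P[].
  by have := pent_charge ndd E; clear; lia.
Qed.

Lemma sum_given : \sum_d given d = \sum_d received d.
Proof.
rewrite /given -big_mkcond /= [RHS](bigID nd) /= [X in _ = _ + X]big1 ?addn0; last first.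
  by move=> d nnd; rewrite /received bs_digonP.
rewrite [RHS](reindex_onto mate mate) /=; last by move=> d ndd; rewrite mateKP.
apply: eq_bigl => d; rewrite nd_mateP /=; apply/idP/eqP => [ndd|<-]; first exact: mateKP.
exact: nd_mateP.
Qed.

(** Over all faces the transfers cancel and the bundle sizes sum to [#|D|], leaving 92F + 4|D| <=
    46|D|. *)
Lemma face_count : 92 * #|porbits phi| <= 42 * #|D|.
Proof.
have sumF (f : D -> nat) : \sum_d f d = \sum_(F in porbits phi) \sum_(e in F) f e.
  rewrite (partition_big (porbit phi) [in porbits phi]) /=; last by move=> d _; apply: imset_f.
  apply: eq_bigr => F /imsetP[d _ ->]; apply: eq_bigl => e.
  by rewrite eq_porbit_mem.
have sumD : \sum_(F in porbits phi) #|F| = #|D|.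
  transitivity (\sum_(d : D) 1); last by rewrite sum1_card.
  by rewrite sumF; apply: eq_bigr => F _; rewrite sum1_card.
have : \sum_(F in porbits phi) (92 + \sum_(e in F) (4 * bs e + given e)) <=
       \sum_(F in porbits phi) (46 * #|F| + \sum_(e in F) received e).
  by apply: leq_sum => F /imsetP[d _ ->]; apply: face_charge.
rewrite big_split [X in _ <= X]big_split /= -!sumF sum_nat_const.
have -> : \sum_(F in porbits phi) 46 * #|F| = 46 * #|D| by rewrite -big_distrr /= sumD.
have -> : \sum_d (4 * bs d + given d) = 4 * #|D| + \sum_d received d.
  by rewrite big_split /= sum_given -big_distrr /= (sum_bsize inv rot).
have [n ->] : exists n, #|D| = n by exists #|D|.
by move: (\sum_d received d); clear; slia.
Qed.
End Faces.

(** * The theorem *)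

Lemma singletons_weight (V : finType) (G : mgraph V) : wf G -> w_ge0 G -> 1 < #|vset G| ->
  23 * #|vset G| <= e2 (mult G) (vset G) + 42.
Proof.
move=> [_ m0 _] w0 n2; have [x xS] : exists x, x \in vset G by apply/card_gt0P; apply: ltnW.
(* Contracting a single vertex changes nothing, so this is the partition into singletons. *)
have pP : partition (cparts G [set x]) (vset G).
  by apply: cparts_partition; [rewrite sub1set|apply/set0Pn; exists x; rewrite set11].
have one A : A \in cparts G [set x] -> exists y, A = [set y].
  by rewrite in_setU1 => /orP[/eqP ->|/imsetP[y _ ->]]; [exists x|exists y].
have cP : #|cparts G [set x]| = #|vset G|.
  rewrite (card_partition pP) -sum1_card; apply: eq_bigr => A /one[y ->].
  by rewrite cards1.
have iP : is_part G (cparts G [set x]) by rewrite /is_part pP cP.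
have := w0 _ iP; rewrite wG_ge0 // cP -(crE (mult G) pP) [X in _ -> _ <= _ + X + _]big1 ?addn0 //.
by move=> A /one[y ->]; rewrite e2_set1.
Qed.

Lemma planar_edges (V : finType) (G : mgraph V) (D : finType) (tail : D -> V) (inv : {perm D}) :
  wf G -> (forall x y, #|[set d | (tail d == x) && (tail (inv d) == y)]| = mult G x y) ->
  #|D| = e2 (mult G) (vset G) /\ #|[set tail d | d : D]| <= #|vset G|.
Proof.
move=> [mC _ mS] cm.
have inS d : tail d \in vset G /\ tail (inv d) \in vset G.
  by apply: mS; rewrite -cm; apply/card_gt0P; exists d; rewrite inE !eqxx.
split; last by apply/subset_leq_card/subsetP => x /imsetP[d _ ->]; case: (inS d).
transitivity (\sum_(d : D) 1); first by rewrite sum1_card.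
rewrite (partition_big tail [in vset G]) /=; last by move=> d _; case: (inS d).
apply: eq_bigr => x xS.
rewrite (partition_big (fun d => tail (inv d)) [in vset G]) /=; last by move=> d _; case: (inS d).
by apply: eq_bigr => y yS; rewrite -cm -sum1_card; apply: eq_bigl => d; rewrite !inE.
Qed.

Theorem theorem1p11 (V : finType) (G : mgraph V) :
  wf G -> planar G -> #|vset G| != 1 -> w_ge0 G ->
  (forall P, is_part G P -> ~ inN (quot G P)) ->
  (exists H, proper_subgraph H G /\ Ngood H) \/
  (exists G' H, [/\ lifts G G', subgraph H G', Ngood H & Sgood (contract G' (vset H))]) \/
  (exists v G'', [/\ v \in vset G, lifts_at v G G'', Sgood (delv G'' v) &
                   forall P, is_part G'' P -> ~ inN (quot G'' P)]) \/
  #|vset G| <= 4.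
Proof.
move=> wfG [D [tail [inv [rot [inv_ok cm orb euler]]]]] _ w0 _.
have [n4|n5] := leqP #|vset G| 4; first by right; right; right.
apply: NNPP => nope.
have no1 : ~ exists H, proper_subgraph H G /\ Ngood H by move=> H1; apply: nope; left.
have irred : ~ lift_reducible G by move=> H2; apply: nope; right; left.
have no3 : ~ vertex_reducible G by move=> H3; apply: nope; right; right; left.
have wS : 23 * #|vset G| <= e2 (mult G) (vset G) + 42.
  by apply: singletons_weight => //; apply: leq_trans n5.
have bdG := bd_proper wfG no1.
have n6 : 5 < #|vset G|.
  rewrite ltn_neqAle n5 andbT eq_sym; apply/eqP => E5.
  by apply: no3; apply: five_vertices_reducible.
have deg15 v : v \in vset G -> 15 <= \sum_(y in vset G) mult G v y.
  move=> vS; rewrite leqNgt; apply/negP => d14; apply: no3.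
  exact: (low_degree_reducible wfG wS bdG n5 n6 vS).
have [cD nv] := planar_edges wfG cm.
have := face_count wfG wS bdG n6 deg15 irred inv_ok cm orb.
have : 0 < #|[set [set e | connect (fun d e => (e == inv d) || (e == rot d)) d e] | d : D]|.
  have /card_gt0P[d _] : 0 < #|D| by rewrite cD; move: wS n6; clear; lia.
  by apply/card_gt0P; exists [set e | connect (fun d e => (e == inv d) || (e == rot d)) d e]; apply: imset_f.
move: euler nv wS cD; rewrite /face_perm /=.
move: #|porbits _| #|[set tail d | d : D]| #|[set _ | _ in _]| #|vset G| (e2 _ _) => f nv c n e.
have [k ->] : exists k, #|D| = k by exists #|D|.
(* Euler gives 46 nv + 46 f = 23 |D| + 92 c with c >= 1, where f counts faces, nv the vertices met
   by darts and c components. But 46 nv <= 2 |D| + 84 by weight and 46 f <= 21 |D| by discharging,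
   so 92 <= 84. *)
by clear; lia.
Qed.
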